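(* Let $c\in(0,2]$ and let $f\in\mathcal{F}(c)$. Then the logarithmic coefficients $\gamma_n$ of $f$ satisfy $$\sum_{n=1}^{\infty} n^2|\gamma_n|^2\le\frac14\sum_{n=1}^{\infty}|D_n|^2$$ and, for every real $t\le 2$, $$\sum_{n=1}^{\infty}(n+1)^t|\gamma_n|^2\le\frac14\sum_{n=1}^{\infty}\frac{(n+1)^t}{n^2}|D_n|^2,$$ where $D_n$ are the Taylor coefficients in $\psi(z)=1+\sum_{n=1}^\infty D_nz^n$ of the function $$\psi(z)=\begin{cases}\dfrac{(c-1)z}{1-z}\cdot\dfrac{1}{1-(1-z)^{c-1}}, & c\neq 1,\\[2mm] \dfrac{-z}{(1-z)\log(1-z)}, & c=1.\end{cases}$$ Moreover, the first inequality is sharp, i.e. equality holds for some function in $\mathcal{F}(c)$.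
   Context: $\mathbb{D}=\{z\in\mathbb{C}:|z|<1\}$; $\mathcal{A}$ is the class of analytic functions $f$ on $\mathbb{D}$ with $f(0)=0$, $f'(0)=1$. For $c\in(0,3]$, $\mathcal{F}(c)$ is the class of $f\in\mathcal{A}$ with $\operatorname{Re}\left(1+\frac{zf''(z)}{f'(z)}\right)>1-\frac c2$ for all $z\in\mathbb{D}$; equivalently, $1+\frac{zf''(z)}{f'(z)}\prec\frac{1+(c-1)z}{1-z}$, where $\prec$ denotes subordination ($F\prec G$ if $F=G\circ\omega$ for some analytic $\omega:\mathbb{D}\to\mathbb{D}$ with $\omega(0)=0$). The logarithmic coefficients $\gamma_n$ of $f$ are defined by the expansion about the origin $\log\frac{f(z)}{z}=2\sum_{n=1}^{\infty}\gamma_nz^n$, with the branch of the logarithm vanishing at $z=0$. Powers and logarithms of $1-z$ are principal branches, and $\psi(0)=1$ by removing the singularity. Series of nonnegative terms take values in $[0,+\infty]$. *)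

(* Defs.v *)
From Stdlib Require Import Reals.
From Coquelicot Require Import Coquelicot.
Local Open Scope R_scope.

(** Functions on the unit disc are total functions [C -> C]; their values
    outside the disc play no role. *)
Definition unit_disc (z : C) : Prop := Cmod z < 1.

Definition analytic_at (f : C -> C) (z0 : C) : Prop :=
  exists (a : nat -> C) (r : R), 0 < r /\
    forall w : C, Cmod w < r ->
      is_pseries (K := C_AbsRing) (V := C_NormedModule) a w (f (z0 + w)%C).

(** [g(z) = a0 + sum_(n >= 1) a_n z^n] for [z] near [0]; [a 0] is not used. *)
Definition expansion_at_0 (g : C -> C) (a0 : C) (a : nat -> C) : Prop :=
  exists r : R, 0 < r /\
    forall z : C, Cmod z < r ->
      is_pseries (K := C_AbsRing) (V := C_NormedModule)
        (fun n => match n with O => a0 | S _ => a n end) z (g z).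

Definition class_A (f : C -> C) : Prop :=
  (forall z, unit_disc z -> analytic_at f z) /\
  f (RtoC 0) = RtoC 0 /\ C_derive f (RtoC 0) = RtoC 1.

(** [C_derive f z <> 0] is what makes the quotient meaningful: Coquelicot's
    division is total, with [/ 0 = 0]. *)
Definition class_F (c : R) (f : C -> C) : Prop :=
  class_A f /\
  forall z, unit_disc z ->
    C_derive f z <> RtoC 0 /\
    Re (1 + z * C_derive (C_derive f) z / C_derive f z)%C > 1 - c / 2.

Definition Cexp (z : C) : C :=
  (exp (Re z) * cos (Im z), exp (Re z) * sin (Im z)).

(** Principal argument, in [(-PI, PI]] for [z <> 0]. *)
Definition Carg (z : C) : R :=
  if Rlt_dec (Im z) 0 then - acos (Re z / Cmod z) else acos (Re z / Cmod z).

Definition Clog (z : C) : C := (ln (Cmod z), Carg z).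

Definition Cpowr (z : C) (a : R) : C := Cexp (RtoC a * Clog z)%C.

(** The branch of [log (f z / z)] vanishing at [0] is the function [L], which
    is continuous near [0] as the sum of a power series. *)
Definition log_coefficients (f : C -> C) (gamma : nat -> C) : Prop :=
  exists L : C -> C,
    L (RtoC 0) = RtoC 0 /\
    (exists r : R, 0 < r /\
       forall z : C, z <> RtoC 0 -> Cmod z < r -> Cexp (L z) = (f z / z)%C) /\
    expansion_at_0 L (RtoC 0) (fun n => RtoC 2 * gamma n)%C.

Definition psi (c : R) (z : C) : C :=
  if Ceq_dec z (RtoC 0) then RtoC 1
  else if Req_EM_T c 1 then (- z / ((1 - z) * Clog (1 - z)))%C
  else (RtoC (c - 1) * z / (1 - z) * (1 / (1 - Cpowr (1 - z) (c - 1))))%C.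

(** [sum_(n >= 1) u n] in [[0, +oo]], for nonnegative [u]: the partial sums are
    nondecreasing, so [Lim_seq] is their limit, possibly [p_infty]. *)
Definition nnSeries1 (u : nat -> R) : Rbar :=
  Lim_seq (fun N => sum_n_m u 1 N).

(* Main.v *)
Require Import Defs.
From Stdlib Require Import Reals Lra Lia Psatz Classical ClassicalEpsilon.
From Coquelicot Require Import Coquelicot.
Local Open Scope R_scope.

(** Put [h z = 1 + c z / (1 - z)].  The condition defining [class_F c] says that
    [1 + z f'' / f' = h (phi z)] for an analytic [phi] with [|phi z| <= |z|].  The
    function [p = z f' / f] satisfies [p + z p' / p = h o phi], and [q = psi c] satisfies the
    same equation with the identity in place of [phi].  The theorem of
    Eenigenburg, Miller, Mocanu and Reade on this Briot-Bouquet equation gives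
    [p = q o omega] with [|omega z| <= |z|].  As
    [p - 1 = sum of 2 n gamma_n z^n], Rogosinski's inequality for subordinate
    functions yields
    [sum_(n <= N) 4 n^2 |gamma_n|^2 <= sum_(n <= N) |D_n|^2] for every [N].  The
    first claim is the limit of this, and the second follows by summation by
    parts, because [(n + 1)^t / n^2] decreases for [t <= 2].  For the solution of
    [f' = (1 - z)^(-c)] one has [p = q] and all the inequalities are equalities.

    The reciprocals [F = 1 / q] and [1 / p] are used instead of [q] and [p]: their
    equations, [z F' + h F = 1] and [z G' + (h o phi) G = 1], are linear, and no
    information on the zeros of [f] is needed.  The power series of [F] is explicit
    ([recip_psi_coef]): apart from the constant term its coefficients are
    nonpositive, and this gives [Re F > 0].  The derivative of [log q] with respect
    to [h] is [W = log_psi_slope].  It satisfies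
    [z W' + (1 / F + (1 + z) / (1 - z)) W = 1], from which [log_psi_slope_Re_pos]
    follows; hence [F] is injective with nonvanishing derivative
    ([recip_psi_injective]).  The equation [F (omega z) = 1 / p z] then defines
    [omega] wherever it can be solved, and Jack's argument at a first point where
    [|omega z| = kappa |z|] ([radial_bound]) shows that it can be solved in the
    whole disc, with [|omega z| <= |z|].

    Integrals along circles are replaced by means over the [M]-th roots of unity.
    For continuously differentiable functions such means tend to the Cauchy
    integral ([discrete_cauchy_formula]).  This suffices for the maximum principle,
    hence for Schwarz's lemma, and for the mean square estimates behind Rogosinski's
    inequality ([littlewood_mean], [rogosinski_inequality]); no expansion of
    [omega] in a power series is required. *)

(** * Continuity and complex derivatives *)

Ltac Rmin_le := unfold Rmin; repeat destruct Rle_dec; lra.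

Definition near (z : C) (P : C -> Prop) : Prop :=
  exists d, 0 < d /\ forall w, Cmod (w - z) < d -> P w.

Definition ccont (f : C -> C) (z : C) : Prop :=
  forall eps, 0 < eps -> near z (fun w => Cmod (f w - f z) < eps).

Definition has_deriv (f : C -> C) (z l : C) : Prop :=
  forall eps, 0 < eps ->
    near z (fun w => Cmod (f w - f z - l * (w - z)) <= eps * Cmod (w - z)).

Lemma near_and {z} {P} {Q} : near z P -> near z Q -> near z (fun w => P w /\ Q w).
Proof.
intros [d [hd H]] [e [he K]]. exists (Rmin d e). split.
- now apply Rmin_pos.
- intros w hw. pose proof (Rmin_l d e). pose proof (Rmin_r d e).
  split; [apply H | apply K]; lra.
Qed.

Lemma near_imp z (P Q : C -> Prop) : (forall w, P w -> Q w) -> near z P -> near z Q.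
Proof. intros h [d [hd H]]. exists d; auto. Qed.

Lemma near_self z P : near z P -> P z.
Proof.
intros [d [hd H]]. apply H. replace (z - z)%C with (RtoC 0) by ring. now rewrite Cmod_0.
Qed.

Lemma near_near z P : near z P -> near z (fun w => near w P).
Proof.
intros [d [hd H]]. exists d; split; [exact hd|]. intros w hw.
exists (d - Cmod (w - z)). split; [lra|]. intros v hv. apply H.
replace (v - z)%C with ((v - w) + (w - z))%C by ring.
pose proof (Cmod_triangle (v - w) (w - z)). lra.
Qed.

Lemma near_ball z d : 0 < d -> near z (fun w => Cmod (w - z) < d).
Proof. intros hd. exists d; auto. Qed.

Lemma Cmod_triangle_rev (x y : C) : Cmod x - Cmod y <= Cmod (x - y).
Proof.
pose proof (Cmod_triangle (x - y) y). replace (x - y + y)%C with x in H by ring. lra.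
Qed.

Lemma Cmod_sub_sym (x y : C) : Cmod (x - y) = Cmod (y - x).
Proof. rewrite <- Cmod_opp. f_equal. ring. Qed.

Lemma near_disc z r : Cmod z < r -> near z (fun w => Cmod w < r).
Proof.
intros h. exists (r - Cmod z). split; [lra|]. intros w hw.
pose proof (Cmod_triangle_rev w z). lra.
Qed.

Lemma near_neq (z a : C) : z <> a -> near z (fun w => w <> a).
Proof.
intros h. exists (Cmod (z - a)). split.
- apply Cmod_gt_0. intros E. apply h. replace z with (z - a + a)%C by ring. rewrite E; ring.
- intros w hw E. subst w. rewrite Cmod_sub_sym in hw. lra.
Qed.

Lemma Cmod_minus_pos (x y : C) : x <> y -> 0 < Cmod (x - y).
Proof.
intros h. apply Cmod_gt_0. intros E. apply h.
replace x with (x - y + y)%C by ring. rewrite E. ring.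
Qed.

Lemma zero_in_unit_disc : unit_disc 0.
Proof. unfold unit_disc. rewrite Cmod_0. lra. Qed.

Lemma RtoC_neq (x y : R) : x <> y -> RtoC x <> RtoC y.
Proof. intros h e. apply h. now apply RtoC_inj. Qed.

Lemma Ceq_from_Cmod (x y : C) : (forall eps, 0 < eps -> Cmod (x - y) < eps) -> x = y.
Proof.
intros h. apply NNPP. intros E. pose proof (Cmod_minus_pos _ _ E). specialize (h _ H). lra.
Qed.

Lemma ccont_const a z : ccont (fun _ => a) z.
Proof.
intros e he. exists 1; split; [lra|]. intros w _. replace (a - a)%C with (RtoC 0) by ring.
now rewrite Cmod_0.
Qed.

Lemma ccont_id z : ccont (fun w => w) z.
Proof. intros e he. now apply near_ball. Qed.

Lemma ccont_plus f g z : ccont f z -> ccont g z -> ccont (fun w => f w + g w)%C z.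
Proof.
intros hf hg e he. generalize (near_and (hf (e/2) ltac:(lra)) (hg (e/2) ltac:(lra))).
apply near_imp. intros w [h1 h2].
replace (f w + g w - (f z + g z))%C with ((f w - f z) + (g w - g z))%C by ring.
pose proof (Cmod_triangle (f w - f z) (g w - g z)). lra.
Qed.

Lemma ccont_mult f g z : ccont f z -> ccont g z -> ccont (fun w => f w * g w)%C z.
Proof.
intros hf hg e he.
pose proof (Cmod_ge_0 (f z)). pose proof (Cmod_ge_0 (g z)).
destruct (ex_intro (fun A => Cmod (f z) + 1 = A) _ eq_refl) as [A hA].
destruct (ex_intro (fun B => Cmod (g z) + 1 = B) _ eq_refl) as [B hB].
assert (0 < A) by lra. assert (0 < B) by lra.
assert (h1 : 0 < e / (2 * B)) by (apply Rdiv_lt_0_compat; lra).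
assert (h2 : 0 < e / (2 * A)) by (apply Rdiv_lt_0_compat; lra).
generalize (near_and (near_and (hf _ h1) (hf 1 ltac:(lra))) (hg _ h2)).
apply near_imp. intros w [[k1 k0] k2].
replace (f w * g w - f z * g z)%C with ((f w - f z) * g z + f w * (g w - g z))%C by ring.
eapply Rle_lt_trans; [apply Cmod_triangle|]. rewrite !Cmod_mult.
pose proof (Cmod_triangle_rev (f w) (f z)).
pose proof (Cmod_ge_0 (f w - f z)). pose proof (Cmod_ge_0 (g w - g z)).
assert (q0 : Cmod (f w - f z) * Cmod (g z) <= e / (2*B) * Cmod (g z)) by (apply Rmult_le_compat_r; lra).
assert (q3 : Cmod (f w) * Cmod (g w - g z) <= A * Cmod (g w - g z)) by (apply Rmult_le_compat_r; lra).
assert (q1 : A * Cmod (g w - g z) < A * (e / (2*A))) by (apply Rmult_lt_compat_l; lra).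
replace (A * (e / (2*A))) with (e/2) in q1 by (field; lra).
assert (q2 : e / (2*B) * Cmod (g z) <= e / (2*B) * B) by (apply Rmult_le_compat_l; lra).
replace (e / (2*B) * B) with (e/2) in q2 by (field; lra). lra.
Qed.

Lemma ccont_comp f g z : ccont f (g z) -> ccont g z -> ccont (fun w => f (g w)) z.
Proof.
intros hf hg e he. destruct (hf e he) as [d [hd H]].
generalize (hg d hd). apply near_imp. intros w hw. now apply H.
Qed.

Lemma ccont_near f z (P : C -> Prop) : ccont f z -> near (f z) P -> near z (fun w => P (f w)).
Proof.
intros hf [d [hd H]]. generalize (hf d hd). apply near_imp. auto.
Qed.

Lemma ccont_ext f g z : near z (fun w => f w = g w) -> ccont f z -> ccont g z.
Proof.
intros h hf e he. pose proof (near_self _ _ h) as E. cbv beta in E.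
generalize (near_and h (hf e he)). apply near_imp. intros w [h1 h2].
now rewrite <- h1, <- E.
Qed.

Lemma ccont_Cinv z : z <> RtoC 0 -> ccont Cinv z.
Proof.
intros hz e he. assert (0 < Cmod z) by now apply Cmod_gt_0.
set (m := Cmod z) in *.
assert (hd : 0 < e * (m * m / 2)) by (apply Rmult_lt_0_compat; nra).
generalize (near_and (near_and (near_ball z _ hd) (near_ball z (m/2) ltac:(lra)))
  (near_neq z 0 hz)).
apply near_imp. intros w [[h1 h2] h3].
replace (/ w - / z)%C with ((z - w) * / (w * z))%C by (field; split; auto).
rewrite Cmod_mult, Cmod_inv by (apply Cmult_neq_0; auto). rewrite Cmod_mult. fold m.
rewrite Cmod_sub_sym.
pose proof (Cmod_triangle_rev z w). rewrite Cmod_sub_sym in H0. fold m in H0.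
assert (hw : m / 2 < Cmod w) by lra.
apply Rmult_lt_reg_r with (Cmod w * m); [nra|]. rewrite Rmult_assoc, Rinv_l, Rmult_1_r by nra.
eapply Rlt_le_trans; [exact h1|]. apply Rmult_le_compat_l; nra.
Qed.

Lemma ccont_inv f z : ccont f z -> f z <> RtoC 0 -> ccont (fun w => / f w)%C z.
Proof. intros hf h. apply (ccont_comp Cinv f); auto. now apply ccont_Cinv. Qed.

Lemma ccont_opp f z : ccont f z -> ccont (fun w => - f w)%C z.
Proof.
intros hf e he. generalize (hf e he). apply near_imp. intros w h.
replace (- f w - - f z)%C with (- (f w - f z))%C by ring. now rewrite Cmod_opp.
Qed.

Lemma ccont_minus f g z : ccont f z -> ccont g z -> ccont (fun w => f w - g w)%C z.
Proof. intros. apply ccont_plus; auto. now apply ccont_opp. Qed.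

Lemma ccont_div f g z : ccont f z -> ccont g z -> g z <> RtoC 0 -> ccont (fun w => f w / g w)%C z.
Proof. intros. apply ccont_mult; auto. now apply ccont_inv. Qed.

Lemma ccont_pow f z n : ccont f z -> ccont (fun w => f w ^ n)%C z.
Proof.
intros h. induction n; simpl. apply ccont_const. now apply ccont_mult.
Qed.

Lemma ccont_neq f z a : ccont f z -> f z <> a -> near z (fun w => f w <> a).
Proof. intros hf h. apply (ccont_near f z (fun y => y <> a)); auto. now apply near_neq. Qed.

(** Caratheodory's form of differentiability, which turns the differentiation
    rules into algebra on slope functions and rules for continuity. *)
Lemma has_deriv_slope f z l : has_deriv f z l <->
  exists s, ccont s z /\ s z = l /\ forall w, f w = (f z + s w * (w - z))%C.
Proof.
split.
- intros h. exists (fun w => if Ceq_dec w z then l else ((f w - f z) / (w - z))%C).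
  split; [|split].
  + intros e he. generalize (h (e/2) ltac:(lra)). apply near_imp. intros w hw.
    destruct (Ceq_dec z z) as [_|n]; [|congruence].
    destruct (Ceq_dec w z) as [->|n].
    * replace (l - l)%C with (RtoC 0) by ring. now rewrite Cmod_0.
    * pose proof (Cmod_minus_pos _ _ n).
      assert (n' : (w - z)%C <> RtoC 0) by (apply Cmod_gt_0; auto).
      replace ((f w - f z) / (w - z) - l)%C with ((f w - f z - l * (w - z)) / (w - z))%C
        by (field; auto).
      rewrite Cmod_div by auto.
      apply Rlt_div_l; auto.
      eapply Rle_lt_trans; [exact hw|]. apply Rmult_lt_compat_r; lra.
  + destruct (Ceq_dec z z); congruence.
  + intros w. destruct (Ceq_dec w z) as [->|n]; [ring|].
    field. pose proof (Cmod_minus_pos _ _ n). apply Cmod_gt_0; auto.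
- intros [s [hs [<- H]]] e he. generalize (hs e he). apply near_imp. intros w hw.
  rewrite (H w). replace (f z + s w * (w - z) - f z - s z * (w - z))%C
    with ((s w - s z) * (w - z))%C by ring.
  rewrite Cmod_mult. apply Rmult_le_compat_r; [apply Cmod_ge_0|]. lra.
Qed.

Lemma has_deriv_ext f g z l : near z (fun w => f w = g w) -> has_deriv f z l -> has_deriv g z l.
Proof.
intros h hf e he. pose proof (near_self _ _ h) as E. cbv beta in E.
generalize (near_and h (hf e he)). apply near_imp. intros w [h1 h2].
now rewrite <- h1, <- E.
Qed.

Lemma has_deriv_eq f z l l' : has_deriv f z l -> l = l' -> has_deriv f z l'.
Proof. now intros h <-. Qed.

Lemma has_deriv_cont f z l : has_deriv f z l -> ccont f z.
Proof.
intros h. apply has_deriv_slope in h. destruct h as [s [hs [_ H]]].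
apply ccont_ext with (fun w => f z + s w * (w - z))%C.
- exists 1; split; [lra|]. intros; now rewrite <- H.
- apply ccont_plus; [apply ccont_const|]. apply ccont_mult; auto.
  apply ccont_minus; [apply ccont_id|apply ccont_const].
Qed.

Lemma has_deriv_const a z : has_deriv (fun _ => a) z 0.
Proof.
apply has_deriv_slope. exists (fun _ => RtoC 0). split; [apply ccont_const|]. split; auto.
intros; ring.
Qed.

Lemma has_deriv_id z : has_deriv (fun w => w) z 1.
Proof.
apply has_deriv_slope. exists (fun _ => RtoC 1). split; [apply ccont_const|]. split; auto.
intros; ring.
Qed.

Lemma has_deriv_plus f g z l m : has_deriv f z l -> has_deriv g z m ->
  has_deriv (fun w => f w + g w)%C z (l + m).
Proof.
rewrite !has_deriv_slope. intros [s [hs [<- H]]] [t [ht [<- K]]].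
exists (fun w => s w + t w)%C. split; [now apply ccont_plus|]. split; auto.
intros w. rewrite (H w), (K w). ring.
Qed.

Lemma has_deriv_mult f g z l m : has_deriv f z l -> has_deriv g z m ->
  has_deriv (fun w => f w * g w)%C z (l * g z + f z * m).
Proof.
intros hf hg. pose proof (has_deriv_cont _ _ _ hg) as cg. revert hf hg.
rewrite !has_deriv_slope. intros [s [hs [<- H]]] [t [ht [<- K]]].
exists (fun w => s w * g w + f z * t w)%C. split.
- apply ccont_plus; apply ccont_mult; auto. apply ccont_const.
- split; auto. intros w. rewrite (H w), (K w). ring.
Qed.

Lemma has_deriv_opp f z l : has_deriv f z l -> has_deriv (fun w => - f w)%C z (- l).
Proof.
intros h. apply has_deriv_slope in h. destruct h as [s [hs [<- H]]].
apply has_deriv_slope. exists (fun w => - s w)%C. split; [now apply ccont_opp|]. split; auto.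
intros w. rewrite (H w). ring.
Qed.

Lemma has_deriv_minus f g z l m : has_deriv f z l -> has_deriv g z m ->
  has_deriv (fun w => f w - g w)%C z (l - m).
Proof. intros. apply has_deriv_plus; auto. now apply has_deriv_opp. Qed.

Lemma has_deriv_scal a f z l : has_deriv f z l -> has_deriv (fun w => a * f w)%C z (a * l).
Proof.
intros h. eapply has_deriv_eq; [apply has_deriv_mult; [apply has_deriv_const|exact h]|cbv beta; ring].
Qed.

Lemma has_deriv_comp f g z l m : has_deriv f (g z) l -> has_deriv g z m ->
  has_deriv (fun w => f (g w)) z (l * m).
Proof.
intros hf hg. pose proof (has_deriv_cont _ _ _ hg) as cg. revert hf hg.
rewrite !has_deriv_slope. intros [s [hs [<- H]]] [t [ht [<- K]]].
exists (fun w => s (g w) * t w)%C. split.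
- apply ccont_mult; auto. now apply ccont_comp.
- split; auto. intros w. rewrite (H (g w)). rewrite (K w) at 2. ring.
Qed.

Lemma has_deriv_Cinv z : z <> RtoC 0 -> has_deriv Cinv z (- / (z * z)).
Proof.
intros hz. 
apply has_deriv_ext with (fun w => / z + (- / (w * z)) * (w - z))%C.
- generalize (near_neq z 0 hz). apply near_imp. intros w hw. field. auto.
- apply has_deriv_slope. exists (fun w => - / (w * z))%C. split; [|split; auto].
  + apply ccont_opp, ccont_inv.
    * apply ccont_mult; [apply ccont_id|apply ccont_const].
    * now apply Cmult_neq_0.
  + intros w. ring.
Qed.

Lemma has_deriv_inv f z l : has_deriv f z l -> f z <> RtoC 0 ->
  has_deriv (fun w => / f w)%C z (- l / (f z * f z)).
Proof.
intros hf h. eapply has_deriv_eq.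
- apply (has_deriv_comp Cinv f); [now apply has_deriv_Cinv|exact hf].
- field. auto.
Qed.

Lemma has_deriv_div f g z l m : has_deriv f z l -> has_deriv g z m -> g z <> RtoC 0 ->
  has_deriv (fun w => f w / g w)%C z ((l * g z - f z * m) / (g z * g z)).
Proof.
intros hf hg h. eapply has_deriv_eq.
- apply has_deriv_mult; [exact hf|]. now apply has_deriv_inv; [exact hg|].
- cbv beta; field. auto.
Qed.

Lemma has_deriv_pow f z l n : has_deriv f z l ->
  has_deriv (fun w => f w ^ n)%C z (RtoC (INR n) * f z ^ (pred n) * l).
Proof.
intros h. induction n.
- eapply has_deriv_eq; [exact (has_deriv_const 1 z)|]. simpl. ring.
- eapply has_deriv_eq.
  + change (fun w => f w ^ S n)%C with (fun w => f w * f w ^ n)%C.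
    apply has_deriv_mult; [exact h|exact IHn].
  + rewrite S_INR, RtoC_plus. destruct n; cbn [pred Cpow INR]; ring.
Qed.

(** Differentiability of an inverse branch comes from its continuity alone. *)
Lemma has_deriv_implicit q p g z dq dp : ccont g z ->
  near z (fun w => q (g w) = p w) ->
  has_deriv q (g z) dq -> dq <> RtoC 0 -> has_deriv p z dp ->
  has_deriv g z (dp / dq).
Proof.
intros cg E hq ndq hp. apply has_deriv_slope in hq, hp.
destruct hq as [s [hs [<- H]]], hp as [t [ht [<- K]]].
apply has_deriv_ext with (fun w => g z + t w / s (g w) * (w - z))%C.
- pose proof (near_self _ _ E) as Ez. cbv beta in Ez.
  assert (csg : ccont (fun w => s (g w)) z) by now apply ccont_comp.
  generalize (near_and E (ccont_neq _ _ _ csg ndq)). apply near_imp.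
  intros w [h1 h2]. rewrite (H (g w)), (K w), Ez in h1.
  assert (h3 : (s (g w) * (g w - g z) = t w * (w - z))%C).
  { replace (s (g w) * (g w - g z))%C with (p z + s (g w) * (g w - g z) - p z)%C by ring.
    rewrite h1. ring. }
  replace (g w) with (g z + (s (g w) * (g w - g z)) / s (g w))%C at 2 by (field; auto).
  rewrite h3. field. auto.
- apply has_deriv_slope. exists (fun w => t w / s (g w))%C. split; [|split; auto].
  + apply ccont_div; auto. now apply ccont_comp.
  + intros w. ring.
Qed.

Lemma has_deriv_C_derive f z l : has_deriv f z l -> C_derive f z = l.
Proof.
intros h. apply is_C_derive_unique. split.
- apply is_linear_scal_l.
- intros x hx.
  rewrite <- (is_filter_lim_locally_unique (K := C_AbsRing)
    (V := AbsRing_NormedModule C_AbsRing) z x hx). clear x hx.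
  intros eps. destruct (h eps (cond_pos eps)) as [d [hd H]].
  exists (mkposreal d hd). intros w hw.
  change (Cmod (w - z) < d) in hw.
  change (Cmod (f w - f z - (w - z) * l) <= eps * Cmod (w - z)).
  rewrite (Cmult_comm (w - z)). now apply H.
Qed.

Lemma has_deriv_unique f z l m : has_deriv f z l -> has_deriv f z m -> l = m.
Proof. intros h1 h2. rewrite <- (has_deriv_C_derive _ _ _ h1). now apply has_deriv_C_derive. Qed.

(** * Mean values, compactness and open mappings *)

Lemma Re_mult_le (x y : C) : Re (x * y) <= Cmod x * Cmod y.
Proof. rewrite <- Cmod_mult. eapply Rle_trans; [apply Rle_abs|apply re_le_Cmod]. Qed.

Lemma im_le_Cmod (z : C) : Rabs (Im z) <= Cmod z.
Proof. pose proof (Rmax_Cmod z). pose proof (Rmax_r (Rabs (fst z)) (Rabs (snd z))). unfold Im. lra. Qed.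

Lemma Cmod_le_abs (z : C) : Cmod z <= Rabs (Re z) + Rabs (Im z).
Proof.
pose proof (Cmod_triangle (RtoC (Re z)) (Ci * RtoC (Im z))).
rewrite Cmod_mult, Cmod_Ci, !Cmod_R, Rmult_1_l in H.
replace (RtoC (Re z) + Ci * RtoC (Im z))%C with z in H; [exact H|].
destruct z as [x y]. unfold RtoC, Ci, Cplus, Cmult, Re, Im; simpl. f_equal; ring.
Qed.

Lemma is_derive_along_line G l (a x v : C) (t : R) : has_deriv G (x + RtoC t * v)%C l ->
  is_derive (fun s : R => Re (a * G (x + RtoC s * v)%C)) t (Re (a * l * v)).
Proof.
intros h. apply is_derive_Reals. intros eps heps.
pose proof (Cmod_ge_0 a). pose proof (Cmod_ge_0 v).
set (k := Cmod a * Cmod v + 1).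
assert (hk : 0 < k) by (unfold k; nra).
destruct (h (eps / 2 / k)) as [d [hd H1]]. { apply Rdiv_lt_0_compat; lra. }
assert (hd' : 0 < d / (Cmod v + 1)) by (apply Rdiv_lt_0_compat; lra).
exists (mkposreal _ hd'). intros s hs hsd. simpl in hsd.
specialize (H1 (x + RtoC (t + s) * v)%C).
replace (x + RtoC (t + s) * v - (x + RtoC t * v))%C with (RtoC s * v)%C in H1
  by (rewrite RtoC_plus; ring).
rewrite Cmod_mult, Cmod_R in H1.
assert (hp : 0 < Rabs s) by now apply Rabs_pos_lt.
assert (h2 : Rabs s * Cmod v < d).
{ apply Rle_lt_trans with (Rabs s * (Cmod v + 1)); [nra|].
  apply Rmult_lt_reg_r with (/ (Cmod v + 1)); [apply Rinv_0_lt_compat; lra|].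
  rewrite Rmult_assoc, Rinv_r, Rmult_1_r by lra. exact hsd. }
specialize (H1 h2).
set (E := (G (x + RtoC (t + s) * v) - G (x + RtoC t * v) - l * (RtoC s * v))%C) in *.
replace ((Re (a * G (x + RtoC (t + s) * v)%C) - Re (a * G (x + RtoC t * v)%C)) / s - Re (a * l * v))
  with (Re (a * E) / s).
2:{ unfold E. 
    generalize (G (x + RtoC (t + s) * v)%C), (G (x + RtoC t * v)%C). intros p q.
    destruct a, l, v, p, q. unfold Re, Cminus, Cplus, Cmult, Copp, RtoC; simpl. field. auto. }
unfold Rdiv at 1. rewrite Rabs_mult, Rabs_inv.
apply Rmult_lt_reg_r with (Rabs s); [exact hp|].
rewrite Rmult_assoc, Rinv_l, Rmult_1_r by lra.
eapply Rle_lt_trans; [apply re_le_Cmod|]. rewrite Cmod_mult.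
apply Rle_lt_trans with (Cmod a * (eps / 2 / k * (Rabs s * Cmod v))).
{ apply Rmult_le_compat_l; auto. }
replace (Cmod a * (eps / 2 / k * (Rabs s * Cmod v))) with
  (eps / 2 / k * (Cmod a * Cmod v) * Rabs s) by ring.
apply Rmult_lt_compat_r; [exact hp|].
apply Rle_lt_trans with (eps / 2 / k * k).
{ apply Rmult_le_compat_l; [|unfold k; lra]. left. apply Rdiv_lt_0_compat; lra. }
unfold Rdiv. rewrite Rmult_assoc, Rinv_l by lra. lra.
Qed.

Lemma Cconj_mult_Re (D : C) : Re (Cconj D * D) = Cmod D ^ 2.
Proof. rewrite Cmod2_alt. destruct D; unfold Cconj, Cmult, Re, Im; simpl. ring. Qed.

Lemma MVT_along_line G G' (a x v : C) :
  (forall s, 0 <= s <= 1 -> has_deriv G (x + RtoC s * v)%C (G' (x + RtoC s * v)%C)) ->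
  exists s, 0 <= s <= 1 /\
    Re (a * (G (x + v) - G x))%C = Re (a * G' (x + RtoC s * v) * v)%C.
Proof.
intros hG.
destruct (MVT_cor2 (fun s : R => Re (a * G (x + RtoC s * v)%C))
  (fun s => Re (a * G' (x + RtoC s * v) * v)%C) 0 1 ltac:(lra)) as [s [H hs]].
- intros s hs. apply is_derive_Reals. apply is_derive_along_line. auto.
- exists s; split; [lra|].
  replace (x + RtoC 1 * v)%C with (x + v)%C in H by ring.
  replace (x + RtoC 0 * v)%C with x in H by ring.
  rewrite Rminus_0_r, Rmult_1_r in H. rewrite <- H.
  generalize (G (x + v)%C), (G x). intros p q.
  destruct a, p, q. unfold Re, Cminus, Cplus, Cmult, Copp; simpl. ring.
Qed.

Lemma mean_value_inequality G G' (x y : C) K :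
  (forall s, 0 <= s <= 1 -> has_deriv G (x + RtoC s * (y - x))%C (G' (x + RtoC s * (y - x))%C)
     /\ Cmod (G' (x + RtoC s * (y - x))%C) <= K) ->
  Cmod (G y - G x) <= K * Cmod (y - x).
Proof.
intros hG.
destruct (MVT_along_line G G' (Cconj (G y - G x)) x (y - x)%C) as [s [hs H]].
{ intros s hs. now apply hG. }
replace (x + (y - x))%C with y in H by ring.
rewrite Cconj_mult_Re in H.
set (D := (G y - G x)%C) in *.
assert (h0 : Cmod D ^ 2 <= Cmod D * (K * Cmod (y - x))).
{ rewrite H. rewrite <- Cmult_assoc. eapply Rle_trans; [apply Re_mult_le|].
  rewrite Cmod_conj. apply Rmult_le_compat_l; [apply Cmod_ge_0|].
  rewrite Cmod_mult. apply Rmult_le_compat_r; [apply Cmod_ge_0|]. now apply hG. }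
destruct (Rle_lt_or_eq_dec 0 (Cmod D) (Cmod_ge_0 D)) as [p|e].
- apply Rmult_le_reg_l with (Cmod D); [exact p|]. simpl in h0. lra.
- rewrite <- e. apply Rmult_le_pos; [|apply Cmod_ge_0].
  destruct (hG 0 ltac:(lra)) as [_ h]. eapply Rle_trans; [apply Cmod_ge_0|exact h].
Qed.

Lemma segment_in_ball (x y z : C) d s : 0 <= s <= 1 ->
  Cmod (x - z) < d -> Cmod (y - z) < d -> Cmod (x + RtoC s * (y - x) - z) < d.
Proof.
intros hs hx hy.
replace (x + RtoC s * (y - x) - z)%C with (RtoC (1 - s) * (x - z) + RtoC s * (y - z))%C
  by (rewrite RtoC_minus; ring).
eapply Rle_lt_trans; [apply Cmod_triangle|].
rewrite !Cmod_mult, !Cmod_R, !Rabs_pos_eq by lra.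
set (m := Rmax (Cmod (x - z)) (Cmod (y - z))).
assert (Cmod (x - z) <= m) by apply Rmax_l. assert (Cmod (y - z) <= m) by apply Rmax_r.
assert (m < d) by now apply Rmax_lub_lt.
assert ((1 - s) * Cmod (x - z) <= (1 - s) * m) by (apply Rmult_le_compat_l; lra).
assert (s * Cmod (y - z) <= s * m) by (apply Rmult_le_compat_l; lra). lra.
Qed.

Lemma zero_deriv_constant G z0 r : 
  (forall w, Cmod (w - z0) < r -> has_deriv G w 0) ->
  forall w, Cmod (w - z0) < r -> G w = G z0.
Proof.
intros h w hw. apply Ceq_from_Cmod. intros eps heps.
eapply Rle_lt_trans; [|exact heps].
rewrite <- (Rmult_0_l (Cmod (w - z0))).
apply mean_value_inequality with (fun _ => RtoC 0).
intros s hs. split; [|rewrite Cmod_0; lra]. apply h. apply segment_in_ball; auto.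
replace (z0 - z0)%C with (RtoC 0) by ring. rewrite Cmod_0.
pose proof (Cmod_ge_0 (w - z0)). lra.
Qed.

Lemma bounded_seq_adherent (u : nat -> C) K : (forall n, Cmod (u n) <= K) ->
  exists l, forall eps, 0 < eps -> forall N, exists n, (N <= n)%nat /\ Cmod (u n - l) < eps.
Proof.
intros hK.
assert (BW : forall v : nat -> R, (forall n, Rabs (v n) <= K) ->
  exists l, forall eps, 0 < eps -> forall N, exists n, (N <= n)%nat /\ Rabs (v n - l) < eps).
{ intros v hv.
  destruct (Bolzano_Weierstrass v (fun x => -K <= x <= K)) as [l hl].
  - apply compact_P3.
  - intros n. apply Rabs_le_between, hv.
  - exists l. intros eps heps N.
    destruct (hl (disc l (mkposreal _ heps)) N) as [n [hn hp]].
    + exists (mkposreal _ heps). intros x hx; exact hx.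
    + exists n; split; [exact hn|]. exact hp. }
destruct (BW (fun n => Re (u n))) as [lx hx].
{ intros n. eapply Rle_trans; [apply re_le_Cmod|apply hK]. }
assert (ch : forall k, exists n, (k <= n)%nat /\ Rabs (Re (u n) - lx) < / (INR k + 1)).
{ intros k. apply hx. apply Rinv_0_lt_compat. pose proof (pos_INR k); lra. }
destruct (choice _ ch) as [phi hphi].
destruct (BW (fun n => Im (u (phi n)))) as [ly hy].
{ intros n. eapply Rle_trans; [apply im_le_Cmod|apply hK]. }
exists (lx, ly). intros eps heps N.
destruct (archimed_cor1 (eps/2) ltac:(lra)) as [N0 [hN0 hN0']].
destruct (hy (eps/2) ltac:(lra) (Nat.max N N0)) as [k [hk h2]].
exists (phi k). destruct (hphi k) as [h3 h4]. split; [lia|].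
eapply Rle_lt_trans; [apply Cmod_le_abs|].
change (Re (u (phi k) - (lx, ly))%C) with (Re (u (phi k)) - lx).
change (Im (u (phi k) - (lx, ly))%C) with (Im (u (phi k)) - ly).
assert (/ (INR k + 1) <= / INR N0).
{ apply Rinv_le_contravar; [now apply lt_0_INR|]. 
  assert (INR N0 <= INR k) by (apply le_INR; lia). lra. }
lra.
Qed.

Lemma min_modulus_attained (A : C -> Prop) (g : C -> C) K a :
  (forall z, A z -> Cmod z <= K) ->
  (forall z, ~ A z -> near z (fun w => ~ A w)) ->
  (forall z, A z -> ccont g z) -> A a ->
  exists z0, A z0 /\ forall z, A z -> Cmod (g z0) <= Cmod (g z).
Proof.
intros hK hcl hg ha.
destruct (completeness (fun x => exists z, A z /\ x = - Cmod (g z))) as [m [hm1 hm2]].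
- exists 0. intros x [z [_ ->]]. pose proof (Cmod_ge_0 (g z)). lra.
- exists (- Cmod (g a)). now exists a.
- assert (hs : forall n : nat, exists z, A z /\ Cmod (g z) < - m + / (INR n + 1)).
  { intros n. apply NNPP. intros hn.
    assert (hp : 0 < / (INR n + 1)) by (apply Rinv_0_lt_compat; pose proof (pos_INR n); lra).
    assert (m <= m - / (INR n + 1)); [|lra].
    apply hm2. intros x [z [hz ->]]. apply Rnot_lt_le. intros hlt. apply hn.
    exists z; split; auto. lra. }
  destruct (choice _ hs) as [u hu].
  destruct (bounded_seq_adherent u K) as [z0 hz0]. { intros n. apply hK, hu. }
  assert (hA : A z0).
  { apply NNPP. intros n. destruct (hcl _ n) as [d [hd H]].
    destruct (hz0 d hd O) as [k [_ hk]]. apply (H _ hk), hu. }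
  exists z0. split; auto. intros z hz.
  apply Rle_trans with (- m).
  2:{ assert (- Cmod (g z) <= m) by (apply hm1; now exists z). lra. }
  apply Rnot_lt_le. intros hlt. set (eps := (Cmod (g z0) + m) / 2).
  assert (heps : 0 < eps) by (unfold eps; lra).
  destruct (hg z0 hA eps heps) as [d [hd H]].
  destruct (archimed_cor1 eps heps) as [N0 [hN0 hN0']].
  destruct (hz0 d hd N0) as [k [hk hk2]].
  specialize (H _ hk2). destruct (hu k) as [_ h3].
  pose proof (Cmod_triangle_rev (g z0) (g (u k))). rewrite Cmod_sub_sym in H0.
  assert (/ (INR k + 1) <= / INR N0).
  { apply Rinv_le_contravar; [now apply lt_0_INR|]. 
    assert (INR N0 <= INR k) by (apply le_INR; lia). lra. }
  unfold eps in *. lra.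
Qed.

Lemma near_not_closed_disc z r : ~ (Cmod z <= r) -> near z (fun w => ~ Cmod w <= r).
Proof.
intros h. exists (Cmod z - r). split; [lra|]. intros w hw h'.
pose proof (Cmod_triangle_rev z w). rewrite Cmod_sub_sym in H. lra.
Qed.

(** The continuity method: an open condition that fails somewhere in a disc
    fails at a point of least modulus, before which it holds. *)
Lemma first_failure (Good : C -> Prop) z1 :
  (forall z, Cmod z <= Cmod z1 -> Good z -> near z Good) -> ~ Good z1 ->
  exists z0, Cmod z0 <= Cmod z1 /\ ~ Good z0 /\ forall z, Cmod z < Cmod z0 -> Good z.
Proof.
intros hop hb.
destruct (min_modulus_attained (fun z => Cmod z <= Cmod z1 /\ ~ Good z) (fun z => z) (Cmod z1) z1)
  as [z0 [[h1 h2] h3]].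
- tauto.
- intros z hz. destruct (classic (Cmod z <= Cmod z1)) as [h|h].
  + assert (hG : Good z) by (apply NNPP; tauto).
    generalize (hop z h hG). apply near_imp. tauto.
  + generalize (near_not_closed_disc _ _ h). apply near_imp. tauto.
- intros; apply ccont_id.
- split; auto. lra.
- exists z0. split; [auto|split; auto]. intros z hz. apply NNPP. intros hn.
  assert (Cmod z0 <= Cmod z); [|lra]. apply h3. split; auto. lra.
Qed.

Lemma near_radial z0 P : z0 <> RtoC 0 -> near z0 P -> exists z, Cmod z < Cmod z0 /\ P z.
Proof.
intros hz [d [hd H]]. assert (hm : 0 < Cmod z0) by now apply Cmod_gt_0.
set (s := Rmin (/2) (d / 2 / Cmod z0)).
assert (hs : 0 < s <= / 2) by (split; [apply Rmin_pos; [lra|apply Rdiv_lt_0_compat; lra]|apply Rmin_l]).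
exists (RtoC (1 - s) * z0)%C. split.
- rewrite Cmod_mult, Cmod_R, Rabs_pos_eq by lra. nra.
- apply H. replace (RtoC (1 - s) * z0 - z0)%C with (- (RtoC s * z0))%C by (rewrite RtoC_minus; ring).
  rewrite Cmod_opp, Cmod_mult, Cmod_R, Rabs_pos_eq by lra.
  assert (s <= d / 2 / Cmod z0) by apply Rmin_r. apply Rle_div_r in H0; lra.
Qed.

Lemma Re_RtoC_mult (s : R) (z : C) : Re (RtoC s * z) = s * Re z.
Proof. destruct z; unfold RtoC, Cmult, Re; simpl. ring. Qed.

(** The boundary half of Jack's lemma.  Moving from [z0] in the directions
    [(-1 + i t) z0], all of which point into the disc, gives a linear inequality
    in [z0 l] for every real [t]. *)
Lemma deriv_at_radial_minimum g z0 l : z0 <> RtoC 0 -> has_deriv g z0 l ->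
  (forall z, Cmod z < Cmod z0 -> Re (g z0) <= Re (g z)) ->
  Im (z0 * l) = 0 /\ Re (z0 * l) <= 0.
Proof.
intros hz hd hmin.
assert (hz' : 0 < Cmod z0) by now apply Cmod_gt_0.
assert (key : forall t : R, 0 <= Re ((-1, t) * (z0 * l))%C).
{ intros t. apply Rnot_lt_le. intros hneg.
  set (v := ((-1, t) * z0)%C).
  set (m := - Re ((-1, t) * (z0 * l))%C).
  pose proof (Cmod_ge_0 v).
  destruct (hd (m / 2 / (Cmod v + 1))) as [d [hd1 H1]].
  { apply Rdiv_lt_0_compat; unfold m; lra. }
  set (s := Rmin (d / 2 / (Cmod v + 1)) (/ (1 + t * t))).
  assert (hs : 0 < s).
  { apply Rmin_pos; [apply Rdiv_lt_0_compat; lra|apply Rinv_0_lt_compat; nra]. }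
  assert (hs1 : s * Cmod v < d).
  { apply Rle_lt_trans with (d / 2 / (Cmod v + 1) * (Cmod v + 1)).
    - apply Rmult_le_compat; try lra. apply Rmin_l.
    - unfold Rdiv. rewrite Rmult_assoc, Rinv_l by lra. lra. }
  assert (hs2 : s * (1 + t * t) <= 1).
  { apply Rle_trans with (/ (1 + t*t) * (1 + t * t)).
    - apply Rmult_le_compat_r; [nra|]. apply Rmin_r.
    - rewrite Rinv_l by nra. lra. }
  specialize (H1 (z0 + RtoC s * v)%C).
  replace (z0 + RtoC s * v - z0)%C with (RtoC s * v)%C in H1 by ring.
  rewrite Cmod_mult, Cmod_R, Rabs_pos_eq in H1 by lra.
  specialize (H1 hs1).
  assert (hin : Cmod (z0 + RtoC s * v) < Cmod z0).
  { unfold v. replace (z0 + RtoC s * ((-1, t) * z0))%C with (((1 - s)%R, (s * t)%R) * z0)%C.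
    2:{ destruct z0; unfold RtoC, Cplus, Cmult; simpl; f_equal; ring. }
    rewrite Cmod_mult. rewrite <- (Rmult_1_l (Cmod z0)) at 2.
    apply Rmult_lt_compat_r; [exact hz'|].
    apply Rsqr_incrst_0; [|apply Cmod_ge_0|lra].
    rewrite !Rsqr_pow2, Cmod2_alt. unfold Re, Im; simpl. nra. }
  specialize (hmin _ hin).
  set (E := (g (z0 + RtoC s * v) - g z0 - l * (RtoC s * v))%C) in *.
  assert (hE : Re (g (z0 + RtoC s * v)%C) = Re (g z0) + Re E + - s * m).
  { unfold E, m, v. generalize (g (z0 + RtoC s * ((-1, t) * z0))%C), (g z0). intros p q.
    destruct p, q, l, z0. unfold Re, RtoC, Cminus, Cplus, Copp, Cmult; simpl. ring. }
  assert (Re E <= m / 2 / (Cmod v + 1) * (s * Cmod v)).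
  { eapply Rle_trans; [|exact H1]. eapply Rle_trans; [apply Rle_abs|apply re_le_Cmod]. }
  assert (m / 2 / (Cmod v + 1) * (s * Cmod v) <= s * (m / 2)).
  { replace (m / 2 / (Cmod v + 1) * (s * Cmod v)) with (s * (m / 2 * (Cmod v / (Cmod v + 1)))) by (field; lra).
    apply Rmult_le_compat_l; [lra|]. rewrite <- (Rmult_1_r (m/2)) at 2.
    apply Rmult_le_compat_l; [unfold m; lra|].
    apply Rmult_le_reg_r with (Cmod v + 1); [lra|]. unfold Rdiv. rewrite Rmult_assoc, Rinv_l by lra. lra. }
  assert (0 < s * m) by (apply Rmult_lt_0_compat; unfold m; lra). lra. }
set (w := (z0 * l)%C) in *. clearbody w. destruct w as [X Y].
unfold Re, Im, Cmult in *; simpl in *.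
assert (Y = 0).
{ apply NNPP. intros hY. specialize (key ((1 - X) / Y)).
  replace (-1 * X - (1 - X) / Y * Y) with (-1) in key by (field; auto). lra. }
split; auto. specialize (key 0). lra.
Qed.

(** Minimise [|F - y|] over a small closed disc.  On its boundary the value is
    larger than at the centre, so the minimum is interior; as [F'] does not
    vanish there, a Newton step would decrease a positive minimum. *)
Lemma open_mapping F F' z0 : 
  near z0 (fun z => has_deriv F z (F' z) /\ F' z <> RtoC 0) ->
  forall e, 0 < e -> near (F z0) (fun y => exists z, Cmod (z - z0) < e /\ F z = y).
Proof.
intros [d0 [hd0 H0]] e he.
assert (hz0 : Cmod (z0 - z0) = 0) by (replace (z0 - z0)%C with (RtoC 0) by ring; apply Cmod_0).
destruct (H0 z0 ltac:(lra)) as [hF hF0].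
set (m := Cmod (F' z0)). assert (hm : 0 < m) by now apply Cmod_gt_0.
destruct (hF (m/2) ltac:(lra)) as [d1 [hd1 H1]].
set (r := Rmin (e/2) (Rmin (d0/2) (d1/2))).
assert (hr : 0 < r) by (unfold r; repeat apply Rmin_pos; lra).
assert (r <= e/2) by apply Rmin_l.
assert (r <= d0/2) by (unfold r; Rmin_le).
assert (r <= d1/2) by (unfold r; Rmin_le).
exists (r * m / 4). split; [apply Rdiv_lt_0_compat; nra|]. intros y hy.
destruct (min_modulus_attained (fun z => Cmod (z - z0) <= r) (fun z => F z - y)%C (Cmod z0 + r) z0)
  as [z1 [h1 h2]].
- intros z hz. pose proof (Cmod_triangle_rev z z0). lra.
- intros z hz. exists (Cmod (z - z0) - r). split; [lra|]. intros w hw h'.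
  pose proof (Cmod_triangle_rev (z - z0) (w - z0)) as tr.
  replace (z - z0 - (w - z0))%C with (z - w)%C in tr by ring. rewrite Cmod_sub_sym in hw. lra.
- intros z hz. apply ccont_minus; [|apply ccont_const].
  destruct (H0 z ltac:(lra)) as [hz1 _]. now apply has_deriv_cont in hz1.
- lra.
- exists z1. split; [lra|].
  apply NNPP. intros hne.
  assert (hb : Cmod (z1 - z0) < r).
  { apply Rnot_le_lt. intros hge.
    assert (heq : Cmod (z1 - z0) = r) by lra.
    specialize (H1 z1 ltac:(lra)). rewrite heq in H1.
    pose proof (Cmod_triangle_rev (F' z0 * (z1 - z0)) (F' z0 * (z1 - z0) - (F z1 - F z0))) as tr.
    replace (F' z0 * (z1 - z0) - (F' z0 * (z1 - z0) - (F z1 - F z0)))%C with (F z1 - F z0)%C in tr by ring.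
    rewrite Cmod_mult, heq in tr. fold m in tr.
    replace (F' z0 * (z1 - z0) - (F z1 - F z0))%C with (- (F z1 - F z0 - F' z0 * (z1 - z0)))%C in tr by ring.
    rewrite Cmod_opp in tr.
    specialize (h2 z0 ltac:(lra)).
    pose proof (Cmod_triangle (F z1 - y) (y - F z0)) as tr2.
    replace (F z1 - y + (y - F z0))%C with (F z1 - F z0)%C in tr2 by ring.
    rewrite (Cmod_sub_sym (F z0) y) in h2. nra. }
  destruct (H0 z1 ltac:(lra)) as [k1 k2].
  set (q := (y - F z1)%C). assert (hq : 0 < Cmod q).
  { apply Cmod_minus_pos. intros E; apply hne; auto. }
  assert (hm1 : 0 < Cmod (F' z1)) by now apply Cmod_gt_0.
  destruct (k1 (Cmod (F' z1) / 2) ltac:(lra)) as [d2 [hd2 H4]].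
  set (v := (q / F' z1)%C).
  assert (hv : Cmod v = Cmod q / Cmod (F' z1)) by (unfold v; now rewrite Cmod_div).
  assert (hv0 : 0 < Cmod v) by (rewrite hv; now apply Rdiv_lt_0_compat).
  set (s := Rmin (/2) (Rmin (d2 / 2 / Cmod v) ((r - Cmod (z1 - z0)) / Cmod v))).
  assert (hs : 0 < s) by (unfold s; repeat apply Rmin_pos; try apply Rdiv_lt_0_compat; lra).
  assert (hs1 : s <= /2) by apply Rmin_l.
  assert (hs2 : s * Cmod v <= d2 / 2).
  { apply Rle_trans with (d2 / 2 / Cmod v * Cmod v).
    - apply Rmult_le_compat_r; [lra|]. eapply Rle_trans; [apply Rmin_r|apply Rmin_l].
    - right. field. lra. }
  assert (hs3 : s * Cmod v <= r - Cmod (z1 - z0)).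
  { apply Rle_trans with ((r - Cmod (z1 - z0)) / Cmod v * Cmod v).
    - apply Rmult_le_compat_r; [lra|]. eapply Rle_trans; [apply Rmin_r|apply Rmin_r].
    - right. field. lra. }
  specialize (H4 (z1 + RtoC s * v)%C).
  replace (z1 + RtoC s * v - z1)%C with (RtoC s * v)%C in H4 by ring.
  rewrite Cmod_mult, Cmod_R, Rabs_pos_eq in H4 by lra.
  specialize (H4 ltac:(lra)).
  specialize (h2 (z1 + RtoC s * v)%C).
  assert (hin : Cmod (z1 + RtoC s * v - z0) <= r).
  { replace (z1 + RtoC s * v - z0)%C with ((z1 - z0) + RtoC s * v)%C by ring.
    eapply Rle_trans; [apply Cmod_triangle|]. rewrite Cmod_mult, Cmod_R, Rabs_pos_eq by lra. lra. }
  specialize (h2 hin).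
  set (E := (F (z1 + RtoC s * v) - F z1 - F' z1 * (RtoC s * v))%C) in *.
  replace (F (z1 + RtoC s * v) - y)%C with (E - RtoC (1 - s) * q)%C in h2.
  2:{ unfold E, v, q. rewrite RtoC_minus. field. auto. }
  assert (Cmod (E - RtoC (1 - s) * q) <= Cmod E + (1 - s) * Cmod q).
  { eapply Rle_trans; [apply Cmod_triangle|]. rewrite Cmod_opp, Cmod_mult, Cmod_R, Rabs_pos_eq by lra. lra. }
  replace (Cmod (F' z1) / 2 * (s * Cmod v)) with (s * Cmod q / 2) in H4 by (rewrite hv; field; lra).
  replace (Cmod (F z1 - y)) with (Cmod q) in h2 by (unfold q; apply Cmod_sub_sym).
  assert (0 < s * Cmod q) by nra. lra.
Qed.

(** * A discrete Cauchy formula *)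

Fixpoint csum (u : nat -> C) (n : nat) : C :=
  match n with O => RtoC 0 | S n => (csum u n + u n)%C end.

Lemma csum_ext u v n : (forall k, (k < n)%nat -> u k = v k) -> csum u n = csum v n.
Proof.
induction n; intros h; [auto|]. cbn. rewrite IHn, h by (intros; auto; apply h; lia).
auto.
Qed.

Lemma csum_plus u v n : csum (fun k => u k + v k)%C n = (csum u n + csum v n)%C.
Proof. induction n; cbn; [ring|rewrite IHn; ring]. Qed.

Lemma csum_scal a u n : csum (fun k => a * u k)%C n = (a * csum u n)%C.
Proof. induction n; cbn; [ring|rewrite IHn; ring]. Qed.

Lemma csum_minus u v n : csum (fun k => u k - v k)%C n = (csum u n - csum v n)%C.
Proof. induction n; cbn; [ring|rewrite IHn; ring]. Qed.

Lemma csum_const a n : csum (fun _ => a) n = (RtoC (INR n) * a)%C.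
Proof. induction n; [cbn; ring|]. cbn [csum]. rewrite IHn, S_INR, RtoC_plus. ring. Qed.

Lemma csum_swap (u : nat -> nat -> C) n m :
  csum (fun i => csum (fun j => u i j) m) n = csum (fun j => csum (fun i => u i j) n) m.
Proof.
induction n; cbn.
- induction m; cbn; [auto|]. rewrite <- IHm. ring.
- rewrite IHn. now rewrite <- csum_plus.
Qed.

Lemma csum_telescope u n : csum (fun k => u (S k) - u k)%C n = (u n - u O)%C.
Proof. induction n; cbn; [ring|rewrite IHn; ring]. Qed.

Lemma Cmod_csum_le u n B : (forall k, (k < n)%nat -> Cmod (u k) <= B) -> Cmod (csum u n) <= INR n * B.
Proof.
induction n; intros h; cbn [csum].
- rewrite Cmod_0. cbn. lra.
- rewrite S_INR. eapply Rle_trans; [apply Cmod_triangle|].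
  assert (Cmod (csum u n) <= INR n * B) by (apply IHn; intros; apply h; lia).
  assert (Cmod (u n) <= B) by (apply h; lia). lra.
Qed.

Lemma has_deriv_csum (u du : nat -> C -> C) n z :
  (forall k, (k < n)%nat -> has_deriv (u k) z (du k z)) ->
  has_deriv (fun w => csum (fun k => u k w) n) z (csum (fun k => du k z) n).
Proof.
induction n; intros h; cbn.
- apply has_deriv_const.
- apply has_deriv_plus; [apply IHn; intros; apply h; lia|apply h; lia].
Qed.

Lemma csum_geometric x n : ((1 - x) * csum (fun k => x ^ k) n = 1 - x ^ n)%C.
Proof.
induction n; cbn [csum Cpow]; [ring|]. rewrite Cmult_plus_distr_l, IHn. ring.
Qed.

Definition unit_root (M : nat) : C := (cos (2 * PI / INR M), sin (2 * PI / INR M)).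

Lemma unit_root_pow M k :
  (unit_root M ^ k)%C = (cos (INR k * (2 * PI / INR M)), sin (INR k * (2 * PI / INR M))).
Proof.
induction k.
- cbn [Cpow]. replace (INR 0 * (2 * PI / INR M)) with 0 by (cbn; ring). now rewrite cos_0, sin_0.
- cbn [Cpow]. rewrite IHk, S_INR. unfold unit_root.
  rewrite Rmult_plus_distr_r, Rmult_1_l, cos_plus, sin_plus.
  unfold Cmult; cbn. f_equal; ring.
Qed.

Lemma Cmod_unit_root M : Cmod (unit_root M) = 1.
Proof.
assert (E : Cmod (unit_root M) ^ 2 = 1).
{ rewrite Cmod2_alt. unfold unit_root, Re, Im; cbn [fst snd].
  pose proof (sin2_cos2 (2 * PI / INR M)). unfold Rsqr in H. lra. }
pose proof (Cmod_ge_0 (unit_root M)). nra.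
Qed.

Lemma unit_root_order M : (0 < M)%nat -> (unit_root M ^ M)%C = RtoC 1.
Proof.
intros hM. rewrite unit_root_pow.
replace (INR M * (2 * PI / INR M)) with (2 * PI).
- now rewrite cos_2PI, sin_2PI.
- field. apply not_0_INR. lia.
Qed.

Lemma unit_root_primitive M j : (0 < j < M)%nat -> (unit_root M ^ j)%C <> RtoC 1.
Proof.
intros hj E. rewrite unit_root_pow in E. apply (f_equal fst) in E. cbn [fst RtoC] in E.
set (x := INR j * (2 * PI / INR M)) in *.
assert (hM : 0 < INR M) by (apply lt_0_INR; lia).
assert (hj0 : 0 < INR j) by (apply lt_0_INR; lia).
assert (hjM : INR j < INR M) by (apply lt_INR; lia).
pose proof PI_RGT_0.
assert (0 < sin (x / 2)).
{ apply sin_gt_0; unfold x.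
  - apply Rmult_lt_0_compat; [|lra]. apply Rmult_lt_0_compat; [lra|]. apply Rdiv_lt_0_compat; lra.
  - replace (INR j * (2 * PI / INR M) / 2) with (PI * (INR j / INR M)) by (field; lra).
    rewrite <- (Rmult_1_r PI) at 2. apply Rmult_lt_compat_l; auto.
    apply Rlt_div_l; lra. }
replace x with (2 * (x / 2)) in E by field. rewrite cos_2a_sin in E. nra.
Qed.

Lemma unit_root_neq_0 M : unit_root M <> RtoC 0.
Proof. apply Cmod_gt_0. rewrite Cmod_unit_root. lra. Qed.

Lemma unit_root_near_1 M : (0 < M)%nat -> Cmod (unit_root M - 1) <= 2 * PI / INR M.
Proof.
intros hM. assert (h : 0 < INR M) by (apply lt_0_INR; lia). pose proof PI_RGT_0.
set (x := 2 * PI / INR M).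
assert (hx : 0 < x) by (unfold x; apply Rdiv_lt_0_compat; lra).
assert (E : Cmod (unit_root M - 1) ^ 2 = (2 * sin (x / 2)) ^ 2).
{ rewrite Cmod2_alt. unfold unit_root. fold x.
  replace (Re ((cos x, sin x) - 1)%C) with (cos x - 1) by (unfold Re; cbn; ring).
  replace (Im ((cos x, sin x) - 1)%C) with (sin x) by (unfold Im; cbn; ring).
  replace (cos x) with (cos (2 * (x/2))) by (f_equal; field).
  replace (sin x) with (sin (2 * (x/2))) by (f_equal; field).
  rewrite cos_2a_sin, sin_2a. pose proof (sin2_cos2 (x/2)). unfold Rsqr in H0. nra. }
assert (E2 : Cmod (unit_root M - 1) ^ 2 <= x ^ 2).
{ rewrite E. assert (sin (x/2) < x/2) by (apply sin_lt_x; lra).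
  assert (hM1 : 1 <= INR M) by (apply (le_INR 1); lia).
  assert (0 <= sin (x/2)).
  { apply sin_ge_0; [lra|]. unfold x. apply Rmult_le_reg_r with (INR M); auto. 
    replace (2 * PI / INR M / 2 * INR M) with PI by (field; lra). nra. }
  nra. }
pose proof (Cmod_ge_0 (unit_root M - 1)). nra.
Qed.

Definition circle (r : R) (M k : nat) : C := (RtoC r * unit_root M ^ k)%C.

Definition cmean (r : R) (M : nat) (g : C -> C) : C :=
  (csum (fun k => g (circle r M k)) M / RtoC (INR M))%C.

Lemma Cmod_circle r M k : 0 <= r -> Cmod (circle r M k) = r.
Proof.
intros hr. unfold circle. rewrite Cmod_mult, Cmod_R, Cmod_pow, Cmod_unit_root, pow1, Rabs_pos_eq; lra.
Qed.

Lemma RtoC_INR_neq_0 M : (0 < M)%nat -> RtoC (INR M) <> RtoC 0.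
Proof. intros h E. apply RtoC_inj in E. apply (not_0_INR M); [lia|auto]. Qed.

Lemma cmean_ext r M g h : (forall k, g (circle r M k) = h (circle r M k)) -> cmean r M g = cmean r M h.
Proof. intros E. unfold cmean. f_equal. apply csum_ext; auto. Qed.

Lemma cmean_scal r M a g : cmean r M (fun z => a * g z)%C = (a * cmean r M g)%C.
Proof. unfold cmean. rewrite csum_scal. unfold Cdiv. ring. Qed.

Lemma Cmod_cmean_le r M g B : 0 <= B -> (forall k, (k < M)%nat -> Cmod (g (circle r M k)) <= B) ->
  Cmod (cmean r M g) <= B.
Proof.
intros hB h. unfold cmean. destruct M.
- cbn. unfold Cdiv. rewrite Cmult_0_l, Cmod_0. auto.
- assert (0 < INR (S M)) by (apply lt_0_INR; lia).
  rewrite Cmod_div by (apply RtoC_INR_neq_0; lia).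
  rewrite Cmod_R, Rabs_pos_eq by lra.
  apply Rle_div_l; auto. rewrite (Rmult_comm B). now apply Cmod_csum_le.
Qed.

Lemma csum_root_powers M x : (0 < M)%nat -> (x ^ M)%C = RtoC 1 -> x <> RtoC 1 ->
  csum (fun k => x ^ k)%C M = RtoC 0.
Proof.
intros hM h1 h2. pose proof (csum_geometric x M) as E. rewrite h1 in E.
assert (n : (1 - x)%C <> RtoC 0).
{ intros e. apply h2. replace x with (1 - (1 - x))%C by ring. rewrite e. ring. }
replace (csum (fun k => x ^ k)%C M) with ((1 - x) * csum (fun k => x ^ k)%C M / (1 - x))%C
  by (field; auto).
rewrite E. field. auto.
Qed.

Lemma Cpow_swap (x : C) j k : ((x ^ j) ^ k = (x ^ k) ^ j)%C.
Proof. now rewrite <- !Cpow_mult_r, Nat.mul_comm. Qed.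

Lemma Cpow_1_l n : (RtoC 1 ^ n)%C = RtoC 1.
Proof. induction n; cbn; [auto|rewrite IHn; ring]. Qed.

(** The mean of the Cauchy kernel: expand [(1 - (a/r)^M) z / (z - a)] as a
    geometric sum in [a / z] and use the orthogonality of the roots of unity. *)
Lemma cmean_cauchy_kernel r M a : 0 < r -> Cmod a < r -> (0 < M)%nat ->
  (cmean r M (fun z => z / (z - a)) * (1 - (a / RtoC r) ^ M))%C = RtoC 1.
Proof.
intros hr ha hM.
assert (hrC : RtoC r <> RtoC 0) by (apply RtoC_neq; lra).
assert (hzk : forall k, circle r M k <> RtoC 0).
{ intros k. apply Cmod_gt_0. rewrite Cmod_circle; lra. }
assert (hza : forall k, (circle r M k - a)%C <> RtoC 0).
{ intros k. apply Cmod_gt_0. apply Cmod_minus_pos. intros e.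
  rewrite <- e, Cmod_circle in ha; lra. }
assert (hu : (/ unit_root M)%C <> RtoC 0).
{ intros e. apply (unit_root_neq_0 M). 
  replace (unit_root M) with (/ / unit_root M)%C by (field; apply unit_root_neq_0).
  rewrite e. unfold Cinv; cbn. unfold RtoC; f_equal; unfold Rdiv; ring. }
unfold cmean.
assert (E : csum (fun k => (circle r M k / (circle r M k - a)) * (1 - (a / r) ^ M))%C M
  = csum (fun k => csum (fun j => (a / r) ^ j * ((/ unit_root M) ^ j) ^ k)%C M) M).
{ apply csum_ext. intros k hk.
  assert (hx : (1 - a / circle r M k)%C <> RtoC 0).
  { replace (1 - a / circle r M k)%C with ((circle r M k - a) / circle r M k)%C by (field; auto).
    intros e. apply (hza k). 
    replace (circle r M k - a)%C with ((circle r M k - a) / circle r M k * circle r M k)%C by (field; auto).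
    rewrite e. ring. }
  assert (E1 : (a / circle r M k)%C = (a / r * (/ unit_root M) ^ k)%C).
  { unfold circle. rewrite Cpow_inv by apply unit_root_neq_0. field. split; auto.
    apply Cpow_nz, unit_root_neq_0. }
  assert (E2 : ((a / r) ^ M = (a / circle r M k) ^ M)%C).
  { rewrite E1, Cpow_mult_l, Cpow_swap, Cpow_inv, unit_root_order by (auto; apply unit_root_neq_0).
    replace (/ 1)%C with (RtoC 1) by field. rewrite Cpow_1_l. ring. }
  rewrite E2, <- csum_geometric.
  replace (circle r M k / (circle r M k - a) * ((1 - a / circle r M k) *
     csum (fun k0 : nat => (a / circle r M k) ^ k0) M))%C
   with (csum (fun k0 : nat => (a / circle r M k) ^ k0)%C M) by (field; split; auto).
  apply csum_ext. intros j hj. rewrite E1, Cpow_mult_l, Cpow_swap. ring. }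
rewrite csum_swap in E.
assert (E3 : csum (fun j => csum (fun i => (a / r) ^ j * ((/ unit_root M) ^ j) ^ i)%C M) M = RtoC (INR M)).
{ destruct M as [|m]; [lia|]. set (M := S m) in *.
  rewrite (csum_ext _ (fun j => if Nat.eq_dec j 0 then RtoC (INR M) else RtoC 0)).
  - assert (G : forall n, csum (fun j => if Nat.eq_dec j 0 then RtoC (INR M) else RtoC 0) (S n) = RtoC (INR M)).
    { induction n; cbn [csum Nat.eq_dec]; [cbn; ring|]. cbn [csum] in IHn. rewrite IHn. cbn; ring. }
    apply G.
  - intros j hj. rewrite csum_scal. destruct (Nat.eq_dec j 0) as [->|n0].
    + cbn [Cpow]. rewrite (csum_ext _ (fun _ => RtoC 1)) by (intros; apply Cpow_1_l).
      rewrite csum_const. ring.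
    + rewrite csum_root_powers; [ring|auto| |].
      * rewrite Cpow_swap, Cpow_inv, unit_root_order by (auto; apply unit_root_neq_0).
        replace (/ 1)%C with (RtoC 1) by field. apply Cpow_1_l.
      * rewrite Cpow_inv by apply unit_root_neq_0. intros e.
        apply (unit_root_primitive M j); [lia|].
        replace (unit_root M ^ j)%C with (/ / unit_root M ^ j)%C
          by (field; apply Cpow_nz, unit_root_neq_0).
        rewrite e. field. }
rewrite E3 in E.
assert (E4 : csum (fun k => (circle r M k / (circle r M k - a)) * (1 - (a / r) ^ M))%C M
   = ((1 - (a / r) ^ M) * csum (fun k => circle r M k / (circle r M k - a)) M)%C).
{ rewrite <- csum_scal. apply csum_ext. intros; ring. }
rewrite E4 in E.
replace (csum (fun k => circle r M k / (circle r M k - a)) M / INR M * (1 - (a / r) ^ M))%C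
  with ((1 - (a / r) ^ M) * csum (fun k => circle r M k / (circle r M k - a)) M / INR M)%C
  by (unfold Cdiv; ring).
rewrite E. field. now apply RtoC_INR_neq_0.
Qed.

(** Locally this is the mean value inequality for [w |-> g w - g' y * w]; a
    failure at every scale would accumulate at some point of [A]. *)
Lemma uniform_differentiability g g' (A : C -> Prop) K :
  (forall z, A z -> Cmod z <= K) ->
  (forall z, ~ A z -> near z (fun w => ~ A w)) ->
  (forall z, A z -> near z (fun w => has_deriv g w (g' w)) /\ ccont g' z) ->
  forall eps, 0 < eps -> exists d, 0 < d /\ forall y y', A y -> Cmod (y' - y) < d ->
    Cmod (g y' - g y - g' y * (y' - y)) <= eps * Cmod (y' - y).
Proof.
intros hK hcl hg eps heps. apply NNPP. intros hn.
assert (hs : forall n : nat, exists p : C * C, A (fst p) /\ Cmod (snd p - fst p) < / (INR n + 1) /\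
   ~ Cmod (g (snd p) - g (fst p) - g' (fst p) * (snd p - fst p)) <= eps * Cmod (snd p - fst p)).
{ intros n. apply NNPP. intros hn'. apply hn. exists (/ (INR n + 1)). split.
  - apply Rinv_0_lt_compat. pose proof (pos_INR n). lra.
  - intros y y' h1 h2. apply NNPP. intros h3. apply hn'. exists (y, y'). auto. }
destruct (choice _ hs) as [u hu].
destruct (bounded_seq_adherent (fun n => fst (u n)) K) as [l hl].
{ intros n. apply hK, hu. }
assert (hA : A l).
{ apply NNPP. intros n. destruct (hcl _ n) as [d [hd H]].
  destruct (hl d hd O) as [k [_ hk]]. apply (H _ hk), hu. }
destruct (hg l hA) as [h1 h2].
destruct (near_and h1 (h2 (eps/2) ltac:(lra))) as [d [hd H]].
destruct (archimed_cor1 (d/2) ltac:(lra)) as [N0 [hN0 hN0']].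
destruct (hl (d/2) ltac:(lra) N0) as [k [hk hk2]].
destruct (hu k) as [u1 [u2 u3]]. apply u3.
set (y := fst (u k)) in *. set (y' := snd (u k)) in *.
assert (/ (INR k + 1) <= / INR N0).
{ apply Rinv_le_contravar; [now apply lt_0_INR|]. 
  assert (INR N0 <= INR k) by (apply le_INR; lia). lra. }
assert (hy' : Cmod (y' - l) < d).
{ replace (y' - l)%C with ((y' - y) + (y - l))%C by ring.
  pose proof (Cmod_triangle (y' - y) (y - l)). lra. }
pose proof (mean_value_inequality (fun w => g w - g' y * w)%C (fun w => g' w - g' y)%C y y' eps) as MV.
replace (g y' - g y - g' y * (y' - y))%C with (g y' - g' y * y' - (g y - g' y * y))%C by ring.
apply MV. intros s hs'.
assert (hin : Cmod (y + RtoC s * (y' - y) - l) < d) by (apply segment_in_ball; auto; lra).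
destruct (H _ hin) as [k1 k2]. split.
- eapply has_deriv_eq; [apply has_deriv_minus; [exact k1|apply has_deriv_scal, has_deriv_id]|].
  ring.
- destruct (H y ltac:(lra)) as [_ k3].
  replace (g' (y + s * (y' - y)) - g' y)%C with ((g' (y + s * (y' - y)) - g' l) - (g' y - g' l))%C by ring.
  eapply Rle_trans; [apply Cmod_triangle|]. rewrite Cmod_opp. lra.
Qed.

Lemma pow_lt_1_small x eps : 0 <= x < 1 -> 0 < eps -> exists N, forall n, (N <= n)%nat -> x ^ n < eps.
Proof.
intros hx he. destruct (pow_lt_1_zero x) with (y := eps) as [N hN]; auto.
- rewrite Rabs_pos_eq; lra.
- exists N. intros n hn. specialize (hN n hn). rewrite Rabs_pos_eq in hN; auto. apply pow_le; lra.
Qed.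

(** Cauchy's formula for a removable point, with the integral replaced by
    means over the [M]-th roots of unity.  Shrinking the circle towards [a] by
    the homothety of ratio [t] changes the mean by a quantity whose
    [t]-derivative is, up to the uniform differentiability error, a telescoping
    sum around the closed polygon. *)
Theorem discrete_cauchy_formula g g' a r R0 :
  Cmod a < r -> r < R0 -> ccont g a ->
  (forall z, Cmod z < R0 -> z <> a -> has_deriv g z (g' z) /\ ccont g' z) ->
  forall eps, 0 < eps -> exists M0, forall M, (M0 <= M)%nat ->
    Cmod (cmean r M (fun z => g z * (z / (z - a)))%C - g a) < eps.
Proof.
intros ha hrR ca hg eps heps.
pose proof (Cmod_ge_0 a) as ha0. assert (hr : 0 < r) by lra.
set (rho := r - Cmod a). assert (hrho : 0 < rho) by (unfold rho; lra).
set (Kk := r / rho). assert (hKk : 0 < Kk) by (apply Rdiv_lt_0_compat; lra).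
assert (he1 : 0 < eps / (4 * Kk)) by (apply Rdiv_lt_0_compat; lra).
destruct (ca _ he1) as [d0 [hd0 H0]].
set (t0 := Rmin 1 (d0 / (4 * r))).
assert (ht0 : 0 < t0) by (apply Rmin_pos; [lra|apply Rdiv_lt_0_compat; lra]).
assert (ht01 : t0 <= 1) by apply Rmin_l.
assert (ht0d : t0 * (2 * r) < d0).
{ apply Rle_lt_trans with (d0 / (4 * r) * (2 * r)).
  - apply Rmult_le_compat_r; [lra|apply Rmin_r].
  - replace (d0 / (4 * r) * (2 * r)) with (d0 / 2) by (field; lra). lra. }
set (A := fun z => Cmod z <= r /\ t0 * rho <= Cmod (z - a)).
assert (htr : 0 < t0 * rho) by (apply Rmult_lt_0_compat; lra).
destruct (uniform_differentiability g g' A r) with (eps := eps / (4 * r)) as [d [hd Hd]].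
{ now intros z [h _]. }
{ intros z hz. destruct (classic (Cmod z <= r)) as [h|h].
  - assert (h' : Cmod (z - a) < t0 * rho) by (apply Rnot_le_lt; intros h'; apply hz; split; auto).
    exists (t0 * rho - Cmod (z - a)). split; [lra|]. intros w hw [_ k].
    pose proof (Cmod_triangle (w - z) (z - a)) as tr.
    replace (w - z + (z - a))%C with (w - a)%C in tr by ring. lra.
  - generalize (near_not_closed_disc _ _ h). apply near_imp. intros w hw [k _]; auto. }
{ intros z [hz1 hz2].
  assert (hza : z <> a).
  { intros ->. replace (a - a)%C with (RtoC 0) in hz2 by ring. rewrite Cmod_0 in hz2. lra. }
  split; [|apply hg; auto; lra].
  generalize (near_and (near_disc z R0 ltac:(lra)) (near_neq z a hza)).
  apply near_imp. intros w [k1 k2]. now apply hg. }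
{ apply Rdiv_lt_0_compat; lra. }
(* how large M must be: the polygon has sides shorter than d, and (|a|/r)^M is small *)
assert (hq : 0 <= Cmod a / r < 1).
{ split; [apply Rdiv_le_0_compat; lra|]. apply Rlt_div_l; lra. }
assert (hga : 0 < eps / (4 * Kk * (Cmod (g a) + 1))).
{ pose proof (Cmod_ge_0 (g a)). apply Rdiv_lt_0_compat; [lra|]. apply Rmult_lt_0_compat; lra. }
destruct (pow_lt_1_small _ _ hq hga) as [N1 hN1].
pose proof PI_RGT_0 as hPI.
destruct (archimed_cor1 (d / (2 * PI * r + 1))) as [N2 [hN2 hN2']].
{ apply Rdiv_lt_0_compat; [lra|]. assert (0 < 2 * PI * r) by (apply Rmult_lt_0_compat; lra). lra. }
exists (Nat.max 2 (Nat.max N1 N2)). intros M hM.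
assert (hM0 : (0 < M)%nat) by lia.
assert (hMR : 0 < INR M) by (apply lt_0_INR; lia).
set (e := unit_root M).
assert (he : Cmod (e - 1) * r < d).
{ apply Rle_lt_trans with (2 * PI / INR M * r).
  { apply Rmult_le_compat_r; [lra|]. now apply unit_root_near_1. }
  assert (/ INR M <= / INR N2) by (apply Rinv_le_contravar; [apply lt_0_INR|apply le_INR]; lia).
  assert (h2 : 0 < 2 * PI * r) by (apply Rmult_lt_0_compat; lra).
  apply Rle_lt_trans with ((2 * PI * r) * / INR N2).
  - replace (2 * PI / INR M * r) with ((2 * PI * r) * / INR M) by (unfold Rdiv; ring).
    apply Rmult_le_compat_l; lra.
  - apply Rlt_trans with ((2 * PI * r) * (d / (2 * PI * r + 1))).
    + apply Rmult_lt_compat_l; lra.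
    + replace ((2 * PI * r) * (d / (2 * PI * r + 1))) with (d - d / (2 * PI * r + 1)) by (field; lra).
      assert (0 < d / (2 * PI * r + 1)) by (apply Rdiv_lt_0_compat; lra). lra. }
assert (he1' : (e - 1)%C <> RtoC 0).
{ intros E. apply (unit_root_primitive M 1); [lia|]. cbn [Cpow].
  replace (unit_root M) with (e - 1 + 1)%C by (unfold e; ring). rewrite E. ring. }
set (zt := fun k => circle r M k).
assert (hzt : forall k, Cmod (zt k) = r) by (intros; apply Cmod_circle; lra).
assert (hztS : forall k, zt (S k) = (zt k * e)%C).
{ intros k. unfold zt, circle, e. cbn [Cpow]. ring. }
assert (hrho' : forall k, rho <= Cmod (zt k - a)).
{ intros k. pose proof (Cmod_triangle_rev (zt k) a). rewrite hzt in H. unfold rho. lra. }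
assert (hzta : forall k, (zt k - a)%C <> RtoC 0).
{ intros k. apply Cmod_gt_0. specialize (hrho' k). lra. }
set (kap := fun k => (zt k / (zt k - a))%C).
assert (hkap : forall k, Cmod (kap k) <= Kk).
{ intros k. unfold kap. rewrite Cmod_div, hzt by auto. unfold Kk, Rdiv.
  apply Rmult_le_compat_l; [lra|]. apply Rinv_le_contravar; auto. }
set (I := fun t : C => (csum (fun k => g (a + t * (zt k - a)) * kap k) M / RtoC (INR M))%C).
set (I' := fun t : C => (csum (fun k => zt k * g' (a + t * (zt k - a))) M / RtoC (INR M))%C).
assert (hA : forall (t : R) k, t0 <= t <= 1 -> A (a + RtoC t * (zt k - a))%C).
{ intros t k ht. split.
  - replace (a + RtoC t * (zt k - a))%C with (RtoC (1 - t) * a + RtoC t * zt k)%C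
      by (rewrite RtoC_minus; ring).
    eapply Rle_trans; [apply Cmod_triangle|].
    rewrite !Cmod_mult, !Cmod_R, !Rabs_pos_eq, hzt by lra.
    assert ((1 - t) * Cmod a <= (1 - t) * r) by (apply Rmult_le_compat_l; lra). lra.
  - replace (a + RtoC t * (zt k - a) - a)%C with (RtoC t * (zt k - a))%C by ring.
    rewrite Cmod_mult, Cmod_R, Rabs_pos_eq by lra.
    apply Rmult_le_compat; try lra. auto. }
assert (Hdiff : forall t : R, t0 <= t <= 1 -> has_deriv I (RtoC t) (I' (RtoC t)) /\ Cmod (I' (RtoC t)) <= eps / 4).
{ intros t ht. split.
  - unfold I, I', Cdiv. eapply has_deriv_eq.
    + apply has_deriv_mult; [|apply has_deriv_const].
      apply (has_deriv_csum (fun k t => g (a + t * (zt k - a)) * kap k)%C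
        (fun k t => zt k * g' (a + t * (zt k - a)))%C).
      intros k hk. destruct (hA t k ht) as [q1 q2].
      assert (hne : (a + RtoC t * (zt k - a))%C <> a).
      { intros E. rewrite E in q2. replace (a - a)%C with (RtoC 0) in q2 by ring.
        rewrite Cmod_0 in q2. lra. }
      destruct (hg (a + RtoC t * (zt k - a))%C ltac:(lra) hne) as [q3 _].
      eapply has_deriv_eq.
      * apply has_deriv_mult; [|apply has_deriv_const].
        apply (has_deriv_comp g (fun t => a + t * (zt k - a))%C); [exact q3|].
        apply has_deriv_plus; [apply has_deriv_const|].
        apply has_deriv_mult; [apply has_deriv_id|apply has_deriv_const].
      * cbv beta. unfold kap. field. auto.
    + cbv beta. ring.
  - (* the increments of g around the polygon sum to 0, and their linear parts give I' *)
    assert (htC : RtoC t <> RtoC 0) by (apply RtoC_neq; lra).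
    set (y := fun k => (a + RtoC t * (zt k - a))%C).
    assert (tel : csum (fun k => g (y (S k)) - g (y k))%C M = RtoC 0).
    { rewrite (csum_telescope (fun k => g (y k))). replace (y M) with (y O); [ring|].
      unfold y, zt, circle. rewrite unit_root_order by auto. cbn [Cpow]. auto. }
    assert (B : Cmod (csum (fun k => g (y (S k)) - g (y k) - g' (y k) * (y (S k) - y k))%C M)
       <= INR M * (eps / (4 * r) * (t * (r * Cmod (e - 1))))).
    { apply Cmod_csum_le. intros k hk.
      replace (t * (r * Cmod (e - 1))) with (Cmod (y (S k) - y k)).
      - apply Hd; [apply hA; auto|].
        unfold y. rewrite hztS.
        replace (a + RtoC t * (zt k * e - a) - (a + RtoC t * (zt k - a)))%C
         with (RtoC t * (zt k * (e - 1)))%C by ring.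
        rewrite !Cmod_mult, Cmod_R, Rabs_pos_eq, hzt by lra.
        pose proof (Cmod_ge_0 (e - 1)).
        assert (0 <= r * Cmod (e - 1)) by (apply Rmult_le_pos; lra). nra.
      - unfold y. rewrite hztS.
        replace (a + RtoC t * (zt k * e - a) - (a + RtoC t * (zt k - a)))%C
         with (RtoC t * (zt k * (e - 1)))%C by ring.
        now rewrite !Cmod_mult, Cmod_R, Rabs_pos_eq, hzt by lra. }
    rewrite csum_minus, tel in B.
    replace (csum (fun k => g' (y k) * (y (S k) - y k))%C M) with
      (RtoC t * (e - 1) * csum (fun k => zt k * g' (y k)) M)%C in B.
    2:{ rewrite <- csum_scal. apply csum_ext. intros k hk. unfold y. rewrite hztS. ring. }
    replace (0 - RtoC t * (e - 1) * csum (fun k => zt k * g' (y k)) M)%C with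
      (- (RtoC t * (e - 1) * csum (fun k => zt k * g' (y k)) M))%C in B by ring.
    rewrite Cmod_opp, !Cmod_mult, Cmod_R, Rabs_pos_eq in B by lra.
    assert (he0 : 0 < Cmod (e - 1)) by now apply Cmod_gt_0.
    unfold I'. fold y. rewrite Cmod_div by now apply RtoC_INR_neq_0.
    rewrite Cmod_R, Rabs_pos_eq by lra.
    apply Rmult_le_reg_r with (t * Cmod (e - 1) * INR M).
    { repeat apply Rmult_lt_0_compat; lra. }
    set (S := Cmod (csum (fun k => zt k * g' (y k)) M)%C) in *.
    change (Cmod (csum (fun k => zt k * g' (a + RtoC t * (zt k - a))) M)%C) with S.
    replace (S / INR M * (t * Cmod (e - 1) * INR M)) with (t * Cmod (e - 1) * S) by (field; lra).
    replace (eps / 4 * (t * Cmod (e - 1) * INR M)) with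
      (INR M * (eps / (4 * r) * (t * (r * Cmod (e - 1))))) by (field; lra).
    exact B. }
assert (B1 : Cmod (I (RtoC 1) - I (RtoC t0)) <= eps / 4).
{ eapply Rle_trans.
  - apply (mean_value_inequality I I' (RtoC t0) (RtoC 1) (eps/4)).
    intros s hs. replace (RtoC t0 + RtoC s * (RtoC 1 - RtoC t0))%C with (RtoC (t0 + s * (1 - t0)))
      by (rewrite RtoC_plus, RtoC_mult, RtoC_minus; ring).
    apply Hdiff. assert (0 <= s * (1 - t0)) by (apply Rmult_le_pos; lra).
    assert (s * (1 - t0) <= 1 * (1 - t0)) by (apply Rmult_le_compat_r; lra). lra.
  - rewrite <- RtoC_minus, Cmod_R, Rabs_pos_eq by lra. nra. }
set (mk := cmean r M (fun z => z / (z - a))%C).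
assert (hmk : Cmod mk <= Kk).
{ apply Cmod_cmean_le; [lra|]. intros k _. apply hkap. }
assert (B2 : Cmod (I (RtoC t0) - g a * mk) <= eps / 4).
{ replace (I (RtoC t0) - g a * mk)%C with
    (cmean r M (fun z => (g (a + t0 * (z - a)) - g a) * (z / (z - a))))%C.
  - apply Cmod_cmean_le; [lra|]. intros k _. change (circle r M k) with (zt k).
    fold (kap k). rewrite Cmod_mult.
    replace (eps / 4) with (eps / (4 * Kk) * Kk) by (field; lra).
    apply Rmult_le_compat; try apply Cmod_ge_0; auto. left. apply H0.
    replace (a + RtoC t0 * (zt k - a) - a)%C with (RtoC t0 * (zt k - a))%C by ring.
    rewrite Cmod_mult, Cmod_R, Rabs_pos_eq by lra.
    eapply Rle_lt_trans; [|exact ht0d]. apply Rmult_le_compat_l; [lra|].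
    eapply Rle_trans; [apply Cmod_triangle|]. rewrite Cmod_opp, hzt. lra.
  - unfold I, mk, cmean. change (fun k => circle r M k / (circle r M k - a))%C with kap.
    rewrite (csum_ext _ (fun k => g (a + t0 * (zt k - a)) * kap k - g a * kap k)%C).
    + rewrite csum_minus, csum_scal. unfold Cdiv. ring.
    + intros k hk. change (circle r M k) with (zt k). unfold kap. unfold Cdiv. ring. }
assert (B3 : Cmod (g a * mk - g a) < eps / 4).
{ pose proof (cmean_cauchy_kernel r M a hr ha hM0) as E. fold mk in E.
  replace (g a * mk - g a)%C with (g a * ((a / RtoC r) ^ M * mk))%C.
  2:{ replace (g a) with (g a * RtoC 1)%C at 3 by ring. rewrite <- E. ring. }
  assert (hrC : RtoC r <> RtoC 0) by (apply RtoC_neq; lra).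
  rewrite !Cmod_mult, Cmod_pow, Cmod_div, Cmod_R, (Rabs_pos_eq r) by (auto; lra).
  specialize (hN1 M ltac:(lia)).
  pose proof (Cmod_ge_0 (g a)). pose proof (Cmod_ge_0 mk).
  assert (0 <= (Cmod a / r) ^ M) by (apply pow_le; lra).
  set (x := (Cmod a / r) ^ M) in *. 
  apply Rle_lt_trans with ((Cmod (g a) + 1) * (x * Kk)).
  - apply Rmult_le_compat; try lra. { apply Rmult_le_pos; lra. } apply Rmult_le_compat_l; lra.
  - apply Rmult_lt_reg_r with (/ ((Cmod (g a) + 1) * Kk)).
    { apply Rinv_0_lt_compat. apply Rmult_lt_0_compat; lra. }
    replace ((Cmod (g a) + 1) * (x * Kk) * / ((Cmod (g a) + 1) * Kk)) with x by (field; lra).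
    eapply Rlt_le_trans; [exact hN1|]. right. field. lra. }
replace (cmean r M (fun z => g z * (z / (z - a)))%C) with (I (RtoC 1)).
2:{ unfold I, cmean. f_equal. apply csum_ext. intros k hk. change (circle r M k) with (zt k).
    replace (a + 1 * (zt k - a))%C with (zt k) by ring. reflexivity. }
clearbody I mk. revert B1 B2 B3. generalize (I (RtoC 1)), (I (RtoC t0)). intros I1 I0 B1 B2 B3.
replace (I1 - g a)%C with ((I1 - I0) + ((I0 - g a * mk) + (g a * mk - g a)))%C by ring.
pose proof (Cmod_triangle (I1 - I0) ((I0 - g a * mk) + (g a * mk - g a))).
pose proof (Cmod_triangle (I0 - g a * mk) (g a * mk - g a)). lra.
Qed.

Corollary discrete_mean_value g g' r R0 : 0 < r -> r < R0 -> ccont g 0 ->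
  (forall z, Cmod z < R0 -> z <> RtoC 0 -> has_deriv g z (g' z) /\ ccont g' z) ->
  forall eps, 0 < eps -> exists M0, forall M, (M0 <= M)%nat -> Cmod (cmean r M g - g (RtoC 0)) < eps.
Proof.
intros hr hR hc hg eps heps.
destruct (discrete_cauchy_formula g g' 0 r R0) with (eps := eps) as [M0 H]; auto.
{ now rewrite Cmod_0. }
exists M0. intros M hM. specialize (H M hM).
rewrite (cmean_ext r M g (fun z => g z * (z / (z - 0)))%C); auto.
intros k. assert (h : circle r M k <> RtoC 0) by (apply Cmod_gt_0; rewrite Cmod_circle; lra).
field. replace (circle r M k - 0)%C with (circle r M k) by ring. auto.
Qed.

(** Landau's trick: Cauchy's formula for the powers [g^n] loses a constant that
    does not depend on [n]. *)
Theorem maximum_modulus g g' a r R0 B : Cmod a < r -> r < R0 -> 0 < B ->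
  (forall z, Cmod z < R0 -> has_deriv g z (g' z) /\ ccont g' z) ->
  (forall z, Cmod z = r -> Cmod (g z) <= B) -> Cmod (g a) <= B.
Proof.
intros ha hR hB hg hbd.
pose proof (Cmod_ge_0 a) as ha0.
apply Rnot_lt_le. intros hlt.
set (K := r / (r - Cmod a)). assert (hK : 0 < K) by (apply Rdiv_lt_0_compat; lra).
assert (key : forall n, Cmod (g a) ^ n <= B ^ n * K).
{ intros n. apply le_epsilon. intros eps heps.
  destruct (discrete_cauchy_formula (fun z => g z ^ n)%C
     (fun z => RtoC (INR n) * g z ^ (pred n) * g' z)%C a r R0) with (eps := eps) as [M0 H]; auto.
  { apply ccont_pow. eapply has_deriv_cont. apply hg. lra. }
  { intros z hz _. destruct (hg z hz) as [h1 h2]. split; [now apply has_deriv_pow|].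
    apply ccont_mult; auto. apply ccont_mult; [apply ccont_const|]. apply ccont_pow.
    eapply has_deriv_cont; eauto. }
  specialize (H M0 (le_n _)).
  set (m := cmean r M0 (fun z => g z ^ n * (z / (z - a)))%C) in *.
  assert (Cmod m <= B ^ n * K).
  { assert (hBn : 0 <= B ^ n) by (apply pow_le; lra).
    apply Cmod_cmean_le; [apply Rmult_le_pos; lra|]. intros k _.
    assert (hz : Cmod (circle r M0 k) = r) by (apply Cmod_circle; lra).
    set (z := circle r M0 k) in *.
    rewrite Cmod_mult, Cmod_pow. apply Rmult_le_compat; auto.
    - apply pow_le, Cmod_ge_0.
    - apply Cmod_ge_0.
    - apply pow_incr. split; [apply Cmod_ge_0|auto].
    - pose proof (Cmod_triangle_rev z a). rewrite hz in H0.
      rewrite Cmod_div, hz by (apply Cmod_gt_0; lra).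
      unfold K, Rdiv. apply Rmult_le_compat_l; [lra|]. apply Rinv_le_contravar; lra. }
  rewrite <- Cmod_pow.
  pose proof (Cmod_triangle_rev (g a ^ n) m). rewrite Cmod_sub_sym in H1. lra. }
set (x := Cmod (g a) / B - 1).
assert (hx : 0 < x).
{ unfold x. apply Rmult_lt_reg_r with B; auto. rewrite Rmult_0_l.
  replace ((Cmod (g a) / B - 1) * B) with (Cmod (g a) - B) by (field; lra). lra. }
destruct (INR_unbounded (K / x)) as [n hn].
specialize (key n).
assert (hBn : 0 < B ^ n) by (apply pow_lt; lra).
replace (Cmod (g a)) with (B * (1 + x)) in key by (unfold x; field; lra).
rewrite Rpow_mult_distr in key. apply Rmult_le_reg_l in key; auto.
pose proof (poly n x hx).
assert (K < INR n * x).
{ apply Rmult_gt_compat_r with (r := x) in hn; auto.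
  replace (K / x * x) with K in hn by (field; lra). lra. }
lra.
Qed.

(** * Power series *)

Definition cseries (u : nat -> C) (l : C) : Prop :=
  forall eps, 0 < eps -> exists N, forall n, (N <= n)%nat -> Cmod (csum u n - l) < eps.

Definition psum (a : nat -> C) (z l : C) : Prop := cseries (fun k => a k * z ^ k)%C l.

Lemma sum_n_csum (u : nat -> C) n : sum_n (G := C_AbelianMonoid) u n = csum u (S n).
Proof.
induction n.
- rewrite sum_O. cbn. now rewrite Cplus_0_l.
- rewrite sum_Sn, IHn. reflexivity.
Qed.

Lemma pow_n_Cpow (z : C) n : pow_n (K := C_Ring) z n = (z ^ n)%C.
Proof. induction n; [reflexivity|]. cbn. now rewrite IHn. Qed.

Lemma ball_C_Cmod (x y : C) (e : R) : ball (M := C_UniformSpace) x e y -> Cmod (y - x) < 2 * e.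
Proof.
intros [h1 h2]. eapply Rle_lt_trans; [apply Cmod_le_abs|].
change (Rabs (Re y - Re x) < e) in h1. change (Rabs (Im y - Im x) < e) in h2.
change (Re (y - x)%C) with (Re y - Re x). change (Im (y - x)%C) with (Im y - Im x). lra.
Qed.

Lemma Cmod_ball_C (x y : C) (e : R) : Cmod (y - x) < e -> ball (M := C_UniformSpace) x e y.
Proof.
intros h. split.
- change (Rabs (Re y - Re x) < e). change (Re y - Re x) with (Re (y - x)%C).
  eapply Rle_lt_trans; [apply re_le_Cmod|exact h].
- change (Rabs (Im y - Im x) < e). change (Im y - Im x) with (Im (y - x)%C).
  eapply Rle_lt_trans; [apply im_le_Cmod|exact h].
Qed.

Lemma is_pseries_psum (a : nat -> C) (z l : C) :
  is_pseries (K := C_AbsRing) (V := C_NormedModule) a z l <-> psum a z l.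
Proof.
assert (E : forall n, sum_n (G := C_AbelianMonoid) (fun k => scal (V := C_ModuleSpace) (pow_n (K := C_Ring) z k) (a k)) n
   = csum (fun k => a k * z ^ k)%C (S n)).
{ intros n. rewrite sum_n_csum. apply csum_ext. intros k _. rewrite pow_n_Cpow.
  apply Cmult_comm. }
split.
- intros h eps heps.
  destruct (h (fun y => Cmod (y - l) < eps)) as [N hN].
  { exists (mkposreal (eps / 2) ltac:(lra)). intros y hy.
    apply ball_C_Cmod in hy. cbn in hy. lra. }
  exists (S N). intros n hn. destruct n; [lia|]. rewrite <- E. apply hN. lia.
- intros h P [eps hP].
  destruct (h eps (cond_pos eps)) as [N hN]. exists N. intros n hn. apply hP, Cmod_ball_C.
  change (Cmod (sum_n (G := C_AbelianMonoid) (fun k => scal (V := C_ModuleSpace) (pow_n (K := C_Ring) z k) (a k)) n - l) < eps).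
  rewrite E. apply hN. lia.
Qed.

Lemma cseries_unique u l m : cseries u l -> cseries u m -> l = m.
Proof.
intros h1 h2. apply Ceq_from_Cmod. intros eps heps.
destruct (h1 (eps/2) ltac:(lra)) as [N1 k1], (h2 (eps/2) ltac:(lra)) as [N2 k2].
specialize (k1 (Nat.max N1 N2) ltac:(lia)). specialize (k2 (Nat.max N1 N2) ltac:(lia)).
set (s := csum u _) in *.
replace (l - m)%C with (- (s - l) + (s - m))%C by ring.
pose proof (Cmod_triangle (- (s - l)) (s - m)). rewrite Cmod_opp in H. lra.
Qed.

Lemma cseries_ext u v l : (forall n, u n = v n) -> cseries u l -> cseries v l.
Proof.
intros h hu eps heps. destruct (hu eps heps) as [N hN]. exists N. intros n hn.
rewrite <- (csum_ext u v) by auto. auto.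
Qed.

Lemma cseries_plus u v l m : cseries u l -> cseries v m -> cseries (fun n => u n + v n)%C (l + m)%C.
Proof.
intros h1 h2 eps heps.
destruct (h1 (eps/2) ltac:(lra)) as [N1 k1], (h2 (eps/2) ltac:(lra)) as [N2 k2].
exists (Nat.max N1 N2). intros n hn. rewrite csum_plus.
specialize (k1 n ltac:(lia)). specialize (k2 n ltac:(lia)).
replace (csum u n + csum v n - (l + m))%C with ((csum u n - l) + (csum v n - m))%C by ring.
pose proof (Cmod_triangle (csum u n - l) (csum v n - m)). lra.
Qed.

Lemma cseries_scal a u l : cseries u l -> cseries (fun n => a * u n)%C (a * l)%C.
Proof.
intros h eps heps. pose proof (Cmod_ge_0 a).
destruct (h (eps / (Cmod a + 1))) as [N k]. { apply Rdiv_lt_0_compat; lra. }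
exists N. intros n hn. rewrite csum_scal. specialize (k n hn).
replace (a * csum u n - a * l)%C with (a * (csum u n - l))%C by ring. rewrite Cmod_mult.
apply Rle_lt_trans with (Cmod a * (eps / (Cmod a + 1))).
- apply Rmult_le_compat_l; lra.
- replace (Cmod a * (eps / (Cmod a + 1))) with (eps - eps / (Cmod a + 1)) by (field; lra).
  assert (0 < eps / (Cmod a + 1)) by (apply Rdiv_lt_0_compat; lra). lra.
Qed.

Lemma cseries_bound u l B : cseries u l -> (forall n, Cmod (csum u n) <= B) -> Cmod l <= B.
Proof.
intros h hB. apply le_epsilon. intros eps heps. destruct (h eps heps) as [N hN].
specialize (hN N (le_n _)). specialize (hB N).
pose proof (Cmod_triangle_rev l (csum u N)). rewrite Cmod_sub_sym in H. lra.
Qed.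

Lemma csum_S_l u n : csum u (S n) = (u O + csum (fun k => u (S k)) n)%C.
Proof. induction n; [cbn; ring|]. cbn [csum] in *. rewrite IHn. ring. Qed.

Lemma cseries_shift u l : cseries (fun n => u (S n)) l <-> cseries u (u O + l)%C.
Proof.
split; intros h eps heps; destruct (h eps heps) as [N hN].
- exists (S N). intros n hn. destruct n; [lia|]. rewrite csum_S_l.
  replace (u O + csum (fun k => u (S k)) n - (u O + l))%C with (csum (fun k => u (S k)) n - l)%C by ring.
  apply hN. lia.
- exists N. intros n hn. specialize (hN (S n) ltac:(lia)). rewrite csum_S_l in hN.
  replace (u O + csum (fun k => u (S k)) n - (u O + l))%C with (csum (fun k => u (S k)) n - l)%C in hN by ring.
  auto.
Qed.

Lemma cseries_delta x : cseries (fun n => match n with O => x | S _ => RtoC 0 end) x.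
Proof.
assert (H : cseries (fun n => match n with O => x | S _ => RtoC 0 end) (x + 0)%C).
{ apply (cseries_shift (fun n => match n with O => x | S _ => RtoC 0 end)).
  intros eps heps. exists O. intros n _. rewrite csum_const.
  replace (INR n * 0 - 0)%C with (RtoC 0) by ring. now rewrite Cmod_0. }
now replace (x + 0)%C with x in H by ring.
Qed.

Lemma csum_geometric_tail u M q : 0 <= q < 1 -> (forall n, Cmod (u n) <= M * q ^ n) ->
  forall N k, Cmod (csum u (N + k) - csum u N) <= M * q ^ N * (1 - q ^ k) / (1 - q).
Proof.
intros hq hu N k. induction k.
- rewrite Nat.add_0_r. replace (csum u N - csum u N)%C with (RtoC 0) by ring.
  rewrite Cmod_0. cbn. right. field. lra.
- rewrite Nat.add_succ_r. cbn [csum].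
  replace (csum u (N + k) + u (N + k)%nat - csum u N)%C with ((csum u (N + k) - csum u N) + u (N + k)%nat)%C by ring.
  eapply Rle_trans; [apply Cmod_triangle|]. specialize (hu (N + k)%nat). rewrite pow_add in hu.
  eapply Rle_trans; [apply Rplus_le_compat; eassumption|]. cbn [pow]. right. field. lra.
Qed.

Lemma csum_geometric_bound u M q : 0 <= q < 1 -> 0 <= M -> (forall n, Cmod (u n) <= M * q ^ n) ->
  forall N m, (N <= m)%nat -> Cmod (csum u m - csum u N) <= M * q ^ N / (1 - q).
Proof.
intros hq hM hu N m hm. replace m with (N + (m - N))%nat by lia.
eapply Rle_trans; [apply csum_geometric_tail with (M := M) (q := q); auto|].
unfold Rdiv. apply Rmult_le_compat_r; [left; apply Rinv_0_lt_compat; lra|].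
assert (0 <= q ^ (m - N)) by (apply pow_le; lra).
assert (0 <= M * q ^ N) by (apply Rmult_le_pos; [auto|apply pow_le; lra]). nra.
Qed.

Lemma cseries_geometric u M q : 0 <= q < 1 -> 0 <= M -> (forall n, Cmod (u n) <= M * q ^ n) ->
  exists l, cseries u l /\ forall N, Cmod (l - csum u N) <= M * q ^ N / (1 - q).
Proof.
intros hq hM hu.
pose proof (csum_geometric_bound u M q hq hM hu) as hb.
destruct (bounded_seq_adherent (csum u) (M * q ^ 0 / (1 - q))) as [l hl].
{ intros n. specialize (hb O n ltac:(lia)). cbn [csum] in hb.
  replace (csum u n - 0)%C with (csum u n) in hb by ring. auto. }
assert (key : forall N, Cmod (l - csum u N) <= M * q ^ N / (1 - q)).
{ intros N. apply le_epsilon. intros eps heps. destruct (hl eps heps N) as [n [h1 h2]].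
  specialize (hb N n h1).
  replace (l - csum u N)%C with (- (csum u n - l) + (csum u n - csum u N))%C by ring.
  pose proof (Cmod_triangle (- (csum u n - l)) (csum u n - csum u N)). rewrite Cmod_opp in H. lra. }
exists l. split; auto. intros eps heps.
destruct (pow_lt_1_small q (eps * (1 - q) / (M + 1)) hq) as [N hN].
{ apply Rdiv_lt_0_compat; [apply Rmult_lt_0_compat; lra|lra]. }
exists N. intros n hn. rewrite Cmod_sub_sym. eapply Rle_lt_trans; [apply key|].
specialize (hN n hn).
apply Rlt_div_l; [lra|].
apply Rle_lt_trans with (M * (eps * (1 - q) / (M + 1))); [apply Rmult_le_compat_l; lra|].
replace (M * (eps * (1 - q) / (M + 1))) with (eps * (1 - q) - eps * (1 - q) / (M + 1)) by (field; lra).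
assert (0 < eps * (1 - q) / (M + 1)); [|lra].
apply Rdiv_lt_0_compat; [apply Rmult_lt_0_compat; lra|lra].
Qed.

Lemma cseries_terms_bounded u l : cseries u l -> exists M, 0 < M /\ forall n, Cmod (u n) <= M.
Proof.
intros h. destruct (h 1 ltac:(lra)) as [N hN].
assert (fin : forall n, exists M, 0 < M /\ forall k, (k < n)%nat -> Cmod (u k) <= M).
{ induction n.
  - exists 1. split; [lra|]. intros; lia.
  - destruct IHn as [M [h1 h2]]. exists (M + Cmod (u n)). pose proof (Cmod_ge_0 (u n)).
    split; [lra|]. intros k hk. destruct (Nat.eq_dec k n) as [->|]; [lra|].
    specialize (h2 k ltac:(lia)). lra. }
destruct (fin N) as [M [h1 h2]]. exists (M + 2). split; [lra|]. intros n.
destruct (Nat.lt_ge_cases n N) as [hl|hg]; [specialize (h2 n hl); lra|].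
pose proof (hN n hg) as k1. pose proof (hN (S n) ltac:(lia)) as k2. cbn [csum] in k2.
replace (u n) with ((csum u n + u n - l) - (csum u n - l))%C by ring.
eapply Rle_trans; [apply Cmod_triangle|]. rewrite Cmod_opp. lra.
Qed.

Lemma psum_coeff_bound a z l rho : Cmod z = rho -> psum a z l ->
  exists M, 0 < M /\ forall n, Cmod (a n) * rho ^ n <= M.
Proof.
intros hz h. destruct (cseries_terms_bounded _ _ h) as [M [h1 h2]].
exists M. split; auto. intros n. specialize (h2 n). now rewrite Cmod_mult, Cmod_pow, hz in h2.
Qed.

Lemma psum_converges a rho M : 0 < rho -> 0 < M -> (forall n, Cmod (a n) * rho ^ n <= M) ->
  forall z, Cmod z < rho -> exists l, psum a z l /\
    forall N, Cmod (l - csum (fun k => a k * z ^ k)%C N) <= M * (Cmod z / rho) ^ N / (1 - Cmod z / rho).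
Proof.
intros hr hM ha z hz. pose proof (Cmod_ge_0 z).
apply cseries_geometric; [|lra|].
- split; [apply Rdiv_le_0_compat; lra|]. apply Rlt_div_l; lra.
- intros n. rewrite Cmod_mult, Cmod_pow.
  assert (hp : 0 < rho ^ n) by now apply pow_lt.
  unfold Rdiv. rewrite Rpow_mult_distr, pow_inv.
  apply Rmult_le_reg_r with (rho ^ n); auto.
  replace (M * (Cmod z ^ n * / rho ^ n) * rho ^ n) with (M * Cmod z ^ n) by (field; lra).
  replace (Cmod (a n) * Cmod z ^ n * rho ^ n) with ((Cmod (a n) * rho ^ n) * Cmod z ^ n) by ring.
  apply Rmult_le_compat_r; [apply pow_le; lra|auto].
Qed.

Lemma psum_0 a : psum a 0 (a O).
Proof.
intros eps heps. exists 1%nat. intros n hn. destruct n; [lia|]. rewrite csum_S_l.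
rewrite (csum_ext _ (fun _ => RtoC 0)) by (intros; cbn; ring).
rewrite csum_const. cbn [Cpow]. replace (a O * 1 + INR n * 0 - a O)%C with (RtoC 0) by ring.
now rewrite Cmod_0.
Qed.

Lemma psum_at_0 a l : psum a 0 l -> l = a O.
Proof. intros h. exact (cseries_unique _ _ _ h (psum_0 a)). Qed.

Lemma psum_remainder a f r : 0 < r -> (forall z, Cmod z < r -> psum a z (f z)) ->
  forall N, exists K d, 0 < d /\ 0 <= K /\ forall z, Cmod z < d ->
    Cmod (f z - csum (fun k => a k * z ^ k)%C N) <= K * Cmod z ^ N.
Proof.
intros hr h N.
destruct (psum_coeff_bound a (RtoC (r/2)) (f (RtoC (r/2))) (r/2)) as [M [hM hb]].
{ rewrite Cmod_R, Rabs_pos_eq; lra. }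
{ apply h. rewrite Cmod_R, Rabs_pos_eq; lra. }
exists (2 * M / (r/2) ^ N), (r/4). 
assert (hp : 0 < (r/2) ^ N) by (apply pow_lt; lra).
split; [lra|split]. { apply Rdiv_le_0_compat; lra. }
intros z hz. pose proof (Cmod_ge_0 z).
destruct (psum_converges a (r/2) M ltac:(lra) hM hb z ltac:(lra)) as [l [hl hl2]].
rewrite (cseries_unique _ _ _ (h z ltac:(lra)) hl).
eapply Rle_trans; [apply hl2|].
set (q := Cmod z / (r/2)).
assert (hq : q <= /2).
{ apply Rle_div_l; lra. }
assert (hq0 : 0 <= q) by (apply Rdiv_le_0_compat; lra).
replace (2 * M / (r / 2) ^ N * Cmod z ^ N) with (2 * (M * q ^ N)).
2:{ unfold q, Rdiv at 1. rewrite Rpow_mult_distr, pow_inv. field. lra. }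
assert (0 <= M * q ^ N) by (apply Rmult_le_pos; [lra|now apply pow_le]).
apply Rle_div_l; [lra|]. nra.
Qed.

(* Bernoulli's inequality for (t / s)^n *)
Lemma INR_mult_pow_le s t : 0 < s < t -> exists K, 0 < K /\ forall n, INR n * s ^ n <= K * t ^ n.
Proof.
intros hs. set (x := t / s - 1).
assert (hx : 0 < x).
{ unfold x. assert (1 < t / s) by (apply Rlt_div_r; lra). lra. }
exists (/ x). split; [now apply Rinv_0_lt_compat|]. intros n.
pose proof (poly n x hx).
replace (t ^ n) with ((1 + x) ^ n * s ^ n).
2:{ rewrite <- Rpow_mult_distr. f_equal. unfold x. field. lra. }
rewrite <- Rmult_assoc. apply Rmult_le_compat_r; [apply pow_le; lra|].
apply Rmult_le_reg_l with x; auto. rewrite <- Rmult_assoc, Rinv_r by lra. lra.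
Qed.

Lemma pow_increment_bound (z h : C) s n : 0 < s -> Cmod z <= s -> Cmod (z + h) <= s ->
  s ^ 2 * Cmod ((z + h) ^ n - z ^ n - RtoC (INR n) * z ^ (pred n) * h)
  <= INR n * INR n * s ^ n * Cmod h ^ 2.
Proof.
intros hs hz hzh. pose proof (Cmod_ge_0 h) as hh.
induction n.
- cbn [Cpow INR pred]. replace (1 - 1 - 0 * 1 * h)%C with (RtoC 0) by ring. rewrite Cmod_0. cbn. lra.
- set (E := ((z + h) ^ n - z ^ n - RtoC (INR n) * z ^ (pred n) * h)%C) in *.
  replace ((z + h) ^ S n - z ^ S n - RtoC (INR (S n)) * z ^ (pred (S n)) * h)%C with
    ((z + h) * E + RtoC (INR n) * z ^ (pred n) * (h * h))%C.
  2:{ unfold E. rewrite S_INR, RtoC_plus. destruct n; cbn [pred Cpow INR]; ring. }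
  pose proof (pos_INR n) as hn.
  assert (h1 : s * s * (INR n * Cmod z ^ pred n) <= INR n * s ^ S n).
  { destruct n; [cbn; lra|]. cbn [pred].
    assert (Cmod z ^ n <= s ^ n) by (apply pow_incr; split; [apply Cmod_ge_0|auto]).
    cbn [pow]. replace (INR (S n) * (s * (s * s ^ n))) with (s * s * INR (S n) * s ^ n) by ring.
    rewrite <- Rmult_assoc. apply Rmult_le_compat_l; [nra|auto]. }
  assert (h2 : Cmod ((z + h) * E + RtoC (INR n) * z ^ (pred n) * (h * h)) <=
     s * Cmod E + (INR n * Cmod z ^ pred n) * Cmod h ^ 2).
  { eapply Rle_trans; [apply Cmod_triangle|]. rewrite !Cmod_mult, Cmod_R, Cmod_pow, (Rabs_pos_eq (INR n)) by auto.
    apply Rplus_le_compat; [apply Rmult_le_compat_r; [apply Cmod_ge_0|auto]|]. cbn. lra. }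
  apply Rle_trans with (s * (s ^ 2 * Cmod E) + (s * s * (INR n * Cmod z ^ pred n)) * Cmod h ^ 2).
  { replace (s * (s ^ 2 * Cmod E) + (s * s * (INR n * Cmod z ^ pred n)) * Cmod h ^ 2) with
     (s ^ 2 * (s * Cmod E + (INR n * Cmod z ^ pred n) * Cmod h ^ 2)) by ring.
    apply Rmult_le_compat_l; [nra|exact h2]. }
  assert (h3 : 0 <= Cmod h ^ 2) by nra.
  assert (h4 : 0 < s ^ S n) by now apply pow_lt.
  apply Rle_trans with (s * (INR n * INR n * s ^ n * Cmod h ^ 2) + INR n * s ^ S n * Cmod h ^ 2).
  + apply Rplus_le_compat; [apply Rmult_le_compat_l; lra|apply Rmult_le_compat_r; auto].
  + rewrite S_INR.
    replace (s * (INR n * INR n * s ^ n * Cmod h ^ 2) + INR n * s ^ S n * Cmod h ^ 2)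
     with ((INR n * INR n + INR n) * (s ^ S n * Cmod h ^ 2)) by (cbn; ring).
    replace ((INR n + 1) * (INR n + 1) * s ^ S n * Cmod h ^ 2) with
     ((INR n + 1) * (INR n + 1) * (s ^ S n * Cmod h ^ 2)) by ring.
    apply Rmult_le_compat_r; [|nra]. apply Rmult_le_pos; lra.
Qed.

Definition deriv_coeffs (a : nat -> C) (n : nat) : C := (RtoC (INR (S n)) * a (S n))%C.

(** The second order Taylor estimate of [pow_increment_bound], summed over the
    terms; replacing the radius twice by a larger one absorbs the factor [n^2]. *)
Theorem psum_has_deriv a f r : (forall z, Cmod z < r -> psum a z (f z)) ->
  forall z, Cmod z < r -> exists l, psum (deriv_coeffs a) z l /\ has_deriv f z l.
Proof.
intros hf z hz. pose proof (Cmod_ge_0 z) as hz0.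
set (e := (r - Cmod z) / 4). assert (he : 0 < e) by (unfold e; lra).
set (s := Cmod z + e). set (sg := s + e). set (tau := sg + e). set (rho := tau + e/2).
assert (hs : 0 < s) by (unfold s; lra). assert (hsg : s < sg) by (unfold sg; lra).
assert (ht : sg < tau) by (unfold tau; lra). assert (hrho : tau < rho < r) by (unfold rho, tau, sg, s, e; lra).
destruct (psum_coeff_bound a (RtoC rho) (f (RtoC rho)) rho) as [M [hM hb]].
{ rewrite Cmod_R, Rabs_pos_eq; lra. }
{ apply hf. rewrite Cmod_R, Rabs_pos_eq; lra. }
destruct (INR_mult_pow_le s sg ltac:(lra)) as [K1 [hK1 k1]].
destruct (INR_mult_pow_le sg tau ltac:(lra)) as [K2 [hK2 k2]].
set (q := tau / rho).
assert (hq : 0 <= q < 1).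
{ split; [apply Rdiv_le_0_compat; lra|]. apply Rlt_div_l; lra. }
assert (hab : forall n, Cmod (a n) * tau ^ n <= M * q ^ n).
{ intros n. unfold q, Rdiv. rewrite Rpow_mult_distr, pow_inv.
  assert (hp : 0 < rho ^ n) by (apply pow_lt; lra).
  apply Rmult_le_reg_r with (rho ^ n); auto.
  replace (M * (tau ^ n * / rho ^ n) * rho ^ n) with (M * tau ^ n) by (field; lra).
  replace (Cmod (a n) * tau ^ n * rho ^ n) with ((Cmod (a n) * rho ^ n) * tau ^ n) by ring.
  apply Rmult_le_compat_r; [apply pow_le; lra|auto]. }
assert (hn2 : forall n, Cmod (a n) * (INR n * INR n * s ^ n) <= K1 * K2 * M * q ^ n).
{ intros n. pose proof (pos_INR n). pose proof (Cmod_ge_0 (a n)).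
  apply Rle_trans with (K1 * K2 * (Cmod (a n) * tau ^ n)).
  - replace (K1 * K2 * (Cmod (a n) * tau ^ n)) with (Cmod (a n) * (K1 * (K2 * tau ^ n))) by ring.
    apply Rmult_le_compat_l; auto. rewrite Rmult_assoc.
    apply Rle_trans with (INR n * (K1 * sg ^ n)); [apply Rmult_le_compat_l; auto|].
    replace (INR n * (K1 * sg ^ n)) with (K1 * (INR n * sg ^ n)) by ring.
    apply Rmult_le_compat_l; [lra|auto].
  - rewrite (Rmult_assoc (K1 * K2)). apply Rmult_le_compat_l; [nra|auto]. }
(* the series of derivatives, indexed without shift *)
set (u := fun n => (a n * (RtoC (INR n) * z ^ (pred n)))%C).
assert (hu : forall n, Cmod (u n) <= K1 * K2 * M / s * q ^ n).
{ intros n. unfold u. rewrite !Cmod_mult, Cmod_R, Cmod_pow, Rabs_pos_eq by apply pos_INR.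
  apply Rmult_le_reg_r with s; auto.
  replace (K1 * K2 * M / s * q ^ n * s) with (K1 * K2 * M * q ^ n) by (field; lra).
  eapply Rle_trans; [|apply hn2]. rewrite Rmult_assoc. apply Rmult_le_compat_l; [apply Cmod_ge_0|].
  destruct n; [cbn; lra|]. cbn [pred].
  assert (1 <= INR (S n)) by (apply (le_INR 1); lia).
  assert (Cmod z ^ n <= s ^ n) by (apply pow_incr; unfold s; lra).
  assert (0 <= s ^ n) by (apply pow_le; lra).
  rewrite !Rmult_assoc. apply Rmult_le_compat_l; [lra|]. cbn [pow].
  apply Rle_trans with (s ^ n * s); [apply Rmult_le_compat_r; lra|].
  rewrite (Rmult_comm (s ^ n)). assert (0 <= s * s ^ n) by nra. nra. }
destruct (cseries_geometric u (K1 * K2 * M / s) q hq) as [l [hl _]]; auto.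
{ apply Rdiv_le_0_compat; [|auto]. repeat apply Rmult_le_pos; lra. }
exists l. split.
- unfold psum. apply cseries_ext with (fun n => u (S n)).
  + intros n. unfold u, deriv_coeffs. cbn [pred]. ring.
  + apply cseries_shift. replace (u O + l)%C with l by (unfold u; cbn; ring). auto.
- set (Q := K1 * K2 * M / (1 - q) / s ^ 2).
  assert (hQ : 0 < Q).
  { unfold Q. repeat apply Rdiv_lt_0_compat; try lra; [repeat apply Rmult_lt_0_compat; lra|nra]. }
  assert (key : forall h, Cmod h < e -> Cmod (f (z + h)%C - f z - l * h) <= Q * Cmod h ^ 2).
  { intros h hh. pose proof (Cmod_triangle z h).
    assert (hzh : Cmod (z + h) <= s) by (unfold s; lra).
    assert (ser : cseries (fun n => a n * ((z + h) ^ n - z ^ n - RtoC (INR n) * z ^ (pred n) * h))%C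
                   (f (z + h)%C - f z - l * h)%C).
    { eapply cseries_ext.
      2:{ replace (f (z + h)%C - f z - l * h)%C with (f (z + h)%C + (-(1)) * f z + (- h) * l)%C by ring.
          apply cseries_plus; [apply cseries_plus|].
          - apply hf. unfold s in *. lra.
          - apply cseries_scal, hf; auto.
          - apply cseries_scal, hl. }
      intros n. cbv beta. unfold u. ring. }
    apply (cseries_bound _ _ _ ser). intros n.
    pose proof (csum_geometric_bound (fun n => a n * ((z + h) ^ n - z ^ n - RtoC (INR n) * z ^ (pred n) * h))%C
       (K1 * K2 * M * Cmod h ^ 2 / s ^ 2) q hq) as G.
    specialize (G ltac:(apply Rdiv_le_0_compat; [apply Rmult_le_pos; [repeat apply Rmult_le_pos; lra|apply pow2_ge_0]|nra])).
    assert (hs2 : 0 < s ^ 2) by nra.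
    assert (G0 : forall n, Cmod (a n * ((z + h) ^ n - z ^ n - RtoC (INR n) * z ^ (pred n) * h)) <=
       K1 * K2 * M * Cmod h ^ 2 / s ^ 2 * q ^ n).
    { intros k. rewrite Cmod_mult.
      pose proof (pow_increment_bound z h s k hs ltac:(unfold s; lra) hzh) as PB.
      apply Rmult_le_reg_r with (s ^ 2); auto.
      replace (K1 * K2 * M * Cmod h ^ 2 / s ^ 2 * q ^ k * s ^ 2) with (K1 * K2 * M * q ^ k * Cmod h ^ 2) by (field; lra).
      rewrite Rmult_assoc, (Rmult_comm _ (s ^ 2)).
      eapply Rle_trans; [apply Rmult_le_compat_l; [apply Cmod_ge_0|exact PB]|].
      rewrite <- Rmult_assoc. apply Rmult_le_compat_r; [apply pow2_ge_0|auto]. }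
    specialize (G G0 O n ltac:(lia)). cbn [csum pow] in G.
    replace (csum (fun n => a n * ((z + h) ^ n - z ^ n - RtoC (INR n) * z ^ (pred n) * h))%C n - 0)%C with
     (csum (fun n => a n * ((z + h) ^ n - z ^ n - RtoC (INR n) * z ^ (pred n) * h))%C n) in G by ring.
    eapply Rle_trans; [exact G|]. right. unfold Q. field. split; lra. }
  intros eps heps. exists (Rmin e (eps / Q)). split; [apply Rmin_pos; [auto|now apply Rdiv_lt_0_compat]|].
  intros w hw. pose proof (Rmin_l e (eps/Q)). pose proof (Rmin_r e (eps/Q)).
  specialize (key (w - z)%C ltac:(lra)). replace (z + (w - z))%C with w in key by ring.
  eapply Rle_trans; [exact key|]. cbn [pow]. rewrite Rmult_1_r, <- Rmult_assoc.
  apply Rmult_le_compat_r; [apply Cmod_ge_0|].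
  apply Rle_trans with (Q * (eps / Q)); [apply Rmult_le_compat_l; lra|]. right. field. lra.
Qed.

Lemma psum_C_derive a g r : (forall z, Cmod z < r -> psum a z (g z)) ->
  forall z, Cmod z < r -> psum (deriv_coeffs a) z (C_derive g z) /\ has_deriv g z (C_derive g z).
Proof.
intros h z hz. destruct (psum_has_deriv a g r h z hz) as [l [h1 h2]].
rewrite (has_deriv_C_derive _ _ _ h2). auto.
Qed.

Lemma analytic_at_psum f z0 : analytic_at f z0 <->
  exists a r, 0 < r /\ forall w, Cmod w < r -> psum a w (f (z0 + w)%C).
Proof.
split; intros [a [r [hr h]]]; exists a, r; split; auto; intros w hw;
now apply is_pseries_psum, h.
Qed.

Lemma analytic_at_deriv f z0 : analytic_at f z0 ->
  near z0 (fun z => has_deriv f z (C_derive f z)) /\ analytic_at (C_derive f) z0.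
Proof.
rewrite !analytic_at_psum. intros [a [r [hr h]]].
assert (H : forall w, Cmod w < r -> psum (deriv_coeffs a) w (C_derive f (z0 + w)%C) /\
   has_deriv f (z0 + w)%C (C_derive f (z0 + w)%C)).
{ intros w hw. destruct (psum_has_deriv a (fun w => f (z0 + w)%C) r h w hw) as [l [h1 h2]].
  assert (h3 : has_deriv f (z0 + w)%C l).
  { apply has_deriv_ext with (fun v => (fun w => f (z0 + w)%C) (v - z0)%C).
    - exists 1. split; [lra|]. intros v _. cbv beta. f_equal. ring.
    - eapply has_deriv_eq.
      + apply (has_deriv_comp (fun w => f (z0 + w)%C) (fun v => v - z0)%C).
        * replace (z0 + w - z0)%C with w by ring. exact h2.
        * apply has_deriv_minus; [apply has_deriv_id|apply has_deriv_const].
      + ring. }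
  rewrite (has_deriv_C_derive _ _ _ h3). auto. }
split.
- exists r. split; auto. intros z hz. destruct (H (z - z0)%C hz) as [_ h2].
  replace (z0 + (z - z0))%C with z in h2 by ring. auto.
- exists (deriv_coeffs a), r. split; auto. intros w hw. apply H, hw.
Qed.

Lemma analytic_has_deriv f z : analytic_at f z -> has_deriv f z (C_derive f z).
Proof. intros h. apply analytic_at_deriv in h. destruct h as [h _]. now apply near_self in h. Qed.

Lemma analytic_C_derive f z : analytic_at f z -> analytic_at (C_derive f) z.
Proof. apply analytic_at_deriv. Qed.

(** * Rogosinski's inequality *)

Definition C1_at (g g' : C -> C) (z : C) : Prop := has_deriv g z (g' z) /\ ccont g' z.

Definition C1_on (U : C -> Prop) (g : C -> C) : Prop := exists g', forall z, U z -> C1_at g g' z.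

Lemma C1_on_const U a : C1_on U (fun _ => a).
Proof. exists (fun _ => RtoC 0). intros z _. split; [apply has_deriv_const|apply ccont_const]. Qed.

Lemma C1_on_id U : C1_on U (fun z => z).
Proof. exists (fun _ => RtoC 1). intros z _. split; [apply has_deriv_id|apply ccont_const]. Qed.

Lemma C1_on_plus U f g : C1_on U f -> C1_on U g -> C1_on U (fun z => f z + g z)%C.
Proof.
intros [f' hf] [g' hg]. exists (fun z => f' z + g' z)%C. intros z hz.
destruct (hf z hz), (hg z hz). split; [now apply has_deriv_plus|now apply ccont_plus].
Qed.

Lemma C1_on_mult U f g : C1_on U f -> C1_on U g -> C1_on U (fun z => f z * g z)%C.
Proof.
intros [f' hf] [g' hg]. exists (fun z => f' z * g z + f z * g' z)%C. intros z hz.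
destruct (hf z hz) as [h1 h2], (hg z hz) as [h3 h4].
pose proof (has_deriv_cont _ _ _ h1). pose proof (has_deriv_cont _ _ _ h3).
split; [now apply has_deriv_mult|]. now apply ccont_plus; apply ccont_mult.
Qed.

Lemma C1_on_inv U f : C1_on U f -> (forall z, U z -> f z <> RtoC 0) -> C1_on U (fun z => / f z)%C.
Proof.
intros [f' hf] hn. exists (fun z => - f' z / (f z * f z))%C. intros z hz.
destruct (hf z hz) as [h1 h2]. pose proof (has_deriv_cont _ _ _ h1).
split; [now apply has_deriv_inv; auto|].
apply ccont_div; [now apply ccont_opp|now apply ccont_mult|]. apply Cmult_neq_0; auto.
Qed.

Lemma C1_on_pow U f n : C1_on U f -> C1_on U (fun z => f z ^ n)%C.
Proof.
intros h. induction n; cbn [Cpow]; [apply C1_on_const|now apply C1_on_mult].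
Qed.

Lemma C1_on_csum U (u : nat -> C -> C) n : (forall k, C1_on U (u k)) ->
  C1_on U (fun z => csum (fun k => u k z) n).
Proof.
intros h. induction n; cbn [csum]; [apply C1_on_const|now apply C1_on_plus].
Qed.

Lemma C1_on_minus U f g : C1_on U f -> C1_on U g -> C1_on U (fun z => f z - g z)%C.
Proof.
intros hf [g' hg]. apply C1_on_plus; auto. exists (fun z => - g' z)%C. intros z hz.
destruct (hg z hz). split; [now apply has_deriv_opp|now apply ccont_opp].
Qed.

Lemma C1_on_subset (U V : C -> Prop) g : (forall z, U z -> V z) -> C1_on V g -> C1_on U g.
Proof. intros h [g' hg]. exists g'. auto. Qed.

Fixpoint rsum (u : nat -> R) (n : nat) : R :=
  match n with O => 0 | S n => rsum u n + u n end.

Definition rmean (r : R) (M : nat) (u : C -> R) : R :=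
  rsum (fun k => u (circle r M k)) M / INR M.

Lemma rsum_le u v n : (forall k, (k < n)%nat -> u k <= v k) -> rsum u n <= rsum v n.
Proof.
induction n; intros h; cbn; [lra|]. apply Rplus_le_compat; [apply IHn; intros; apply h; lia|apply h; lia].
Qed.

Lemma rsum_ext u v n : (forall k, (k < n)%nat -> u k = v k) -> rsum u n = rsum v n.
Proof.
induction n; intros h; cbn; [auto|]. rewrite IHn, h by (intros; auto; apply h; lia). auto.
Qed.

Lemma rsum_plus u v n : rsum (fun k => u k + v k) n = rsum u n + rsum v n.
Proof. induction n; cbn; [ring|rewrite IHn; ring]. Qed.

Lemma rsum_scal a u n : rsum (fun k => a * u k) n = a * rsum u n.
Proof. induction n; cbn; [ring|rewrite IHn; ring]. Qed.

Lemma rsum_S_l u n : rsum u (S n) = u O + rsum (fun k => u (S k)) n.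
Proof. induction n; [cbn; ring|]. cbn [rsum] in *. rewrite IHn. ring. Qed.

Lemma rsum_const a n : rsum (fun _ => a) n = INR n * a.
Proof. induction n; [cbn; ring|]. cbn [rsum]. rewrite IHn, S_INR. ring. Qed.

Lemma Re_csum u n : Re (csum u n) = rsum (fun k => Re (u k)) n.
Proof. induction n; [reflexivity|]. cbn [csum rsum]. now rewrite <- IHn. Qed.

Lemma Re_cmean r M g : (0 < M)%nat -> Re (cmean r M g) = rmean r M (fun z => Re (g z)).
Proof.
intros hM. unfold cmean, rmean. rewrite <- Re_csum.
assert (INR M <> 0) by (apply not_0_INR; lia).
unfold Cdiv. rewrite <- RtoC_inv by auto. rewrite Cmult_comm, Re_RtoC_mult. unfold Rdiv. ring.
Qed.

Lemma rmean_le r M u v : (0 < M)%nat -> (forall k, u (circle r M k) <= v (circle r M k)) ->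
  rmean r M u <= rmean r M v.
Proof.
intros hM h. unfold rmean, Rdiv. apply Rmult_le_compat_r.
- left. apply Rinv_0_lt_compat, lt_0_INR. lia.
- now apply rsum_le.
Qed.

Lemma rmean_plus r M u v : rmean r M (fun z => u z + v z) = rmean r M u + rmean r M v.
Proof. unfold rmean. rewrite rsum_plus. unfold Rdiv. ring. Qed.

Lemma rmean_scal r M a u : rmean r M (fun z => a * u z) = a * rmean r M u.
Proof. unfold rmean. rewrite rsum_scal. unfold Rdiv. ring. Qed.

Lemma rmean_const r M a : (0 < M)%nat -> rmean r M (fun _ => a) = a.
Proof. intros hM. unfold rmean. rewrite rsum_const. field. apply not_0_INR. lia. Qed.

Lemma Cmod2_plus (x y : C) : Cmod (x + y) ^ 2 = Cmod x ^ 2 + 2 * Re (Cconj x * y) + Cmod y ^ 2.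
Proof. rewrite !Cmod2_alt. destruct x, y. unfold Cconj, Cplus, Cmult, Re, Im; cbn. ring. Qed.

(** Littlewood's subordination inequality.  Writing the composed polynomial as
    [d 0 + omega * Q], the cross term has mean zero because [omega] vanishes at
    the origin, and [|omega * Q| <= |Q|]. *)
Lemma littlewood_mean omega r : 0 < r < 1 -> omega (RtoC 0) = RtoC 0 ->
  C1_on unit_disc omega -> (forall z, unit_disc z -> Cmod (omega z) <= 1) ->
  forall n (d : nat -> C) eps, 0 < eps -> exists M0, forall M, (M0 <= M)%nat ->
   rmean r M (fun z => Cmod (csum (fun k => d k * omega z ^ k)%C n) ^ 2)
     <= rsum (fun k => Cmod (d k) ^ 2) n + eps.
Proof.
intros hr h0 hC hb n. induction n; intros d eps heps.
- exists 1%nat. intros M hM. cbn [csum rsum]. rewrite Cmod_0.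
  rewrite rmean_const by lia. cbn. lra.
- set (Q := fun z => csum (fun k => d (S k) * omega z ^ k)%C n).
  set (g := fun z => (omega z * Q z)%C).
  assert (hQ : C1_on unit_disc Q).
  { apply C1_on_csum. intros k. apply C1_on_mult; [apply C1_on_const|now apply C1_on_pow]. }
  assert (hg : C1_on unit_disc g) by now apply C1_on_mult.
  destruct (IHn (fun k => d (S k)) (eps/2) ltac:(lra)) as [M1 H1].
  destruct hg as [g' hg].
  pose proof (Cmod_ge_0 (d O)) as hd0.
  destruct (discrete_mean_value g g' r 1) with (eps := eps / 4 / (Cmod (d O) + 1)) as [M2 H2];
    try lra.
  { destruct (hg 0) as [k _]; [unfold unit_disc; rewrite Cmod_0; lra|]. now apply has_deriv_cont in k. }
  { intros z hz _. now apply hg. }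
  { repeat apply Rdiv_lt_0_compat; lra. }
  exists (Nat.max 1 (Nat.max M1 M2)). intros M hM.
  assert (hM0 : (0 < M)%nat) by lia.
  specialize (H1 M ltac:(lia)). specialize (H2 M ltac:(lia)).
  assert (g0 : g (RtoC 0) = RtoC 0) by (unfold g; rewrite h0; ring).
  rewrite g0 in H2. replace (cmean r M g - 0)%C with (cmean r M g) in H2 by ring.
  rewrite rsum_S_l.
  apply Rle_trans with (rmean r M (fun z => (Cmod (d O) ^ 2 + 2 * Re (Cconj (d O) * g z)) + Cmod (Q z) ^ 2)).
  + apply rmean_le; auto. intros k. set (z := circle r M k).
    assert (hz : unit_disc z) by (unfold unit_disc, z; rewrite Cmod_circle; lra).
    rewrite csum_S_l.
    replace (d O * omega z ^ 0 + csum (fun k0 => d (S k0) * omega z ^ S k0) n)%C with (d O + g z)%C.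
    * rewrite Cmod2_plus. apply Rplus_le_compat_l. unfold g. rewrite Cmod_mult.
      rewrite Rpow_mult_distr. specialize (hb z hz). pose proof (Cmod_ge_0 (omega z)).
      pose proof (pow2_ge_0 (Cmod (Q z))).
      assert (Cmod (omega z) ^ 2 <= 1) by nra. nra.
    * unfold g, Q. rewrite <- csum_scal. cbn [Cpow]. 
      rewrite (csum_ext (fun k0 => omega z * (d (S k0) * omega z ^ k0))%C
        (fun k0 => d (S k0) * (omega z * omega z ^ k0))%C) by (intros; ring). ring.
  + rewrite !rmean_plus, rmean_scal, rmean_const by auto.
    rewrite <- (Re_cmean r M (fun z => Cconj (d O) * g z)%C) by auto.
    rewrite cmean_scal.
    assert (Re (Cconj (d O) * cmean r M g) <= eps / 4).
    { eapply Rle_trans; [apply Re_mult_le|]. rewrite Cmod_conj.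
      apply Rle_trans with (Cmod (d O) * (eps / 4 / (Cmod (d O) + 1))); [apply Rmult_le_compat_l; lra|].
      replace (Cmod (d O) * (eps / 4 / (Cmod (d O) + 1))) with (eps / 4 - eps / 4 / (Cmod (d O) + 1)) by (field; lra).
      assert (0 < eps / 4 / (Cmod (d O) + 1)) by (repeat apply Rdiv_lt_0_compat; lra). lra. }
    unfold Q in *. lra.
Qed.

Lemma cmean_csum r M (u : nat -> C -> C) n :
  cmean r M (fun z => csum (fun k => u k z) n) = csum (fun k => cmean r M (u k)) n.
Proof.
unfold cmean. rewrite csum_swap. unfold Cdiv. rewrite Cmult_comm, <- csum_scal.
apply csum_ext. intros; ring.
Qed.

Lemma cmean_monomials r M m n : 0 < r -> (m < M)%nat -> (n < M)%nat ->
  cmean r M (fun z => z ^ m * / z ^ n)%C = if Nat.eq_dec m n then RtoC 1 else RtoC 0.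
Proof.
intros hr hm hn.
assert (hM : (0 < M)%nat) by lia.
assert (hrC : RtoC r <> RtoC 0) by (apply RtoC_neq; lra).
pose proof (unit_root_neq_0 M) as hu.
set (x := (unit_root M ^ m * / unit_root M ^ n)%C).
assert (E : forall k, ((circle r M k) ^ m * / (circle r M k) ^ n)%C = (RtoC r ^ m * / RtoC r ^ n * x ^ k)%C).
{ intros k. unfold circle, x. rewrite !Cpow_mult_l.
  rewrite (Cpow_swap _ k m), (Cpow_swap _ k n), Cpow_inv by now apply Cpow_nz.
  field. split; repeat apply Cpow_nz; auto. }
unfold cmean. rewrite (csum_ext _ (fun k => RtoC r ^ m * / RtoC r ^ n * x ^ k)%C) by (intros; apply E).
rewrite csum_scal.
destruct (Nat.eq_dec m n) as [->|hne].
- assert (x = RtoC 1) by (unfold x; field; now apply Cpow_nz). rewrite H.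
  rewrite (csum_ext _ (fun _ => RtoC 1)) by (intros; apply Cpow_1_l). rewrite csum_const.
  field. split; [now apply Cpow_nz|now apply RtoC_INR_neq_0].
- rewrite csum_root_powers; auto.
  + unfold Cdiv. ring.
  + unfold x. rewrite Cpow_mult_l, Cpow_swap, unit_root_order, Cpow_1_l by auto.
    rewrite Cpow_inv by now apply Cpow_nz. rewrite Cpow_swap, unit_root_order, Cpow_1_l by auto. field.
  + intros e.
    assert (e' : (unit_root M ^ m = unit_root M ^ n)%C).
    { replace (unit_root M ^ m)%C with (x * unit_root M ^ n)%C by (unfold x; field; now apply Cpow_nz).
      rewrite e. ring. }
    assert (key : forall i j, (i < j)%nat -> (j < M)%nat -> (unit_root M ^ i)%C <> (unit_root M ^ j)%C).
    { intros i j hij hj ee. apply (unit_root_primitive M (j - i)); [lia|].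
      replace j with (i + (j - i))%nat in ee by lia. rewrite Cpow_add_r in ee.
      replace (unit_root M ^ (j - i))%C with (unit_root M ^ i * unit_root M ^ (j - i) / unit_root M ^ i)%C
        by (field; now apply Cpow_nz).
      rewrite <- ee. field. now apply Cpow_nz. }
    destruct (Nat.lt_total m n) as [h|[h|h]]; [|lia|].
    * now apply (key m n).
    * now apply (key n m).
Qed.

Lemma csum_single (a : nat -> C) j n : (j < n)%nat ->
  csum (fun k => if Nat.eq_dec k j then a k else RtoC 0) n = a j.
Proof.
intros hj. induction n; [lia|]. cbn [csum]. destruct (Nat.eq_dec n j) as [->|hne].
- rewrite (csum_ext _ (fun _ => RtoC 0)), csum_const; [ring|].
  intros k hk. destruct (Nat.eq_dec k j); [lia|auto].
- rewrite IHn by lia. ring.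
Qed.

Lemma Cconj_csum u n : Cconj (csum u n) = csum (fun k => Cconj (u k)) n.
Proof.
induction n; cbn [csum]; [unfold Cconj, RtoC; cbn; f_equal; ring|].
rewrite <- IHn. unfold Cconj, Cplus; cbn; f_equal; ring.
Qed.

Lemma Cconj_pow z n : Cconj (z ^ n)%C = (Cconj z ^ n)%C.
Proof.
induction n; cbn [Cpow]; [unfold Cconj, RtoC; cbn; f_equal; ring|].
rewrite <- IHn. unfold Cconj, Cmult; cbn. f_equal; ring.
Qed.

Lemma Cconj_mult x y : Cconj (x * y)%C = (Cconj x * Cconj y)%C.
Proof. unfold Cconj, Cmult; cbn. f_equal; ring. Qed.

Lemma csum_mult_r (a : C) u n : (csum u n * a)%C = csum (fun k => u k * a)%C n.
Proof. rewrite Cmult_comm, <- csum_scal. apply csum_ext. intros; ring. Qed.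

Section Rogosinski.

Variables (omega : C -> C) (a d : nat -> C) (N : nat).
Hypothesis omega_0 : omega (RtoC 0) = RtoC 0.
Hypothesis omega_C1 : C1_on unit_disc omega.
Hypothesis omega_le : forall z, unit_disc z -> Cmod (omega z) <= 1.

Let P (z : C) := csum (fun k => a k * z ^ S k)%C N.
Let Q1 (z : C) := csum (fun k => d k * omega z ^ k)%C N.
Let Rm (z : C) := (omega z * Q1 z - P z)%C.

Hypothesis contact : exists K e, 0 < e /\ forall z, Cmod z < e -> Cmod (Rm z) <= K * Cmod z ^ S N.

(* Cconj (P z), made holomorphic on the circle of radius r through conj z = r^2 / z *)
Let Pbar (r : R) (z : C) := csum (fun k => Cconj (a k) * RtoC (r ^ 2) ^ S k * / z ^ S k)%C N.

Let Pbar_circle r M k : 0 < r -> Cconj (P (circle r M k)) = Pbar r (circle r M k).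
Proof.
intros hr. unfold P, Pbar. rewrite Cconj_csum. apply csum_ext. intros j _.
set (z := circle r M k).
assert (hz : z <> RtoC 0) by (apply Cmod_gt_0; unfold z; rewrite Cmod_circle; lra).
rewrite Cconj_mult, Cconj_pow.
assert (E : RtoC (r ^ 2) = (z * Cconj z)%C).
{ rewrite <- Cmod2_conj. unfold z. rewrite Cmod_circle by lra. reflexivity. }
rewrite E, Cpow_mult_l. field. now apply Cpow_nz.
Qed.

Let mean_P_sq r M : 0 < r -> (N < M)%nat ->
  rmean r M (fun z => Cmod (P z) ^ 2) = rsum (fun k => Cmod (a k) ^ 2 * (r ^ 2) ^ S k) N.
Proof.
intros hr hM.
assert (E1 : rmean r M (fun z => Cmod (P z) ^ 2) = Re (cmean r M (fun z => Pbar r z * P z)%C)).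
{ rewrite Re_cmean by lia. unfold rmean. f_equal. apply rsum_ext. intros k _.
  rewrite <- Pbar_circle by auto. now rewrite Cconj_mult_Re. }
rewrite E1.
assert (E2 : cmean r M (fun z => Pbar r z * P z)%C =
  csum (fun k => RtoC (Cmod (a k) ^ 2 * (r ^ 2) ^ S k)) N).
{ rewrite (cmean_ext r M _ (fun z => csum (fun k => csum (fun j =>
     (Cconj (a k) * RtoC (r ^ 2) ^ S k * a j) * (z ^ S j * / z ^ S k)) N) N)%C).
  2:{ intros k. unfold Pbar, P. rewrite csum_mult_r. apply csum_ext. intros i _.
      rewrite <- csum_scal. apply csum_ext. intros; ring. }
  rewrite (cmean_csum r M (fun k z => csum (fun j =>
     (Cconj (a k) * RtoC (r ^ 2) ^ S k * a j) * (z ^ S j * / z ^ S k)) N)%C).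
  apply csum_ext. intros k hk.
  rewrite (cmean_csum r M (fun j z => (Cconj (a k) * RtoC (r ^ 2) ^ S k * a j) * (z ^ S j * / z ^ S k))%C).
  rewrite (csum_ext _ (fun j => if Nat.eq_dec j k then (Cconj (a k) * RtoC (r ^ 2) ^ S k * a j)%C else RtoC 0)).
  - rewrite (csum_single (fun j => Cconj (a k) * RtoC (r ^ 2) ^ S k * a j)%C) by auto.
    rewrite RtoC_mult, Cmod2_conj, (RtoC_pow (r ^ 2) (S k)). ring.
  - intros j hj. rewrite (cmean_scal r M _ (fun z => z ^ S j * / z ^ S k)%C).
    rewrite cmean_monomials by (auto; lia).
    destruct (Nat.eq_dec (S j) (S k)), (Nat.eq_dec j k); try lia; ring. }
rewrite E2, Re_csum. reflexivity.
Qed.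

Let cross_term_vanishes r : 0 < r < 1 -> forall eps, 0 < eps -> exists M0, forall M, (M0 <= M)%nat ->
  Cmod (cmean r M (fun z => Pbar r z * Rm z)%C) < eps.
Proof.
intros hr eps heps.
assert (z0 : unit_disc 0) by (unfold unit_disc; rewrite Cmod_0; lra).
assert (hRm : C1_on unit_disc Rm).
{ apply C1_on_minus.
  - apply C1_on_mult; auto. apply C1_on_csum. intros k.
    apply C1_on_mult; [apply C1_on_const|now apply C1_on_pow].
  - apply C1_on_csum. intros k. apply C1_on_mult; [apply C1_on_const|].
    apply C1_on_pow, C1_on_id. }
assert (hRm0 : Rm (RtoC 0) = RtoC 0).
{ destruct contact as [K [e [he H]]]. apply Cmod_eq_0. apply Rle_antisym; [|apply Cmod_ge_0].
  specialize (H 0 ltac:(rewrite Cmod_0; lra)). rewrite Cmod_0 in H. cbn in H. lra. }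
assert (hC1 : C1_on (fun z => Cmod z < 1 /\ z <> RtoC 0) (fun z => Pbar r z * Rm z)%C).
{ apply C1_on_mult; [|apply C1_on_subset with unit_disc; [now intros z [h _]|auto]].
  apply C1_on_csum. intros k. apply C1_on_mult; [apply C1_on_const|].
  apply C1_on_inv; [apply C1_on_pow, C1_on_id|]. intros z [_ hz]. now apply Cpow_nz. }
destruct hC1 as [g' hg'].
assert (hc : ccont (fun z => Pbar r z * Rm z)%C 0).
{ apply ccont_ext with (fun z => csum (fun k => Cconj (a k) * RtoC (r ^ 2) ^ S k * (/ z ^ S k * Rm z)) N)%C.
  { exists 1. split; [lra|]. intros w _. unfold Pbar. rewrite csum_mult_r. apply csum_ext. intros; ring. }
  assert (G : forall n, (n <= N)%nat ->
     ccont (fun z => csum (fun k => Cconj (a k) * RtoC (r ^ 2) ^ S k * (/ z ^ S k * Rm z)) n)%C 0).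
  { induction n; intros hn; cbn [csum]; [apply ccont_const|].
    apply ccont_plus; [apply IHn; lia|]. apply ccont_mult; [apply ccont_const|].
    destruct contact as [K [e [he H]]]. intros eta heta.
    exists (Rmin 1 (Rmin e (eta / (Rabs K + 1)))).
    assert (hK : 0 < Rabs K + 1) by (pose proof (Rabs_pos K); lra).
    assert (hek : 0 < eta / (Rabs K + 1)) by (now apply Rdiv_lt_0_compat).
    split; [repeat apply Rmin_pos; lra|]. intros w hw.
    replace (w - 0)%C with w in hw by ring.
    pose proof (Rmin_l 1 (Rmin e (eta / (Rabs K + 1)))). pose proof (Rmin_r 1 (Rmin e (eta / (Rabs K + 1)))).
    pose proof (Rmin_l e (eta / (Rabs K + 1))). pose proof (Rmin_r e (eta / (Rabs K + 1))).
    rewrite hRm0, Cmult_0_r. replace (/ w ^ S n * Rm w - 0)%C with (/ w ^ S n * Rm w)%C by ring.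
    destruct (Ceq_dec w 0) as [->|hw0].
    { rewrite hRm0, Cmult_0_r, Cmod_0. auto. }
    rewrite Cmod_mult, Cmod_inv, Cmod_pow by now apply Cpow_nz.
    assert (hw1 : 0 < Cmod w) by now apply Cmod_gt_0.
    assert (hwp : 0 < Cmod w ^ S n) by now apply pow_lt.
    apply Rle_lt_trans with (Rabs K * Cmod w).
    - apply Rmult_le_reg_l with (Cmod w ^ S n); auto.
      rewrite <- Rmult_assoc, Rinv_r, Rmult_1_l by lra.
      eapply Rle_trans; [apply H; lra|].
      replace (Cmod w ^ S n * (Rabs K * Cmod w)) with (Rabs K * Cmod w ^ (S (S n))) by (cbn; ring).
      apply Rle_trans with (Rabs K * Cmod w ^ S N).
      + apply Rmult_le_compat_r; [apply pow_le; lra|apply Rle_abs].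
      + apply Rmult_le_compat_l; [apply Rabs_pos|].
        replace (S N) with (S (S n) + (N - S n))%nat by lia. rewrite pow_add.
        rewrite <- (Rmult_1_r (Cmod w ^ S (S n))) at 2.
        apply Rmult_le_compat_l; [apply pow_le; lra|].
        rewrite <- (pow1 (N - S n)). apply pow_incr. lra.
    - apply Rle_lt_trans with ((Rabs K + 1) * Cmod w); [apply Rmult_le_compat_r; lra|].
      apply Rlt_le_trans with ((Rabs K + 1) * (eta / (Rabs K + 1))); [apply Rmult_lt_compat_l; lra|].
      right. field. lra. }
  apply (G N). lia. }
destruct (discrete_mean_value (fun z => Pbar r z * Rm z)%C g' r 1) with (eps := eps) as [M0 H]; try lra; auto.
{ intros z h1 h2. apply hg'. auto. }
exists M0. intros M hM. specialize (H M hM). rewrite hRm0, Cmult_0_r in H.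
replace (cmean r M (fun z => Pbar r z * Rm z) - 0)%C with (cmean r M (fun z => Pbar r z * Rm z)%C) in H by ring.
auto.
Qed.

Let weighted_bound r : 0 < r < 1 ->
  rsum (fun k => Cmod (a k) ^ 2 * (r ^ 2) ^ S k) N <= rsum (fun k => Cmod (d k) ^ 2) N.
Proof.
intros hr. apply le_epsilon. intros eps heps.
destruct (littlewood_mean omega r hr omega_0 omega_C1 omega_le N d (eps/2) ltac:(lra)) as [M1 H1].
destruct (cross_term_vanishes r hr (eps/4) ltac:(lra)) as [M2 H2].
set (M := Nat.max (S N) (Nat.max M1 M2)).
specialize (H1 M ltac:(lia)). specialize (H2 M ltac:(lia)).
rewrite <- (mean_P_sq r M) by (try lra; lia).
assert (hle : rmean r M (fun z => Cmod (P z) ^ 2) <=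
  rmean r M (fun z => Cmod (Q1 z) ^ 2 + (-2) * Re (Pbar r z * Rm z)%C)).
{ apply rmean_le; [lia|]. intros k. rewrite <- Pbar_circle by lra. set (z := circle r M k).
  assert (hz : unit_disc z) by (unfold unit_disc, z; rewrite Cmod_circle; lra).
  pose proof (Cmod2_plus (P z) (Rm z)) as E.
  replace (P z + Rm z)%C with (omega z * Q1 z)%C in E by (unfold Rm; ring).
  rewrite Cmod_mult, Rpow_mult_distr in E. specialize (omega_le z hz).
  pose proof (Cmod_ge_0 (omega z)). pose proof (pow2_ge_0 (Cmod (Q1 z))). pose proof (pow2_ge_0 (Cmod (Rm z))).
  assert (Cmod (omega z) ^ 2 <= 1) by nra.
  assert (Cmod (omega z) ^ 2 * Cmod (Q1 z) ^ 2 <= 1 * Cmod (Q1 z) ^ 2) by (apply Rmult_le_compat_r; auto).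
  lra. }
rewrite rmean_plus, rmean_scal, <- (Re_cmean r M (fun z => Pbar r z * Rm z)%C) in hle by lia.
set (m := cmean r M (fun z => Pbar r z * Rm z)%C) in *.
assert (- Cmod m <= Re m).
{ pose proof (re_le_Cmod m). apply Rabs_le_between in H. lra. }
unfold Q1 in hle. lra.
Qed.

(** Here [omega * Q1 = P + Rm], where [P] is a polynomial of degree at most [N]
    and [Rm] vanishes to order [N + 1].  On a circle the mean of [|P + Rm|^2] is
    asymptotically at least that of [|P|^2], because the cross term is the mean of
    a function with a removable zero at the origin; Littlewood bounds it from above.  Then the
    radius tends to 1. *)
Theorem rogosinski_inequality :
  rsum (fun k => Cmod (a k) ^ 2) N <= rsum (fun k => Cmod (d k) ^ 2) N.
Proof.
set (A := rsum (fun k => Cmod (a k) ^ 2) N). set (B := rsum (fun k => Cmod (d k) ^ 2) N).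
apply Rnot_lt_le. intros hlt.
assert (hB : 0 <= B).
{ unfold B. rewrite <- (Rmult_0_r (INR N)), <- rsum_const. apply rsum_le. intros; apply pow2_ge_0. }
assert (hw : forall r, 0 < r < 1 -> r ^ (2 * N) * A <= B).
{ intros r hr. eapply Rle_trans; [|apply (weighted_bound r hr)].
  unfold A. rewrite <- rsum_scal. apply rsum_le. intros k hk.
  rewrite Rmult_comm. apply Rmult_le_compat_l; [apply pow2_ge_0|].
  rewrite <- pow_mult. replace (2 * N)%nat with (2 * S k + 2 * (N - S k))%nat by lia.
  rewrite pow_add. rewrite <- (Rmult_1_r (r ^ (2 * S k))) at 2.
  apply Rmult_le_compat_l; [apply pow_le; lra|].
  rewrite <- (pow1 (2 * (N - S k))). apply pow_incr. lra. }
assert (hc : continuity_pt (fun x => x ^ (2 * N)) 1).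
{ apply derivable_continuous_pt, derivable_pt_pow. }
destruct (hc (1 - B / A)) as [al [hal H]].
{ apply Rlt_gt. apply Rmult_lt_reg_r with A; [lra|].
  replace ((1 - B / A) * A) with (A - B) by (field; lra). lra. }
set (r := 1 - Rmin (al/2) (/2)).
assert (0 < Rmin (al/2) (/2)) by (apply Rmin_pos; lra).
pose proof (Rmin_l (al/2) (/2)). pose proof (Rmin_r (al/2) (/2)).
specialize (hw r ltac:(unfold r; lra)).
specialize (H r). cbn in H. unfold R_dist in H.
assert (hx : Rabs (r ^ (2 * N) - 1 ^ (2 * N)) < 1 - B / A).
{ apply H. split.
  - split; [exact I|]. unfold r. lra.
  - unfold r. replace (1 - Rmin (al/2) (/2) - 1) with (- Rmin (al/2) (/2)) by ring.
    rewrite Rabs_Ropp, Rabs_pos_eq; lra. }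
rewrite pow1 in hx. apply Rabs_def2 in hx.
assert (B / A * A < r ^ (2 * N) * A) by (apply Rmult_lt_compat_r; lra).
replace (B / A * A) with B in H3 by (field; lra). lra.
Qed.

End Rogosinski.

(** * Exponential and principal logarithm *)

Lemma Cexp_plus z w : Cexp (z + w) = (Cexp z * Cexp w)%C.
Proof.
destruct z as [x y], w as [u v]. unfold Cexp, Cplus, Cmult, Re, Im; cbn [fst snd].
rewrite exp_plus, cos_plus, sin_plus. f_equal; ring.
Qed.

Lemma Cexp_0 : Cexp 0 = RtoC 1.
Proof. unfold Cexp, RtoC, Re, Im; cbn [fst snd]. rewrite exp_0, cos_0, sin_0. f_equal; ring. Qed.

Lemma Cexp_neq_0 z : Cexp z <> RtoC 0.
Proof.
intros E. assert (H : (Cexp z * Cexp (- z))%C = RtoC 1).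
{ rewrite <- Cexp_plus. replace (z + - z)%C with (RtoC 0) by ring. apply Cexp_0. }
rewrite E, Cmult_0_l in H. apply RtoC_inj in H. lra.
Qed.

Lemma derivable_pt_lim_at_0 f l : derivable_pt_lim f 0 l -> forall eps, 0 < eps ->
  exists d, 0 < d /\ forall x, Rabs x < d -> Rabs (f x - f 0 - l * x) <= eps * Rabs x.
Proof.
intros h eps heps. destruct (h eps heps) as [d H]. exists d. split; [apply cond_pos|].
intros x hx. destruct (Req_dec x 0) as [->|n].
- rewrite Rmult_0_r, Rminus_0_r, Rminus_diag, Rabs_R0. lra.
- specialize (H x n hx). rewrite Rplus_0_l in H.
  assert (hp : 0 < Rabs x) by now apply Rabs_pos_lt.
  replace (f x - f 0 - l * x) with (((f x - f 0) / x - l) * x) by (field; auto).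
  rewrite Rabs_mult. apply Rmult_le_compat_r; lra.
Qed.

Lemma has_deriv_Cexp_0 : has_deriv Cexp 0 1.
Proof.
intros eps heps. set (e := Rmin 1 (eps / 16)).
assert (he : 0 < e) by (apply Rmin_pos; lra).
assert (he1 : e <= 1) by apply Rmin_l. assert (he2 : e <= eps / 16) by apply Rmin_r.
destruct (derivable_pt_lim_at_0 exp 1) with (eps := e) as [d1 [hd1 H1]]; auto.
{ rewrite <- exp_0. apply derivable_pt_lim_exp. }
destruct (derivable_pt_lim_at_0 sin 1) with (eps := e) as [d2 [hd2 H2]]; auto.
{ rewrite <- cos_0. apply derivable_pt_lim_sin. }
destruct (derivable_pt_lim_at_0 cos 0) with (eps := e) as [d3 [hd3 H3]]; auto.
{ replace 0 with (- sin 0) at 2 by (rewrite sin_0; ring). apply derivable_pt_lim_cos. }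
set (d := Rmin (Rmin d1 d2) (Rmin d3 e)).
exists d. split; [unfold d; repeat apply Rmin_pos; lra|].
intros w hw. replace (w - 0)%C with w in * by ring.
assert (d <= d1) by (unfold d; Rmin_le).
assert (d <= d2) by (unfold d; Rmin_le).
assert (d <= d3) by (unfold d; Rmin_le).
assert (d <= e) by (unfold d; Rmin_le).
rewrite Cexp_0. pose proof (re_le_Cmod w) as hx. pose proof (im_le_Cmod w) as hy.
set (m := Cmod w) in *. clearbody d.
set (x := Re w) in *. set (y := Im w) in *.
specialize (H1 x ltac:(lra)). specialize (H2 y ltac:(lra)). specialize (H3 y ltac:(lra)).
rewrite exp_0 in H1. rewrite sin_0 in H2. rewrite cos_0 in H3.
eapply Rle_trans; [apply Cmod_le_abs|].
replace (Re (Cexp w - 1 - 1 * w)%C) with (exp x * cos y - 1 - x).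
2:{ unfold x, y. destruct w. unfold Cexp, Re, Im; cbn. ring. }
replace (Im (Cexp w - 1 - 1 * w)%C) with (exp x * sin y - y).
2:{ unfold x, y. destruct w. unfold Cexp, Re, Im; cbn. ring. }
clearbody x y.
pose proof (Rabs_pos x). pose proof (Rabs_pos y).
assert (A : Rabs (exp x - 1) <= 2 * e).
{ replace (exp x - 1) with ((exp x - 1 - 1 * x) + x) by ring.
  eapply Rle_trans; [apply Rabs_triang|]. nra. }
assert (B : Rabs (exp x) <= 3).
{ replace (exp x) with ((exp x - 1) + 1) by ring. eapply Rle_trans; [apply Rabs_triang|].
  rewrite Rabs_R1. lra. }
assert (C1 : Rabs (exp x * cos y - 1 - x) <= e * m + 3 * (e * m)).
{ replace (exp x * cos y - 1 - x) with ((exp x - 1 - 1 * x) + exp x * (cos y - 1 - 0 * y)) by ring.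
  eapply Rle_trans; [apply Rabs_triang|]. rewrite Rabs_mult.
  apply Rplus_le_compat; [eapply Rle_trans; [exact H1|apply Rmult_le_compat_l; lra]|].
  apply Rmult_le_compat; try apply Rabs_pos; auto.
  eapply Rle_trans; [exact H3|apply Rmult_le_compat_l; lra]. }
assert (C2 : Rabs (exp x * sin y - y) <= 3 * (e * m) + 2 * e * m).
{ replace (exp x * sin y - y) with (exp x * (sin y - 0 - 1 * y) + (exp x - 1) * y) by ring.
  eapply Rle_trans; [apply Rabs_triang|]. rewrite !Rabs_mult.
  apply Rplus_le_compat; apply Rmult_le_compat; try apply Rabs_pos; auto.
  eapply Rle_trans; [exact H2|apply Rmult_le_compat_l; lra]. }
assert (0 <= m) by lra.
assert (e * m <= eps / 16 * m) by (apply Rmult_le_compat_r; lra).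
assert (0 <= eps * m) by (apply Rmult_le_pos; lra). lra.
Qed.

Lemma has_deriv_Cexp z : has_deriv Cexp z (Cexp z).
Proof.
apply has_deriv_ext with (fun w => Cexp z * Cexp (w - z))%C.
- exists 1. split; [lra|]. intros w _. rewrite <- Cexp_plus. f_equal. ring.
- eapply has_deriv_eq.
  + apply has_deriv_scal. apply (has_deriv_comp Cexp (fun w => w - z)%C).
    * replace (z - z)%C with (RtoC 0) by ring. apply has_deriv_Cexp_0.
    * apply has_deriv_minus; [apply has_deriv_id|apply has_deriv_const].
  + ring.
Qed.

Lemma Cexp_Clog z : z <> RtoC 0 -> Cexp (Clog z) = z.
Proof.
intros hz. assert (hm : 0 < Cmod z) by now apply Cmod_gt_0.
unfold Cexp, Clog, Re, Im; cbn [fst snd]. rewrite exp_ln by auto.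
pose proof (Cmod2_alt z) as E.
set (m := Cmod z) in *. unfold Carg. fold m.
assert (hx : -1 <= Re z / m <= 1).
{ pose proof (re_le_Cmod z) as h. fold m in h. apply Rabs_le_between in h.
  split; apply Rmult_le_reg_r with m; auto; unfold Rdiv; rewrite Rmult_assoc, Rinv_l; lra. }
assert (hs : sqrt (1 - (Re z / m)²) = Rabs (Im z) / m).
{ replace (1 - (Re z / m)²) with ((Rabs (Im z) / m)²).
  - apply sqrt_Rsqr. apply Rdiv_le_0_compat; [apply Rabs_pos|auto].
  - unfold Rdiv. rewrite !Rsqr_mult, <- Rsqr_abs. unfold Rsqr.
    replace (Im z * Im z) with (m * m - Re z * Re z) by nra. field. lra. }
transitivity ((Re z, Im z) : C); [|destruct z; reflexivity].
destruct (Rlt_dec (Im z) 0) as [hn|hn].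
- rewrite cos_neg, sin_neg, cos_acos, sin_acos, hs by auto. rewrite Rabs_left by auto.
  f_equal; field; lra.
- rewrite cos_acos, sin_acos, hs by auto. rewrite Rabs_pos_eq by lra. f_equal; field; lra.
Qed.

Lemma Carg_atan z : 0 < Re z -> Carg z = atan (Im z / Re z).
Proof.
intros hz. assert (hm : 0 < Cmod z).
{ pose proof (re_le_Cmod z). rewrite Rabs_pos_eq in H by lra. lra. }
pose proof (Cmod2_alt z) as E. set (m := Cmod z) in *.
assert (hp : 0 < Re z / m) by now apply Rdiv_lt_0_compat.
assert (hs : sqrt (1 - (Re z / m)²) / (Re z / m) = Rabs (Im z) / Re z).
{ replace (1 - (Re z / m)²) with ((Rabs (Im z) / m)²).
  - rewrite sqrt_Rsqr; [field; lra|]. apply Rdiv_le_0_compat; [apply Rabs_pos|auto].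
  - unfold Rdiv. rewrite !Rsqr_mult, <- Rsqr_abs. unfold Rsqr.
    replace (Im z * Im z) with (m * m - Re z * Re z) by nra. field. lra. }
unfold Carg. fold m. rewrite acos_atan, hs by auto.
destruct (Rlt_dec (Im z) 0) as [hn|hn].
- rewrite Rabs_left by auto. rewrite <- atan_opp. f_equal. field. lra.
- rewrite Rabs_pos_eq by lra. reflexivity.
Qed.

Lemma ccont_real_comp (phi : R -> R) (u : C -> R) z : continuity_pt phi (u z) ->
  ccont (fun w => RtoC (u w)) z -> ccont (fun w => RtoC (phi (u w))) z.
Proof.
intros hp hu eps heps. destruct (hp eps heps) as [d [hd H]].
generalize (hu d hd). apply near_imp. intros w hw.
rewrite <- RtoC_minus, Cmod_R in *.
destruct (Req_dec (u w) (u z)) as [e|n].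
- rewrite e, Rminus_diag, Rabs_R0. auto.
- apply (H (u w)). split; [split; [exact I|congruence]|exact hw].
Qed.

Lemma ccont_Re z : ccont (fun w => RtoC (Re w)) z.
Proof.
intros eps heps. exists eps. split; auto. intros w hw. rewrite <- RtoC_minus, Cmod_R.
eapply Rle_lt_trans; [|exact hw]. apply (re_le_Cmod (w - z)).
Qed.

Lemma ccont_Im z : ccont (fun w => RtoC (Im w)) z.
Proof.
intros eps heps. exists eps. split; auto. intros w hw. rewrite <- RtoC_minus, Cmod_R.
eapply Rle_lt_trans; [|exact hw]. apply (im_le_Cmod (w - z)).
Qed.

Lemma ccont_Cmod z : ccont (fun w => RtoC (Cmod w)) z.
Proof.
intros eps heps. exists eps. split; auto. intros w hw. rewrite <- RtoC_minus, Cmod_R.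
eapply Rle_lt_trans; [|exact hw]. apply Rabs_le.
pose proof (Cmod_triangle_rev w z). pose proof (Cmod_triangle_rev z w).
rewrite (Cmod_sub_sym z w) in H0. lra.
Qed.

Lemma near_Re_pos z : 0 < Re z -> near z (fun w => 0 < Re w).
Proof.
intros h. exists (Re z). split; auto. intros w hw.
pose proof (re_le_Cmod (w - z)) as H. change (Re (w - z)%C) with (Re w - Re z) in H.
apply Rabs_le_between in H. lra.
Qed.

Lemma Re_pos_neq_0 z : 0 < Re z -> z <> RtoC 0.
Proof. intros h ->. cbn in h. lra. Qed.

Lemma ccont_Clog z : 0 < Re z -> ccont Clog z.
Proof.
intros hz.
assert (hm : 0 < Cmod z) by (apply Cmod_gt_0; now apply Re_pos_neq_0).
apply ccont_ext with (fun w => RtoC (ln (Cmod w)) + Ci * RtoC (atan (Im w / Re w)))%C.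
- generalize (near_Re_pos z hz). apply near_imp. intros w hw.
  unfold Clog. rewrite Carg_atan by auto. unfold Ci, RtoC, Cplus, Cmult; cbn. f_equal; ring.
- apply ccont_plus; [|apply ccont_mult; [apply ccont_const|]].
  + apply (ccont_real_comp ln Cmod); [|apply ccont_Cmod].
    apply derivable_continuous_pt. exists (/ Cmod z). now apply derivable_pt_lim_ln.
  + apply (ccont_real_comp atan (fun w => Im w / Re w)).
    * apply derivable_continuous_pt, derivable_pt_atan.
    * apply ccont_ext with (fun w => RtoC (Im w) / RtoC (Re w))%C.
      -- generalize (near_Re_pos z hz). apply near_imp. intros w hw. rewrite RtoC_div; [reflexivity|lra].
      -- apply ccont_div; [apply ccont_Im|apply ccont_Re|]. intros e. apply RtoC_inj in e. lra.
Qed.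

(** Only the continuity of [Clog] needs a formula for the principal argument; its
    derivative is that of a continuous branch of the inverse of [Cexp]. *)
Lemma has_deriv_Clog z : 0 < Re z -> has_deriv Clog z (/ z).
Proof.
intros hz. pose proof (Re_pos_neq_0 z hz) as hn. eapply has_deriv_eq.
- apply (has_deriv_implicit Cexp (fun w => w) Clog z z 1).
  + now apply ccont_Clog.
  + generalize (near_neq z 0 hn). apply near_imp. intros w hw. now apply Cexp_Clog.
  + rewrite <- (Cexp_Clog z hn) at 2. apply has_deriv_Cexp.
  + auto.
  + apply has_deriv_id.
- field. auto.
Qed.

Lemma Clog_1 : Clog 1 = RtoC 0.
Proof.
unfold Clog. rewrite Cmod_1, ln_1. rewrite Carg_atan by (cbn; lra).
replace (Im 1 / Re 1) with 0 by (cbn; field). now rewrite atan_0.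
Qed.

Lemma disc_Re_one_minus z : unit_disc z -> 0 < Re (1 - z).
Proof.
intros h. unfold unit_disc in h. pose proof (re_le_Cmod z) as H. apply Rabs_le_between in H.
replace (Re (1 - z)%C) with (1 - Re z) by (destruct z; unfold Re; cbn; ring). lra.
Qed.

Lemma half_lt_Re_inv_one_minus z : unit_disc z -> / 2 < Re (/ (1 - z))%C.
Proof.
intros hz. pose proof (disc_Re_one_minus z hz) as q. pose proof (Cmod2_alt z) as q2.
assert (q3 : Cmod z ^ 2 < 1) by (unfold unit_disc in hz; pose proof (Cmod_ge_0 z); nra).
destruct z as [a b]. unfold Re, Im, Cinv, Cplus, Cminus, Copp, RtoC in *; cbn in *.
rewrite !Rmult_1_r. apply Rlt_div_r; nra.
Qed.

Lemma one_minus_neq_0 z : unit_disc z -> (1 - z)%C <> RtoC 0.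
Proof. intros hz. now apply Re_pos_neq_0, disc_Re_one_minus. Qed.

Lemma has_deriv_Clog_one_minus z : unit_disc z ->
  has_deriv (fun w => Clog (1 - w)) z (- / (1 - z)).
Proof.
intros hz. eapply has_deriv_eq.
- apply (has_deriv_comp Clog (fun w => 1 - w)%C).
  + now apply has_deriv_Clog, disc_Re_one_minus.
  + apply has_deriv_minus; [apply has_deriv_const|apply has_deriv_id].
- ring.
Qed.

Lemma has_deriv_Cpowr_one_minus a z : unit_disc z ->
  has_deriv (fun w => Cpowr (1 - w) a) z (- RtoC a / (1 - z) * Cpowr (1 - z) a).
Proof.
intros hz. eapply has_deriv_eq.
- apply (has_deriv_comp Cexp (fun w => RtoC a * Clog (1 - w))%C).
  + apply has_deriv_Cexp.
  + apply has_deriv_scal. now apply has_deriv_Clog_one_minus.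
- unfold Cpowr. field. now apply Re_pos_neq_0, disc_Re_one_minus.
Qed.

Lemma Cpowr_neq_0 z a : Cpowr z a <> RtoC 0.
Proof. apply Cexp_neq_0. Qed.

Lemma Cpowr_1_l a : Cpowr 1 a = RtoC 1.
Proof. unfold Cpowr. rewrite Clog_1, Cmult_0_r. apply Cexp_0. Qed.

(** * The dominant *)

(** Taylor coefficients of [1 / psi c]: the recursion is the differential equation
    [z F' + h F = 1], where [h = 1 + c z / (1 - z)]. *)
Fixpoint recip_psi_coef (c : R) (n : nat) : R :=
  match n with
  | O => 1
  | S O => - c / 2
  | S (S _ as m) => (INR m + 1 - c) / (INR m + 2) * recip_psi_coef c m
  end.

Definition recip_psi (c : R) (z : C) : C :=
  epsilon (inhabits (RtoC 0)) (psum (fun n => RtoC (recip_psi_coef c n)) z).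

Lemma recip_psi_coef_1 c : recip_psi_coef c 1 = - c / 2.
Proof. reflexivity. Qed.

Lemma recip_psi_coef_rec c n : (INR n + 3) * recip_psi_coef c (S (S n)) = (INR n + 2 - c) * recip_psi_coef c (S n).
Proof.
change (recip_psi_coef c (S (S n))) with ((INR (S n) + 1 - c) / (INR (S n) + 2) * recip_psi_coef c (S n)).
rewrite S_INR. pose proof (pos_INR n). field. lra.
Qed.

Section Dominant.

Variable c : R.
Hypothesis hc : 0 < c <= 2.

Let f n := - recip_psi_coef c (S n).

Lemma recip_psi_coef_nonpos n : recip_psi_coef c (S n) <= 0.
Proof.
induction n; [rewrite recip_psi_coef_1; lra|].
pose proof (recip_psi_coef_rec c n). pose proof (pos_INR n). nra.
Qed.

(* the recursion telescopes *)
Lemma rsum_recip_psi_coef N : c * rsum f N = c - (INR N + 2) * f N.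
Proof.
induction N; [unfold f; rewrite recip_psi_coef_1; cbn [rsum INR]; field|].
cbn [rsum]. rewrite Rmult_plus_distr_l, IHN, S_INR.
unfold f. pose proof (recip_psi_coef_rec c N). lra.
Qed.

Lemma rsum_recip_psi_coef_le_1 N : rsum f N <= 1.
Proof.
pose proof (rsum_recip_psi_coef N). pose proof (recip_psi_coef_nonpos N). pose proof (pos_INR N).
assert (0 <= (INR N + 2) * f N) by (apply Rmult_le_pos; unfold f; lra). nra.
Qed.

Lemma recip_psi_coef_abs_le_1 n : Rabs (recip_psi_coef c n) <= 1.
Proof.
destruct n; [cbn; rewrite Rabs_R1; lra|].
rewrite Rabs_left1 by apply recip_psi_coef_nonpos.
pose proof (rsum_recip_psi_coef_le_1 (S n)) as H. cbn [rsum] in H. fold (f n).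
assert (0 <= rsum f n); [|lra].
rewrite <- (Rmult_0_r (INR n)), <- rsum_const. apply rsum_le. intros k _.
unfold f. pose proof (recip_psi_coef_nonpos k). lra.
Qed.

Lemma recip_psi_psum z : unit_disc z -> psum (fun n => RtoC (recip_psi_coef c n)) z (recip_psi c z).
Proof.
intros hz. apply (epsilon_spec (inhabits (RtoC 0)) (psum (fun n => RtoC (recip_psi_coef c n)) z)).
destruct (psum_converges (fun n => RtoC (recip_psi_coef c n)) 1 1) with (z := z) as [l [hl _]]; try lra; auto.
- intros n. rewrite pow1, Cmod_R. pose proof (recip_psi_coef_abs_le_1 n). lra.
- now exists l.
Qed.

Lemma recip_psi_0 : recip_psi c 0 = RtoC 1.
Proof.
apply (psum_at_0 (fun n => RtoC (recip_psi_coef c n))). apply recip_psi_psum. unfold unit_disc. rewrite Cmod_0. lra.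
Qed.

Definition recip_psi' := C_derive (recip_psi c).
Definition recip_psi'' := C_derive recip_psi'.

Lemma recip_psi_deriv z : unit_disc z -> has_deriv (recip_psi c) z (recip_psi' z).
Proof. intros hz. now apply (psum_C_derive _ _ 1 recip_psi_psum z hz). Qed.

Lemma recip_psi'_psum z : unit_disc z -> psum (deriv_coeffs (fun n => RtoC (recip_psi_coef c n))) z (recip_psi' z).
Proof. intros hz. now apply (psum_C_derive _ _ 1 recip_psi_psum z hz). Qed.

Lemma recip_psi'_deriv z : unit_disc z -> has_deriv recip_psi' z (recip_psi'' z).
Proof. intros hz. now apply (psum_C_derive _ _ 1 recip_psi'_psum z hz). Qed.

Lemma recip_psi'_0 : recip_psi' 0 = RtoC (- c / 2).
Proof.
rewrite (psum_at_0 (deriv_coeffs (fun n => RtoC (recip_psi_coef c n))) (recip_psi' 0)).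
- unfold deriv_coeffs. cbn [INR]. rewrite recip_psi_coef_1. ring.
- apply recip_psi'_psum. unfold unit_disc. rewrite Cmod_0. lra.
Qed.

(* the equation z F' + h F = 1, multiplied by 1 - z *)
Lemma recip_psi_ode z : unit_disc z ->
  ((1 - z) * z * recip_psi' z + (1 - z + RtoC c * z) * recip_psi c z = 1 - z)%C.
Proof.
intros hz.
set (a := fun n => RtoC (recip_psi_coef c n)).
set (T := fun n => (RtoC (INR n + 1) * a n * z ^ n)%C).
assert (hzF' : cseries (fun n => RtoC (INR n) * a n * z ^ n)%C (z * recip_psi' z)%C).
{ replace (z * recip_psi' z)%C with (RtoC (INR 0) * a O * z ^ 0 + z * recip_psi' z)%C by (cbn; ring).
  apply (cseries_shift (fun n => RtoC (INR n) * a n * z ^ n)%C).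
  eapply cseries_ext; [|apply cseries_scal, (recip_psi'_psum z hz)].
  intros n. cbv beta. unfold deriv_coeffs, a. cbn [Cpow]. ring. }
pose proof (recip_psi_psum z hz) as hF.
assert (hT : cseries T (z * recip_psi' z + recip_psi c z)%C).
{ eapply cseries_ext; [|apply cseries_plus; [exact hzF'|exact hF]].
  intros n. unfold T, a. rewrite RtoC_plus. ring. }
set (l := (z * recip_psi' z + recip_psi c z)%C) in *.
assert (hTS : cseries (fun n => T (S n)) (l - T O)%C).
{ apply (cseries_shift T). replace (T O + (l - T O))%C with l by ring. auto. }
assert (T0 : T O = RtoC 1) by (unfold T, a; change (recip_psi_coef c 0) with 1; cbn [INR Cpow]; rewrite Rplus_0_l; ring).
rewrite T0 in hTS.
assert (h2 : cseries (fun n => z * ((-(1)) * (RtoC (INR n) * a n * z ^ n) + RtoC (c - 1) * (a n * z ^ n)))%C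
   (z * ((-(1)) * (z * recip_psi' z) + RtoC (c - 1) * recip_psi c z))%C).
{ apply cseries_scal, cseries_plus; apply cseries_scal; auto. }
assert (h3 : cseries (fun n => (-(1)) * T (S n) + match n with O => - z | S _ => RtoC 0 end)%C
   ((-(1)) * (l - 1) + (- z))%C).
{ apply cseries_plus; [now apply cseries_scal|apply cseries_delta]. }
assert (E : (z * ((-(1)) * (z * recip_psi' z) + RtoC (c - 1) * recip_psi c z) = (-(1)) * (l - 1) + (- z))%C).
{ eapply cseries_unique; [exact h2|]. eapply cseries_ext; [|exact h3].
  intros n. cbv beta. unfold T, a. destruct n.
  - rewrite recip_psi_coef_1. change (recip_psi_coef c 0) with 1. cbn [INR Cpow].
    replace (- c / 2) with (- (c / 2)) by field.
    replace (0 + 1 + 1) with 2 by ring. replace (1 + 1) with 2 by ring.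
    rewrite RtoC_opp, RtoC_div, RtoC_minus by lra. field.
  - pose proof (recip_psi_coef_rec c n) as R1. apply (f_equal RtoC) in R1. rewrite !RtoC_mult in R1.
    rewrite !S_INR. replace (INR n + 1 + 1 + 1) with (INR n + 3) by ring.
    rewrite R1. cbn [Cpow]. rewrite !RtoC_minus, !RtoC_plus. ring. }
unfold l in E. rewrite RtoC_minus in E.
replace ((1 - z) * z * recip_psi' z + (1 - z + RtoC c * z) * recip_psi c z)%C with
  (z * ((-(1)) * (z * recip_psi' z) + (RtoC c - 1) * recip_psi c z) + (z * recip_psi' z + recip_psi c z))%C by ring.
rewrite E. ring.
Qed.

(** All the coefficients of [F] but the first are nonpositive, and their sum is
    at least [-1]. *)
Lemma recip_psi_near_1 z : unit_disc z -> Cmod (recip_psi c z - 1) <= Cmod z.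
Proof.
intros hz. pose proof (recip_psi_psum z hz) as h.
assert (h' : cseries (fun n => RtoC (recip_psi_coef c (S n)) * z ^ S n)%C (recip_psi c z - 1)%C).
{ apply (cseries_shift (fun n => RtoC (recip_psi_coef c n) * z ^ n)%C).
  replace (RtoC (recip_psi_coef c 0) * z ^ 0 + (recip_psi c z - 1))%C with (recip_psi c z) by (cbn; ring). exact h. }
apply (cseries_bound _ _ _ h'). intros n.
unfold unit_disc in hz. pose proof (Cmod_ge_0 z).
apply Rle_trans with (Cmod z * rsum f n).
- clear h h'. induction n; cbn [csum rsum]; [rewrite Cmod_0; lra|].
  eapply Rle_trans; [apply Cmod_triangle|]. rewrite Rmult_plus_distr_l.
  apply Rplus_le_compat; auto. rewrite Cmod_mult, Cmod_pow, Cmod_R.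
  rewrite Rabs_left1 by apply recip_psi_coef_nonpos. fold (f n). cbn [pow].
  assert (0 <= f n) by (unfold f; pose proof (recip_psi_coef_nonpos n); lra).
  assert (Cmod z ^ n <= 1) by (rewrite <- (pow1 n); apply pow_incr; lra).
  assert (0 <= Cmod z ^ n) by (apply pow_le; lra).
  rewrite (Rmult_comm (f n)). apply Rmult_le_compat_r; auto. nra.
- pose proof (rsum_recip_psi_coef_le_1 n). nra.
Qed.

Lemma recip_psi_Re_pos z : unit_disc z -> 0 < Re (recip_psi c z).
Proof.
intros hz. pose proof (recip_psi_near_1 z hz). unfold unit_disc in hz.
pose proof (re_le_Cmod (recip_psi c z - 1)) as H1. apply Rabs_le_between in H1.
replace (Re (recip_psi c z - 1)%C) with (Re (recip_psi c z) - 1) in H1 by reflexivity. lra.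
Qed.

Lemma recip_psi_neq_0 z : unit_disc z -> recip_psi c z <> RtoC 0.
Proof. intros hz. now apply Re_pos_neq_0, recip_psi_Re_pos. Qed.

Lemma RtoC_c_neq_0 : RtoC c <> RtoC 0.
Proof. intros e. apply RtoC_inj in e. lra. Qed.

(** The ratio of the derivatives of [log (psi c)] and of [h = 1 + c z / (1 - z)].
    That its real part is positive is what makes [psi c] a dominant. *)
Definition log_psi_slope (z : C) : C := (- ((1 - z) * (1 - z)) * recip_psi' z / (RtoC c * recip_psi c z))%C.

Definition log_psi_slope' (z : C) : C :=
  ((2 * (1 - z) * recip_psi' z - (1 - z) * (1 - z) * recip_psi'' z) / (RtoC c * recip_psi c z)
   + (1 - z) * (1 - z) * recip_psi' z * recip_psi' z / (RtoC c * (recip_psi c z * recip_psi c z)))%C.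

Lemma log_psi_slope_deriv z : unit_disc z -> has_deriv log_psi_slope z (log_psi_slope' z).
Proof.
intros hz. pose proof (recip_psi_neq_0 z hz). pose proof RtoC_c_neq_0.
eapply has_deriv_eq.
- apply has_deriv_div.
  + apply has_deriv_mult; [|now apply recip_psi'_deriv].
    apply has_deriv_opp, has_deriv_mult; (apply has_deriv_minus; [apply has_deriv_const|apply has_deriv_id]).
  + apply has_deriv_scal. now apply recip_psi_deriv.
  + now apply Cmult_neq_0.
- cbv beta. unfold log_psi_slope'. field. split; auto.
Qed.

Lemma recip_psi_ode' z : unit_disc z ->
  ((1 - z) * z * recip_psi'' z + (2 - 3 * z + RtoC c * z) * recip_psi' z + (RtoC c - 1) * recip_psi c z = -(1))%C.
Proof.
intros hz.
assert (h1 : has_deriv (fun z => (1 - z) * z * recip_psi' z + (1 - z + RtoC c * z) * recip_psi c z)%C z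
  ((1 - z) * z * recip_psi'' z + (2 - 3 * z + RtoC c * z) * recip_psi' z + (RtoC c - 1) * recip_psi c z)%C).
{ eapply has_deriv_eq.
  - apply has_deriv_plus; apply has_deriv_mult; [| now apply recip_psi'_deriv | | now apply recip_psi_deriv].
    + apply has_deriv_mult; [|apply has_deriv_id].
      apply has_deriv_minus; [apply has_deriv_const|apply has_deriv_id].
    + apply has_deriv_plus; [apply has_deriv_minus; [apply has_deriv_const|apply has_deriv_id]|].
      apply has_deriv_scal, has_deriv_id.
  - cbv beta. ring. }
assert (h2 : has_deriv (fun z => 1 - z)%C z (-(1))%C).
{ eapply has_deriv_eq; [apply has_deriv_minus; [apply has_deriv_const|apply has_deriv_id]|ring]. }
eapply has_deriv_unique; [exact h1|]. eapply has_deriv_ext; [|exact h2].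
generalize (near_disc z 1 hz). apply near_imp. intros w hw. symmetry. now apply recip_psi_ode.
Qed.

(* after multiplication by c F^2, a combination of the equation for F and its derivative *)
Lemma log_psi_slope_ode z : unit_disc z ->
  (z * log_psi_slope' z + (/ recip_psi c z + (1 + z) / (1 - z)) * log_psi_slope z = 1)%C.
Proof.
intros hz. pose proof (recip_psi_neq_0 z hz) as n1. pose proof RtoC_c_neq_0 as n2. pose proof (one_minus_neq_0 z hz) as n3.
pose proof (recip_psi_ode z hz) as O1. pose proof (recip_psi_ode' z hz) as O2.
unfold log_psi_slope', log_psi_slope. set (F0 := recip_psi c z) in *. set (F1 := recip_psi' z) in *. set (F2 := recip_psi'' z) in *.
clearbody F0 F1 F2.
assert (E : (z * (2 * (1 - z) * F1 - (1 - z) * (1 - z) * F2) * F0 + z * ((1 - z) * (1 - z)) * F1 * F1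
   - (1 - z) * (1 - z) * F1 - (1 + z) * (1 - z) * F1 * F0 = RtoC c * (F0 * F0))%C).
{ transitivity (RtoC c * (F0 * F0)
    - (1 - z) * F0 * (((1 - z) * z * F2 + (2 - 3 * z + RtoC c * z) * F1 + (RtoC c - 1) * F0) + 1)
    + ((1 - z) * F1 - F0) * (((1 - z) * z * F1 + (1 - z + RtoC c * z) * F0) - (1 - z)))%C; [ring|].
  rewrite O1, O2. ring. }
transitivity ((z * (2 * (1 - z) * F1 - (1 - z) * (1 - z) * F2) * F0 + z * ((1 - z) * (1 - z)) * F1 * F1
   - (1 - z) * (1 - z) * F1 - (1 + z) * (1 - z) * F1 * F0) / (RtoC c * (F0 * F0)))%C; [field; auto|].
rewrite E. field. auto.
Qed.

Lemma log_psi_slope_0 : log_psi_slope 0 = RtoC (/ 2).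
Proof.
unfold log_psi_slope. rewrite recip_psi_0, recip_psi'_0. pose proof RtoC_c_neq_0.
replace (- c / 2) with (- (c * / 2)) by field. rewrite RtoC_opp, RtoC_mult. field. auto.
Qed.

(** At a first zero of [Re W], the number [z W'] is real and nonpositive.  By the
    equation [A W = 1 - z W'] is then a positive real number; this is impossible
    for [W] imaginary and [Re A > 0]. *)
Lemma log_psi_slope_Re_pos z : unit_disc z -> 0 < Re (log_psi_slope z).
Proof.
intros hz. apply NNPP. intros hn. unfold unit_disc in hz.
destruct (first_failure (fun z => 0 < Re (log_psi_slope z)) z) as [z0 [h1 [h2 h3]]]; auto.
{ intros y hy hp. apply (ccont_near log_psi_slope y (fun v => 0 < Re v)); [|now apply near_Re_pos].
  eapply has_deriv_cont, log_psi_slope_deriv. unfold unit_disc. lra. }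
assert (hz0 : unit_disc z0) by (unfold unit_disc; lra).
assert (hne : z0 <> RtoC 0).
{ intros ->. apply h2. rewrite log_psi_slope_0. cbn. lra. }
assert (hm : 0 < Cmod z0) by now apply Cmod_gt_0.
pose proof (log_psi_slope_deriv z0 hz0) as hd.
assert (hRe : Re (log_psi_slope z0) = 0).
{ apply Rle_antisym; [lra|]. apply Rnot_lt_le. intros hneg.
  assert (hnear : near z0 (fun w => Re (log_psi_slope w) < 0)).
  { apply (ccont_near log_psi_slope z0 (fun v => Re v < 0)); [now apply has_deriv_cont in hd|].
    assert (0 < Re (- log_psi_slope z0)%C) by (replace (Re (- log_psi_slope z0)%C) with (- Re (log_psi_slope z0)) by reflexivity; lra).
    destruct (near_Re_pos _ H) as [d [hd1 H1]]. exists d. split; auto. intros w hw.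
    specialize (H1 (- w)%C). replace (- w - - log_psi_slope z0)%C with (- (w - log_psi_slope z0))%C in H1 by ring.
    rewrite Cmod_opp in H1. specialize (H1 hw). change (0 < - Re w) in H1. lra. }
  destruct (near_radial z0 _ hne hnear) as [y [q1 q2]]. specialize (h3 y q1). lra. }
destruct (deriv_at_radial_minimum log_psi_slope z0 (log_psi_slope' z0) hne hd) as [k1 k2].
{ intros y hy. rewrite hRe. left. now apply h3. }
pose proof (log_psi_slope_ode z0 hz0) as E.
assert (hA : 0 < Re (/ recip_psi c z0 + (1 + z0) / (1 - z0))%C).
{ assert (p1 : 0 < Re (/ recip_psi c z0)%C).
  { pose proof (recip_psi_Re_pos z0 hz0). destruct (recip_psi c z0) as [u v]. unfold Re, Cinv in *; cbn in *.
    apply Rdiv_lt_0_compat; auto. nra. }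
  assert (p2 : 0 < Re ((1 + z0) / (1 - z0))%C).
  { pose proof (half_lt_Re_inv_one_minus z0 hz0).
    replace ((1 + z0) / (1 - z0))%C with (RtoC 2 * / (1 - z0) + RtoC (- (1)))%C
      by (rewrite RtoC_opp; field; now apply one_minus_neq_0).
    change (0 < Re (RtoC 2 * / (1 - z0))%C + - (1)). rewrite Re_RtoC_mult. lra. }
  change (0 < Re (/ recip_psi c z0)%C + Re ((1 + z0) / (1 - z0))%C). lra. }
set (A := (/ recip_psi c z0 + (1 + z0) / (1 - z0))%C) in *. set (X := (z0 * log_psi_slope' z0)%C) in *.
clearbody A X. destruct (log_psi_slope z0) as [u v]. destruct A as [p q]. destruct X as [x y].
pose proof (f_equal fst E) as e1. pose proof (f_equal snd E) as e2.
unfold Re, Im in *. cbn in *. subst u y.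
assert (hv : p * v = 0) by lra. apply Rmult_integral in hv. destruct hv as [hv|hv]; [lra|].
subst v. lra.
Qed.

Lemma recip_psi'_neq_0 z : unit_disc z -> recip_psi' z <> RtoC 0.
Proof.
intros hz E. pose proof (log_psi_slope_Re_pos z hz) as h. unfold log_psi_slope in h. rewrite E in h.
replace (- ((1 - z) * (1 - z)) * 0 / (RtoC c * recip_psi c z))%C with (RtoC 0) in h by (unfold Cdiv; ring).
cbn in h. lra.
Qed.

(** In the variable [v = 1 / (1 - z)], which maps the disc onto a half-plane,
    [log F] has derivative [- c W]; its real part does not vanish, so that
    [log F] is injective (Noshiro and Warschawski). *)
Lemma recip_psi_injective x y : unit_disc x -> unit_disc y -> recip_psi c x = recip_psi c y -> x = y.
Proof.
intros hx hy E. apply NNPP. intros hne.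
set (zv := fun v : C => (1 - / v)%C).
set (G := fun v => Clog (recip_psi c (zv v))).
set (G' := fun v => (- RtoC c * log_psi_slope (zv v))%C).
assert (hz : forall v, / 2 < Re v -> unit_disc (zv v) /\ v <> RtoC 0).
{ intros v h. assert (hv0 : v <> RtoC 0) by (apply Re_pos_neq_0; lra). split; auto.
  unfold unit_disc, zv. replace (1 - / v)%C with ((v - 1) / v)%C by (field; auto).
  assert (hp : 0 < Cmod v) by now apply Cmod_gt_0.
  rewrite Cmod_div by auto. apply Rmult_lt_reg_r with (Cmod v); auto.
  unfold Rdiv. rewrite Rmult_assoc, Rinv_l, Rmult_1_l, Rmult_1_r by lra.
  pose proof (Cmod2_alt v) as e1. pose proof (Cmod2_alt (v - 1)) as e2.
  pose proof (Cmod_ge_0 (v - 1)).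
  apply Rsqr_incrst_0; try lra. rewrite !Rsqr_pow2, e1, e2.
  destruct v as [a b]. unfold Re, Im in *; cbn in *. nra. }
assert (hG : forall v, / 2 < Re v -> has_deriv G v (G' v)).
{ intros v h. destruct (hz v h) as [h1 h2].
  pose proof (recip_psi_neq_0 _ h1) as n1. pose proof RtoC_c_neq_0 as n2.
  eapply has_deriv_eq.
  - apply (has_deriv_comp Clog (fun v => recip_psi c (zv v))).
    + apply has_deriv_Clog. now apply recip_psi_Re_pos.
    + apply (has_deriv_comp (recip_psi c) zv); [now apply recip_psi_deriv|].
      apply has_deriv_minus; [apply has_deriv_const|now apply has_deriv_Cinv].
  - unfold G', log_psi_slope. replace (1 - zv v)%C with (/ v)%C by (unfold zv; ring). field. auto. }
set (a := (/ (1 - x))%C). set (b := (/ (1 - y))%C).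
assert (za : zv a = x) by (unfold zv, a; field; now apply one_minus_neq_0).
assert (zb : zv b = y) by (unfold zv, b; field; now apply one_minus_neq_0).
assert (hab : (b - a)%C <> RtoC 0).
{ intros e. apply hne. rewrite <- za, <- zb. f_equal. 
  replace b with (b - a + a)%C by ring. rewrite e. ring. }
assert (hseg : forall s, 0 <= s <= 1 -> / 2 < Re (a + RtoC s * (b - a))%C).
{ intros s hs. pose proof (half_lt_Re_inv_one_minus x hx) as v1. pose proof (half_lt_Re_inv_one_minus y hy) as v2. fold a in v1. fold b in v2.
  clear za zb hab. clearbody a b.
  replace (a + RtoC s * (b - a))%C with (RtoC (1 - s) * a + RtoC s * b)%C by (rewrite RtoC_minus; ring).
  change (/ 2 < Re (RtoC (1 - s) * a)%C + Re (RtoC s * b)%C). rewrite !Re_RtoC_mult.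
  set (u := Re a) in *. set (v := Re b) in *. clearbody u v.
  assert (0 <= s * (v - / 2)) by (apply Rmult_le_pos; lra).
  destruct (Req_dec s 1) as [->|hs1]; [lra|].
  assert (0 < (1 - s) * (u - / 2)) by (apply Rmult_lt_0_compat; lra). lra. }
destruct (MVT_along_line G G' (/ (b - a)) a (b - a)) as [s [hs H]].
{ intros s hs. apply hG. now apply hseg. }
replace (a + (b - a))%C with b in H by ring.
replace (G b - G a)%C with (RtoC 0) in H by (unfold G; rewrite za, zb, E; ring).
rewrite Cmult_0_r in H.
specialize (hseg s hs). destruct (hz _ hseg) as [q1 _].
pose proof (log_psi_slope_Re_pos _ q1) as hW.
unfold G' in H.
set (w := log_psi_slope (zv (a + RtoC s * (b - a))%C)) in *.
replace (/ (b - a) * (- RtoC c * w) * (b - a))%C with (RtoC (- c) * w)%C in H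
  by (rewrite RtoC_opp; field; auto).
rewrite Re_RtoC_mult in H. change (Re (RtoC 0)) with 0 in H.
assert (0 < c * Re w) by (apply Rmult_lt_0_compat; lra). lra.
Qed.

End Dominant.

(** * Subordination to the dominant *)

Lemma C1_at_local g g' h z : near z (fun w => h w = g w) -> near z (C1_at g g') ->
  C1_at h (C_derive h) z.
Proof.
intros E H. 
assert (K : near z (fun w => has_deriv h w (g' w))).
{ generalize (near_and (near_near _ _ E) H). apply near_imp. intros w [e [k _]].
  apply has_deriv_ext with g; auto. generalize e. apply near_imp. auto. }
pose proof (near_self _ _ H) as [h1 h2]. pose proof (near_self _ _ K) as k0. cbv beta in k0.
split; [now rewrite (has_deriv_C_derive _ _ _ k0)|].
apply ccont_ext with g'; auto. generalize K. apply near_imp. intros w k.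
symmetry. now apply has_deriv_C_derive.
Qed.

Lemma analytic_C1_at f z : analytic_at f z -> C1_at f (C_derive f) z.
Proof.
intros h. split; [now apply analytic_has_deriv|].
eapply has_deriv_cont. now apply analytic_has_deriv, analytic_C_derive.
Qed.

(** The map [w / (1 - w)] sends the disc [|w| < |o|] onto a disc.  The inequality
    says that the image of [w] lies on the inner side of the tangent line at the
    image of [o]. *)
Lemma horocycle_inequality (o w : C) : Cmod o < 1 -> Cmod w < Cmod o ->
  Re ((w - o) * (1 - o) * Cconj ((1 - w) * o)) < 0.
Proof.
intros ho hw.
assert (E : 2 * Re ((w - o) * (1 - o) * Cconj ((1 - w) * o)) =
  Cmod (1 - o) ^ 2 * (Cmod w ^ 2 - Cmod o ^ 2) - (1 - Cmod o ^ 2) * Cmod (w - o) ^ 2).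
{ rewrite !Cmod2_alt. destruct o, w. unfold Re, Im, Cconj, Cmult, Cminus, Cplus, Copp, RtoC; cbn. ring. }
pose proof (Cmod_ge_0 w). pose proof (Cmod_ge_0 (w - o)).
assert (h1 : 0 < Cmod (1 - o)).
{ pose proof (Cmod_triangle_rev 1 o). rewrite Cmod_1 in H1. lra. }
assert (0 < Cmod (1 - o) ^ 2) by (apply pow_lt; auto).
assert (Cmod w ^ 2 < Cmod o ^ 2) by nra.
assert (0 < 1 - Cmod o ^ 2) by nra.
assert (0 <= (1 - Cmod o ^ 2) * Cmod (w - o) ^ 2) by (apply Rmult_le_pos; [lra|apply pow2_ge_0]).
assert (0 < Cmod (1 - o) ^ 2 * (Cmod o ^ 2 - Cmod w ^ 2)) by (apply Rmult_lt_0_compat; lra).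
lra.
Qed.

Section Subordination.

Variables (c : R) (f : C -> C).
Hypothesis hc : 0 < c <= 2.
Hypothesis hf : class_F c f.

Let f1 := C_derive f.
Let f2 := C_derive f1.

Let f_an z (hz : unit_disc z) : analytic_at f z := proj1 (proj1 hf) z hz.
Let f_C1 z (hz : unit_disc z) : C1_at f f1 z := analytic_C1_at f z (f_an z hz).
Let f1_C1 z (hz : unit_disc z) : C1_at f1 f2 z :=
  analytic_C1_at f1 z (analytic_C_derive f z (f_an z hz)).
Let f2_C1 z (hz : unit_disc z) : C1_at f2 (C_derive f2) z :=
  analytic_C1_at f2 z (analytic_C_derive f1 z (analytic_C_derive f z (f_an z hz))).

Let f1_neq_0 z : unit_disc z -> f1 z <> RtoC 0.
Proof. intros hz. now apply (proj2 hf). Qed.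

Let Re_bound z : unit_disc z -> - c / 2 < Re (z * f2 z / f1 z).
Proof.
intros hz. pose proof (proj2 (proj2 hf z hz)) as h.
change (Re (1 + z * f2 z / f1 z) > 1 - c / 2) in h.
change (Re (1 + z * f2 z / f1 z)) with (1 + Re (z * f2 z / f1 z)%C) in h. lra.
Qed.

(** The reciprocal of [z f' / f], with its removable singularity removed. *)
Definition recip_log_deriv (z : C) : C :=
  if Ceq_dec z 0 then RtoC 1 else (f z / (z * C_derive f z))%C.

Let Ff := recip_log_deriv.

Let Ff_near_0 : exists g, near 0 (fun w => Ff w = (g w / f1 w)%C) /\
  near 0 (C1_at g (C_derive g)) /\ g (RtoC 0) = RtoC 1 /\ C_derive g 0 = (f2 0 / 2)%C.
Proof.
destruct (proj1 (analytic_at_psum f 0) (f_an 0 zero_in_unit_disc)) as [a [r [hr h]]].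
assert (h' : forall w, Cmod w < r -> psum a w (f w)).
{ intros w hw. specialize (h w hw). now replace (0 + w)%C with w in h by ring. }
assert (hr0 : Cmod 0 < r) by (rewrite Cmod_0; auto).
assert (a0 : a O = RtoC 0).
{ rewrite <- (psum_at_0 a _ (h' 0 hr0)). apply (proj1 hf). }
assert (a1 : a 1%nat = RtoC 1).
{ destruct (psum_C_derive a f r h' 0 hr0) as [k _]. apply psum_at_0 in k.
  pose proof (proj2 (proj2 (proj1 hf))) as e. rewrite e in k. unfold deriv_coeffs in k. cbn in k.
  rewrite k. ring. }
assert (h1 : forall w, Cmod w < r -> psum (deriv_coeffs a) w (f1 w)).
{ intros w hw. now apply (psum_C_derive a f r h' w hw). }
assert (a2 : a 2%nat = (f2 0 / 2)%C).
{ destruct (psum_C_derive _ f1 r h1 0 hr0) as [k _]. apply psum_at_0 in k.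
  fold f2 in k. rewrite k. unfold deriv_coeffs. cbn [INR].
  replace (1 + 1) with 2 by ring. field. }
set (g := fun w => if Ceq_dec w 0 then RtoC 1 else (f w / w)%C).
assert (hg : forall w, Cmod w < r -> psum (fun n => a (S n)) w (g w)).
{ intros w hw. unfold g. destruct (Ceq_dec w 0) as [->|n].
  - rewrite <- a1. apply (psum_0 (fun n => a (S n))).
  - assert (k : cseries (fun n => a (S n) * w ^ S n)%C (f w)).
    { apply (cseries_shift (fun n => a n * w ^ n)%C). rewrite a0.
      replace (0 * w ^ 0 + f w)%C with (f w) by ring. exact (h' w hw). }
    apply (cseries_scal (/ w)) in k. 
    replace (f w / w)%C with (/ w * f w)%C by (field; auto).
    eapply cseries_ext; [|exact k]. intros m. cbn [Cpow]. field. auto. }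
exists g. split; [|split; [|split]].
- generalize (near_disc 0 1 zero_in_unit_disc). apply near_imp. intros w hw.
  unfold Ff, recip_log_deriv, g. destruct (Ceq_dec w 0) as [->|n].
  + fold f1. pose proof (proj2 (proj2 (proj1 hf))) as e. fold f1 in e. rewrite e. field.
  + fold f1. field. split; auto.
- generalize (near_disc 0 r hr0). apply near_imp. intros w hw.
  destruct (psum_C_derive _ g r hg w hw) as [k1 k2]. split; auto.
  assert (k3 : forall v, Cmod v < r -> psum (deriv_coeffs (fun n => a (S n))) v (C_derive g v)).
  { intros v hv. now apply (psum_C_derive _ g r hg v hv). }
  destruct (psum_C_derive _ _ r k3 w hw) as [_ k4]. now apply has_deriv_cont in k4.
- unfold g. destruct (Ceq_dec 0 0); congruence.
- destruct (psum_C_derive _ g r hg 0 hr0) as [k _]. apply psum_at_0 in k.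
  rewrite k. unfold deriv_coeffs. rewrite a2. cbn [INR]. ring.
Qed.

Lemma recip_log_deriv_C1 z : unit_disc z -> C1_at Ff (C_derive Ff) z.
Proof.
intros hz. destruct (Ceq_dec z 0) as [->|hne].
- destruct Ff_near_0 as [g [E [hg _]]].
  apply C1_at_local with (fun w => g w / f1 w)%C
    (fun w => (C_derive g w * f1 w - g w * f2 w) / (f1 w * f1 w))%C; auto.
  generalize (near_and hg (near_disc 0 1 hz)). apply near_imp. intros w [[k1 k2] hw].
  destruct (f1_C1 w hw) as [k3 k4]. pose proof (f1_neq_0 w hw) as n.
  pose proof (has_deriv_cont _ _ _ k1). pose proof (has_deriv_cont _ _ _ k3).
  split; [now apply has_deriv_div|].
  apply ccont_div; [apply ccont_minus; now apply ccont_mult|now apply ccont_mult|now apply Cmult_neq_0].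
- apply C1_at_local with (fun w => f w / (w * f1 w))%C
    (fun w => (f1 w * (w * f1 w) - f w * (1 * f1 w + w * f2 w)) / ((w * f1 w) * (w * f1 w)))%C.
  + generalize (near_neq z 0 hne). apply near_imp. intros w hw.
    unfold Ff, recip_log_deriv. destruct (Ceq_dec w 0); [congruence|reflexivity].
  + generalize (near_and (near_neq z 0 hne) (near_disc z 1 hz)). apply near_imp. intros w [hw0 hw].
    destruct (f_C1 w hw) as [k1 k2], (f1_C1 w hw) as [k3 k4]. pose proof (f1_neq_0 w hw) as n.
    pose proof (has_deriv_cont _ _ _ k1). pose proof (has_deriv_cont _ _ _ k3).
    assert (hm : has_deriv (fun w => w * f1 w)%C w (1 * f1 w + w * f2 w)%C).
    { apply has_deriv_mult; [apply has_deriv_id|auto]. }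
    pose proof (has_deriv_cont _ _ _ hm).
    assert (hn : (w * f1 w)%C <> RtoC 0) by now apply Cmult_neq_0.
    split; [now apply (has_deriv_div f (fun w => w * f1 w)%C)|].
    apply ccont_div; [|now apply (ccont_mult (fun w => w * f1 w) (fun w => w * f1 w))%C|now apply Cmult_neq_0].
    apply ccont_minus; [now apply (ccont_mult f1 (fun w => w * f1 w)%C)|].
    apply (ccont_mult f (fun w => 1 * f1 w + w * f2 w)%C); auto.
    apply ccont_plus; apply ccont_mult; auto; [apply ccont_const|apply ccont_id].
Qed.

Lemma recip_log_deriv_ode z : unit_disc z -> z <> RtoC 0 ->
  (z * C_derive Ff z + (1 + z * f2 z / f1 z) * Ff z = 1)%C.
Proof.
intros hz hne. destruct (f_C1 z hz) as [k1 _], (f1_C1 z hz) as [k3 _]. pose proof (f1_neq_0 z hz) as n.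
assert (hn : (z * f1 z)%C <> RtoC 0) by now apply Cmult_neq_0.
assert (h : has_deriv Ff z ((f1 z * (z * f1 z) - f z * (1 * f1 z + z * f2 z)) / ((z * f1 z) * (z * f1 z)))%C).
{ apply has_deriv_ext with (fun w => f w / (w * f1 w))%C.
  - generalize (near_neq z 0 hne). apply near_imp. intros w hw.
    unfold Ff, recip_log_deriv. destruct (Ceq_dec w 0); [congruence|reflexivity].
  - apply (has_deriv_div f (fun w => w * f1 w)%C); auto. apply has_deriv_mult; [apply has_deriv_id|auto]. }
rewrite (has_deriv_C_derive _ _ _ h).
replace (Ff z) with (f z / (z * f1 z))%C.
2:{ unfold Ff, recip_log_deriv. destruct (Ceq_dec z 0); [congruence|reflexivity]. }
field. auto.
Qed.

Lemma recip_log_deriv_0 : Ff 0 = RtoC 1.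
Proof. unfold Ff, recip_log_deriv. destruct (Ceq_dec 0 0); congruence. Qed.

(** [1 + z f'' / f' = h (z * Phi z)], where [h w = 1 + c w / (1 - w)]. *)
Let Phi (z : C) : C := (f2 z / (z * f2 z + RtoC c * f1 z))%C.

Let Phi_den z : unit_disc z -> (z * f2 z + RtoC c * f1 z)%C <> RtoC 0.
Proof.
intros hz E. pose proof (Re_bound z hz) as h. pose proof (f1_neq_0 z hz) as n.
replace (z * f2 z / f1 z)%C with ((z * f2 z + RtoC c * f1 z) / f1 z - RtoC c)%C in h by (field; auto).
rewrite E in h. replace (0 / f1 z - RtoC c)%C with (RtoC (- c)) in h by (rewrite RtoC_opp; field; auto).
cbn in h. lra.
Qed.

Let zPhi_le z : unit_disc z -> Cmod (z * Phi z) <= 1.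
Proof.
intros hz. pose proof (Re_bound z hz) as h. pose proof (f1_neq_0 z hz) as n.
pose proof (Phi_den z hz) as n2.
set (u := (z * f2 z / f1 z)%C) in *.
assert (E1 : (z * f2 z)%C = (u * f1 z)%C) by (unfold u; field; auto).
assert (n3 : (u + RtoC c)%C <> RtoC 0).
{ intros e. apply n2. rewrite E1. replace (u * f1 z + RtoC c * f1 z)%C with ((u + RtoC c) * f1 z)%C by ring.
  rewrite e. ring. }
replace (z * Phi z)%C with (u / (u + RtoC c))%C.
2:{ unfold Phi. rewrite E1. unfold u. field. repeat split; auto. }
rewrite Cmod_div by auto.
assert (hp : 0 < Cmod (u + RtoC c)) by now apply Cmod_gt_0.
apply Rle_div_l; auto. rewrite Rmult_1_l.
apply Rsqr_incr_0; [|apply Cmod_ge_0|lra]. rewrite !Rsqr_pow2, !Cmod2_alt.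
clearbody u. destruct u as [x y]. unfold Re, Im in *; cbn in *. nra.
Qed.

(** Schwarz's lemma, from the maximum principle on circles of radius close to 1. *)
Let Phi_le z : unit_disc z -> Cmod (Phi z) <= 1.
Proof.
intros hz. apply Rnot_lt_le. intros hlt. unfold unit_disc in hz.
set (m := Rmax (Cmod z) (/ Cmod (Phi z))).
assert (hm : m < 1).
{ apply Rmax_lub_lt; auto. rewrite <- Rinv_1. apply Rinv_lt_contravar; lra. }
assert (h1 : Cmod z <= m) by apply Rmax_l. assert (h2 : / Cmod (Phi z) <= m) by apply Rmax_r.
set (r := (1 + m) / 2).
assert (h3 : 0 < / Cmod (Phi z)) by (apply Rinv_0_lt_compat; lra).
assert (hC : C1_on unit_disc Phi).
{ assert (k1 : C1_on unit_disc f1) by (exists f2; auto).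
  assert (k2 : C1_on unit_disc f2) by (exists (C_derive f2); auto).
  apply C1_on_mult; auto. apply C1_on_inv; auto.
  apply C1_on_plus; apply C1_on_mult; auto; [apply C1_on_id|apply C1_on_const]. }
destruct hC as [g' hg'].
assert (K : Cmod (Phi z) <= / r).
{ apply (maximum_modulus Phi g' z r 1); auto; try (unfold r; lra).
  - apply Rinv_0_lt_compat. unfold r. lra.
  - intros w hw. assert (hwd : unit_disc w) by (unfold unit_disc; unfold r in hw; lra).
    pose proof (zPhi_le w hwd) as k. rewrite Cmod_mult, hw in k.
    apply Rmult_le_reg_l with r; [unfold r; lra|]. rewrite Rinv_r by (unfold r; lra). lra. }
assert (/ r < Cmod (Phi z)); [|lra].
rewrite <- (Rinv_inv (Cmod (Phi z))). apply Rinv_lt_contravar; [|unfold r; lra].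
apply Rmult_lt_0_compat; unfold r; lra.
Qed.

Let Ff'_0_bound : Cmod (C_derive Ff 0) <= c / 2.
Proof.
destruct Ff_near_0 as [g [E [hg [g0 g1]]]].
destruct (near_self _ _ hg) as [k1 _]. destruct (f1_C1 0 zero_in_unit_disc) as [k3 _].
pose proof (f1_neq_0 0 zero_in_unit_disc) as n.
assert (h : has_deriv Ff 0 ((C_derive g 0 * f1 0 - g 0 * f2 0) / (f1 0 * f1 0))%C).
{ apply has_deriv_ext with (fun w => g w / f1 w)%C; [|now apply has_deriv_div].
  generalize E. apply near_imp. auto. }
assert (e1 : f1 0 = RtoC 1) by (apply (proj1 hf)).
rewrite (has_deriv_C_derive _ _ _ h), g0, g1, e1.
pose proof (Phi_le 0 zero_in_unit_disc) as hP. unfold Phi in hP. rewrite e1 in hP.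
replace (f2 0 / (0 * f2 0 + RtoC c * 1))%C with (f2 0 / RtoC c)%C in hP.
2:{ replace (0 * f2 0 + RtoC c * 1)%C with (RtoC c) by ring. reflexivity. }
rewrite Cmod_div, Cmod_R, Rabs_pos_eq in hP by (try apply RtoC_c_neq_0; lra).
replace ((f2 0 / 2 * 1 - 1 * f2 0) / (1 * 1))%C with (- (f2 0 / 2))%C by field.
rewrite Cmod_opp, Cmod_div, Cmod_R, Rabs_pos_eq; try lra.
- apply Rle_div_l in hP; lra.
- apply RtoC_neq; lra.
Qed.

Definition subordinating_function (z : C) : C :=
  epsilon (inhabits (RtoC 0)) (fun o => unit_disc o /\ recip_psi c o = Ff z).

Let omega := subordinating_function.

Let omega_eq z o : unit_disc o -> recip_psi c o = Ff z -> omega z = o.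
Proof.
intros h1 h2. unfold omega, subordinating_function.
destruct (epsilon_spec (inhabits (RtoC 0)) (fun o => unit_disc o /\ recip_psi c o = Ff z)) as [k1 k2].
{ now exists o. }
apply (recip_psi_injective c hc); auto. congruence.
Qed.

Let recip_psi_open o : unit_disc o -> forall e, 0 < e ->
  near (recip_psi c o) (fun y => exists z, Cmod (z - o) < e /\ recip_psi c z = y).
Proof.
intros ho. apply open_mapping with (recip_psi' c).
generalize (near_disc o 1 ho). apply near_imp. intros w hw.
split; [now apply recip_psi_deriv|now apply recip_psi'_neq_0].
Qed.

Let omega_near z o : unit_disc z -> unit_disc o -> recip_psi c o = Ff z -> forall e, 0 < e ->
  near z (fun w => unit_disc (omega w) /\ recip_psi c (omega w) = Ff w /\ Cmod (omega w - o) < e).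
Proof.
intros hz ho E e he. destruct (recip_log_deriv_C1 z hz) as [k _]. apply has_deriv_cont in k.
unfold unit_disc in ho.
assert (hm : 0 < Rmin e (1 - Cmod o)) by (apply Rmin_pos; lra).
pose proof (recip_psi_open o ho _ hm) as H. rewrite E in H.
generalize (ccont_near Ff z _ k H). apply near_imp. intros w [o' [h1 h2]].
pose proof (Rmin_l e (1 - Cmod o)). pose proof (Rmin_r e (1 - Cmod o)).
pose proof (Cmod_triangle_rev o' o).
assert (ho' : unit_disc o') by (unfold unit_disc; lra).
rewrite (omega_eq w o') by auto. repeat split; auto. lra.
Qed.

Let omega_deriv z o : unit_disc z -> unit_disc o -> recip_psi c o = Ff z ->
  ccont omega z /\ has_deriv omega z (C_derive Ff z / recip_psi' c o)%C.
Proof.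
intros hz ho E. pose proof (omega_eq z o ho E) as Eo.
assert (hcn : ccont omega z).
{ intros e he. rewrite Eo. generalize (omega_near z o hz ho E e he). apply near_imp. tauto. }
split; auto.
apply (has_deriv_implicit (recip_psi c) Ff).
- auto.
- generalize (omega_near z o hz ho E 1 ltac:(lra)). apply near_imp. tauto.
- rewrite Eo. now apply recip_psi_deriv.
- now apply recip_psi'_neq_0.
- now apply recip_log_deriv_C1.
Qed.

Section Radial_bound.

Variables (z1 : C) (kappa : R).
Hypothesis hkappa : 1 < kappa.
Hypothesis hz1 : kappa * Cmod z1 < 1.

Let Good z := z = RtoC 0 \/ exists o, Cmod o < kappa * Cmod z /\ recip_psi c o = Ff z.

Let in_disc z : Cmod z <= Cmod z1 -> kappa * Cmod z < 1 /\ unit_disc z.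
Proof.
intros h. pose proof (Cmod_ge_0 z). unfold unit_disc.
assert (kappa * Cmod z <= kappa * Cmod z1) by (apply Rmult_le_compat_l; lra).
split; [lra|]. nra.
Qed.

(* near 0 the equation F(o) = Ff(z) reads - (c/2) o + ... = Ff'(0) z + ..., and |Ff'(0)| <= c/2 *)
Let good_near_0 : near 0 Good.
Proof.
set (A := c / 2). set (ep := A * (kappa - 1) / (2 * (kappa + 1))).
assert (hA : 0 < A) by (unfold A; lra).
assert (hep : 0 < ep) by (unfold ep; apply Rdiv_lt_0_compat; [apply Rmult_lt_0_compat|]; lra).
assert (hep2 : (A + ep) < kappa * (A - ep)).
{ assert (ep * (kappa + 1) = A * (kappa - 1) / 2) by (unfold ep; field; lra).
  assert (0 < A * (kappa - 1)) by (apply Rmult_lt_0_compat; lra). nra. }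
assert (hepA : ep < A) by nra.
destruct (recip_psi_deriv c hc 0 zero_in_unit_disc ep hep) as [d1 [hd1 H1]].
destruct (recip_log_deriv_C1 0 zero_in_unit_disc) as [k _].
pose proof (k ep hep) as H2. apply has_deriv_cont in k.
pose proof (recip_psi_open 0 zero_in_unit_disc d1 hd1) as H3. rewrite recip_psi_0, <- recip_log_deriv_0 in H3 by auto.
generalize (near_and H2 (ccont_near Ff 0 _ k H3)). apply near_imp.
intros w [h2 [o [h3 h4]]]. destruct (Ceq_dec w 0) as [->|n]; [now left|right].
exists o. split; auto. specialize (H1 o h3).
rewrite recip_psi_0, recip_psi'_0, h4 in H1 by auto. rewrite recip_log_deriv_0 in h2.
replace (w - 0)%C with w in h2 by ring. replace (o - 0)%C with o in H1 by ring.
set (y := (Ff w - 1)%C) in *.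
assert (B1 : A * Cmod o <= Cmod y + ep * Cmod o).
{ replace (A * Cmod o) with (Cmod (RtoC (- c / 2) * o)).
  2:{ rewrite Cmod_mult, Cmod_R. replace (- c / 2) with (- A) by (unfold A; field).
      rewrite Rabs_Ropp, Rabs_pos_eq by lra. reflexivity. }
  pose proof (Cmod_triangle_rev (RtoC (- c / 2) * o) y) as tr. rewrite Cmod_sub_sym in tr. lra. }
assert (B2 : Cmod y <= A * Cmod w + ep * Cmod w).
{ pose proof (Cmod_triangle_rev y (C_derive Ff 0 * w)) as tr. rewrite Cmod_mult in tr.
  pose proof Ff'_0_bound as hb. fold A in hb. pose proof (Cmod_ge_0 w).
  assert (Cmod (C_derive Ff 0) * Cmod w <= A * Cmod w) by (apply Rmult_le_compat_r; auto). lra. }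
assert (hw : 0 < Cmod w) by now apply Cmod_gt_0.
apply Rmult_lt_reg_l with (A - ep); [lra|].
apply Rle_lt_trans with ((A + ep) * Cmod w); [lra|].
replace ((A - ep) * (kappa * Cmod w)) with (kappa * (A - ep) * Cmod w) by ring.
apply Rmult_lt_compat_r; auto.
Qed.

Let good_open z : Cmod z <= Cmod z1 -> Good z -> near z Good.
Proof.
intros hz [->|[o [h1 h2]]]; [apply good_near_0|].
destruct (in_disc z hz) as [h3 h4].
assert (ho : unit_disc o) by (unfold unit_disc; lra).
set (m := kappa * Cmod z - Cmod o). assert (hm : 0 < m) by (unfold m; lra).
assert (hb : 0 < m / 2 / kappa) by (repeat apply Rdiv_lt_0_compat; lra).
generalize (near_and (omega_near z o h4 ho h2 (m/2) ltac:(lra)) (near_ball z _ hb)).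
apply near_imp. intros w [[k1 [k2 k3]] k4]. right. exists (omega w). split; auto.
pose proof (Cmod_triangle_rev (omega w) o). pose proof (Cmod_triangle_rev z w) as tr.
rewrite Cmod_sub_sym in tr.
assert (kappa * (Cmod z - Cmod w) < m / 2).
{ apply Rle_lt_trans with (kappa * Cmod (w - z)); [apply Rmult_le_compat_l; lra|].
  apply Rlt_le_trans with (kappa * (m / 2 / kappa)); [apply Rmult_lt_compat_l; lra|]. right; field; lra. }
unfold m in *. lra.
Qed.

(* the least value of |F - Ff z0| over the closed disc must be zero *)
Let limit_solution z0 : unit_disc z0 -> kappa * Cmod z0 < 1 -> z0 <> RtoC 0 ->
  (forall z, Cmod z < Cmod z0 -> Good z) ->
  exists o, Cmod o <= kappa * Cmod z0 /\ recip_psi c o = Ff z0.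
Proof.
intros hz hk hne hG.
assert (hod : forall o, Cmod o <= kappa * Cmod z0 -> unit_disc o) by (intros o ho; unfold unit_disc; lra).
destruct (min_modulus_attained (fun o => Cmod o <= kappa * Cmod z0) (fun o => recip_psi c o - Ff z0)%C
  (kappa * Cmod z0) 0) as [o [h1 h2]].
- auto.
- intros o. apply near_not_closed_disc.
- intros o ho. apply ccont_minus; [|apply ccont_const]. eapply has_deriv_cont, recip_psi_deriv; auto.
- rewrite Cmod_0. pose proof (Cmod_ge_0 z0). nra.
- exists o. split; auto. apply NNPP. intros hn.
  destruct (recip_log_deriv_C1 z0 hz) as [k _]. apply has_deriv_cont in k.
  destruct (near_radial z0 _ hne (near_and (near_neq z0 0 hne)
    (k _ (Cmod_minus_pos _ _ hn)))) as [w [q1 [q2 q3]]].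
  destruct (hG w q1) as [e|[o' [k1 k2]]]; [congruence|].
  assert (ho' : Cmod o' <= kappa * Cmod z0).
  { assert (kappa * Cmod w <= kappa * Cmod z0) by (apply Rmult_le_compat_l; lra). lra. }
  specialize (h2 o' ho'). rewrite k2 in h2. lra.
Qed.

(** Jack's argument.  At a first point [z0] where [|omega| = kappa |z0|], the number
    [z0 omega' / omega] is real and at least 1.  The two differential equations
    then place [1 + z f'' / f'] outside the image under [h] of the disc of radius
    [|omega z0|], although it is [h (z0 * Phi z0)] with [|Phi| <= 1 < kappa]. *)
Lemma radial_bound : z1 <> RtoC 0 -> exists o, Cmod o < kappa * Cmod z1 /\ recip_psi c o = Ff z1.
Proof.
intros hne1. apply NNPP. intros hbad.
destruct (first_failure Good z1) as [z0 [h1 [h2 h3]]].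
{ apply good_open. }
{ intros [e|e]; [congruence|auto]. }
destruct (in_disc z0 h1) as [hk hz0].
assert (hne : z0 <> RtoC 0) by (intros e; apply h2; now left).
assert (hp : 0 < Cmod z0) by now apply Cmod_gt_0.
destruct (limit_solution z0 hz0 hk hne h3) as [o [ho1 ho2]].
assert (ho : Cmod o = kappa * Cmod z0).
{ apply Rle_antisym; auto. apply Rnot_lt_le. intros hlt. apply h2. right. now exists o. }
assert (hod : unit_disc o) by (unfold unit_disc; lra).
assert (hone : o <> RtoC 0).
{ apply Cmod_gt_0. rewrite ho. apply Rmult_lt_0_compat; lra. }
pose proof (omega_eq z0 o hod ho2) as Eo.
destruct (omega_deriv z0 o hz0 hod ho2) as [_ hd].
set (od := (C_derive Ff z0 / recip_psi' c o)%C) in *.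
(* |omega(z) / z| over the disc |z| < |z0| is at most its value at z0 *)
set (g := fun z => (- (RtoC 1) * (z0 / o) * (omega z * / z))%C).
assert (hg : has_deriv g z0 (- (RtoC 1) * (z0 / o) * (od * / z0 + o * (- (1) / (z0 * z0))))%C).
{ unfold g. apply has_deriv_scal. eapply has_deriv_eq.
  - apply has_deriv_mult; [exact hd|]. apply has_deriv_inv; [apply has_deriv_id|auto].
  - rewrite Eo. reflexivity. }
destruct (deriv_at_radial_minimum g z0 _ hne hg) as [m1 m2].
{ intros z hz.
  assert (g0 : g z0 = (- (1))%C) by (unfold g; rewrite Eo; field; auto).
  rewrite g0. change (Re (- (1))%C) with (- (1)).
  assert (hle : Cmod (g z) <= 1).
  { unfold g. destruct (Ceq_dec z 0) as [->|n].
    - replace (/ 0)%C with (RtoC 0).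
      + rewrite !Cmult_0_r, Cmod_0. lra.
      + unfold Cinv, RtoC; cbn. f_equal; unfold Rdiv; ring.
    - destruct (h3 z hz) as [e|[o' [k1 k2]]]; [congruence|].
      assert (hzd : Cmod z <= Cmod z1) by lra. destruct (in_disc z hzd) as [q1 q2].
      rewrite (omega_eq z o') by (auto; unfold unit_disc; lra).
      assert (0 < Cmod z) by now apply Cmod_gt_0.
      rewrite !Cmod_mult, Cmod_opp, Cmod_1, Rmult_1_l, Cmod_inv by auto.
      rewrite Cmod_div, ho by auto.
      apply Rmult_le_reg_r with (kappa * Cmod z); [apply Rmult_lt_0_compat; lra|].
      replace (Cmod z0 / (kappa * Cmod z0) * (Cmod o' * / Cmod z) * (kappa * Cmod z)) with (Cmod o') by (field; lra).
      lra. }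
  pose proof (re_le_Cmod (g z)) as hr. apply Rabs_le_between in hr. lra. }
replace (z0 * (- (RtoC 1) * (z0 / o) * (od * / z0 + o * (- (1) / (z0 * z0)))))%C with (1 - z0 * od / o)%C in m1, m2
  by (field; auto).
set (mu := - Re (1 - z0 * od / o)%C). assert (hmu : 0 <= mu) by (unfold mu; lra).
assert (Emu : (z0 * od)%C = (RtoC (1 + mu) * o)%C).
{ assert (e : (1 - z0 * od / o)%C = RtoC (- mu)).
  { unfold mu. destruct (1 - z0 * od / o)%C as [x y]. unfold Re, Im, RtoC in *; cbn in *. f_equal; lra. }
  replace (z0 * od)%C with ((1 - (1 - z0 * od / o)) * o)%C by (field; auto).
  rewrite e, RtoC_opp, RtoC_plus. ring. }
pose proof (recip_psi'_neq_0 c hc o hod) as nF'. pose proof (recip_psi_neq_0 c hc o hod) as nF.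
pose proof (recip_psi_ode c hc o hod) as O1. pose proof (recip_log_deriv_ode z0 hz0 hne) as O2. rewrite <- ho2 in O2.
pose proof (log_psi_slope_Re_pos c hc o hod) as hW.
pose proof (one_minus_neq_0 o hod) as no. pose proof (RtoC_c_neq_0 c hc) as nc.
pose proof (f1_neq_0 z0 hz0) as nf. pose proof (Phi_den z0 hz0) as nd.
set (phi := (z0 * Phi z0)%C).
assert (hphi : Cmod phi < Cmod o).
{ unfold phi. rewrite Cmod_mult, ho. pose proof (Phi_le z0 hz0).
  apply Rle_lt_trans with (Cmod z0 * 1); [apply Rmult_le_compat_l; lra|]. nra. }
assert (nphi : (1 - phi)%C <> RtoC 0).
{ apply one_minus_neq_0. unfold unit_disc in *. lra. }
assert (EP : (1 + z0 * f2 z0 / f1 z0)%C = (1 + RtoC c * phi / (1 - phi))%C).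
{ assert (e : (1 - phi)%C = (RtoC c * f1 z0 / (z0 * f2 z0 + RtoC c * f1 z0))%C).
  { unfold phi, Phi. field. auto. }
  rewrite e. unfold phi, Phi. field. auto. }
rewrite EP in O2.
assert (EFf : (z0 * C_derive Ff z0)%C = (RtoC (1 + mu) * o * recip_psi' c o)%C).
{ replace (C_derive Ff z0) with (od * recip_psi' c o)%C by (unfold od; field; auto).
  replace (z0 * (od * recip_psi' c o))%C with (z0 * od * recip_psi' c o)%C by ring. now rewrite Emu. }
rewrite EFf in O2.
assert (EW : recip_psi' c o = (- RtoC c * recip_psi c o * log_psi_slope c o / ((1 - o) * (1 - o)))%C).
{ unfold log_psi_slope. field. auto. }
set (W := log_psi_slope c o) in *. set (X := recip_psi c o) in *.
assert (key : (RtoC mu * W * (o * (1 - phi)) = (phi - o) * (1 - o))%C).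
{ assert (k1 : ((1 - o) * (RtoC (1 + mu) * o * recip_psi' c o) - (1 - o) * o * recip_psi' c o
     = ((1 - o + RtoC c * o) - (1 - o) * (1 + RtoC c * phi / (1 - phi))) * X)%C).
  { replace ((1 - o) * (RtoC (1 + mu) * o * recip_psi' c o))%C with
      ((1 - o) * (RtoC (1 + mu) * o * recip_psi' c o + (1 + RtoC c * phi / (1 - phi)) * X)
        - (1 - o) * (1 + RtoC c * phi / (1 - phi)) * X)%C by ring.
    rewrite O2.
    replace ((1 - o) * o * recip_psi' c o)%C with (((1 - o) * o * recip_psi' c o + (1 - o + RtoC c * o) * X) - (1 - o + RtoC c * o) * X)%C by ring.
    rewrite O1. ring. }
  rewrite EW, RtoC_plus in k1.
  (* both sides of k1 are multiplied by the nonzero factor (1 - o)(1 - phi) / (- c X) *)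
  replace (RtoC mu * W * (o * (1 - phi)))%C with
    (((1 - o) * ((1 + RtoC mu) * o * (- RtoC c * X * W / ((1 - o) * (1 - o))))
      - (1 - o) * o * (- RtoC c * X * W / ((1 - o) * (1 - o)))) * ((1 - o) * (1 - phi) / (- RtoC c * X)))%C
    by (field; repeat split; auto).
  rewrite k1. field. repeat split; auto. }
pose proof (horocycle_inequality o phi hod hphi) as hneg.
rewrite <- key in hneg.
replace (RtoC mu * W * (o * (1 - phi)) * Cconj ((1 - phi) * o))%C with
  (RtoC (mu * Cmod ((1 - phi) * o) ^ 2) * W)%C in hneg
  by (rewrite RtoC_mult, Cmod2_conj; ring).
rewrite Re_RtoC_mult in hneg.
assert (0 <= mu * Cmod ((1 - phi) * o) ^ 2) by (apply Rmult_le_pos; [auto|apply pow2_ge_0]).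
assert (0 <= mu * Cmod ((1 - phi) * o) ^ 2 * Re W) by (apply Rmult_le_pos; lra). lra.
Qed.

End Radial_bound.

(* kappa tends to 1 *)
Lemma subordinating_function_spec z : unit_disc z ->
  recip_psi c (omega z) = Ff z /\ Cmod (omega z) <= Cmod z.
Proof.
intros hz. unfold unit_disc in hz. destruct (Ceq_dec z 0) as [->|hne].
- rewrite (omega_eq 0 0) by (auto; rewrite recip_psi_0, recip_log_deriv_0; auto). 
  rewrite recip_psi_0, recip_log_deriv_0 by auto. split; auto. lra.
- assert (hp : 0 < Cmod z) by now apply Cmod_gt_0.
  assert (key : forall kappa, 1 < kappa -> kappa * Cmod z < 1 ->
    recip_psi c (omega z) = Ff z /\ Cmod (omega z) < kappa * Cmod z).
  { intros kappa h1 h2. destruct (radial_bound z kappa h1 h2 hne) as [o [k1 k2]].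
    rewrite (omega_eq z o) by (auto; unfold unit_disc; lra). auto. }
  set (k0 := (1 + / Cmod z) / 2).
  assert (hi : 1 < / Cmod z) by (rewrite <- Rinv_1; apply Rinv_lt_contravar; lra).
  assert (hiz : / Cmod z * Cmod z = 1) by (apply Rinv_l; lra).
  split; [apply (key k0); unfold k0; nra|].
  apply Rnot_lt_le. intros hlt.
  set (k := Rmin k0 (Cmod (omega z) / Cmod z)).
  assert (hq : 1 < Cmod (omega z) / Cmod z).
  { apply Rlt_div_r; lra. }
  assert (hk1 : k <= k0) by apply Rmin_l. assert (hk2 : k <= Cmod (omega z) / Cmod z) by apply Rmin_r.
  destruct (key k) as [_ q].
  + unfold k. apply Rmin_glb_lt; auto. unfold k0. lra.
  + apply Rle_lt_trans with (k0 * Cmod z); [apply Rmult_le_compat_r; lra|]. unfold k0. nra.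
  + apply Rle_div_r in hk2; lra.
Qed.

Lemma subordinating_function_C1 : C1_on unit_disc omega.
Proof.
exists (fun z => C_derive Ff z / recip_psi' c (omega z))%C. intros z hz.
destruct (subordinating_function_spec z hz) as [h1 h2].
assert (ho : unit_disc (omega z)) by (unfold unit_disc in *; lra).
destruct (omega_deriv z (omega z) hz ho h1) as [k1 k2]. split; auto.
apply ccont_div.
- apply (recip_log_deriv_C1 z hz).
- apply (ccont_comp (recip_psi' c) omega); auto. eapply has_deriv_cont. now apply recip_psi'_deriv.
- now apply recip_psi'_neq_0.
Qed.

End Subordination.

(** * The coefficient inequality *)

(** Two solutions of this linear equation differ by a multiple of [(1 - z)^c].
    The closed formulas for [psi] are recognised through it. *)
Lemma recip_psi_characterization c Y : 0 < c <= 2 -> Y (RtoC 0) = RtoC 0 ->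
  (forall z, unit_disc z -> has_deriv Y z (1 - RtoC c * Y z / (1 - z))%C) ->
  forall z, unit_disc z -> Y z = (z * recip_psi c z)%C.
Proof.
intros hc hY0 hY z hz.
set (E := fun w => ((w * recip_psi c w - Y w) * Cpowr (1 - w) (- c))%C).
assert (hE : E z = E (RtoC 0)).
{ apply (zero_deriv_constant E 0 1).
  - intros w hw. replace (w - 0)%C with w in hw by ring.
    pose proof (one_minus_neq_0 w hw) as n.
    eapply has_deriv_eq.
    + apply has_deriv_mult; [|now apply has_deriv_Cpowr_one_minus].
      apply has_deriv_minus; [|now apply hY].
      apply has_deriv_mult; [apply has_deriv_id|now apply recip_psi_deriv].
    + cbv beta. rewrite RtoC_opp.
      pose proof (recip_psi_ode c hc w hw) as O.
      assert (O' : (w * recip_psi' c w = 1 - (1 + RtoC c * w / (1 - w)) * recip_psi c w)%C).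
      { replace (w * recip_psi' c w)%C with (((1 - w) * w * recip_psi' c w + (1 - w + RtoC c * w) * recip_psi c w
          - (1 - w + RtoC c * w) * recip_psi c w) / (1 - w))%C by (field; auto).
        rewrite O. field. auto. }
      rewrite O'. field. auto.
  - replace (z - 0)%C with z by ring. exact hz. }
unfold E in hE. rewrite hY0 in hE.
replace ((0 * recip_psi c 0 - 0) * Cpowr (1 - 0) (- c))%C with (RtoC 0) in hE by ring.
pose proof (Cpowr_neq_0 (1 - z) (- c)) as n.
replace (Y z) with (z * recip_psi c z - (z * recip_psi c z - Y z) * Cpowr (1 - z) (- c) / Cpowr (1 - z) (- c))%C by (field; auto).
rewrite hE. field. auto.
Qed.

Lemma psi_recip c z : 0 < c <= 2 -> unit_disc z -> psi c z = (/ recip_psi c z)%C.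
Proof.
intros hc hz. unfold psi. destruct (Ceq_dec z 0) as [->|hne].
{ rewrite recip_psi_0 by auto. field. }
pose proof (recip_psi_neq_0 c hc z hz) as n1. pose proof (one_minus_neq_0 z hz) as n2.
assert (nzF : (z * recip_psi c z)%C <> RtoC 0) by now apply Cmult_neq_0.
destruct (Req_EM_T c 1) as [e|n].
- assert (E : (- (1 - z) * Clog (1 - z))%C = (z * recip_psi c z)%C).
  { apply (recip_psi_characterization c (fun z => - (1 - z) * Clog (1 - z))%C hc); auto.
    - replace (1 - 0)%C with (RtoC 1) by ring. rewrite Clog_1. ring.
    - intros w hw. pose proof (one_minus_neq_0 w hw). eapply has_deriv_eq.
      + apply has_deriv_mult; [|now apply has_deriv_Clog_one_minus].
        apply has_deriv_opp, has_deriv_minus; [apply has_deriv_const|apply has_deriv_id].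
      + cbv beta. rewrite e. field. auto. }
  replace ((1 - z) * Clog (1 - z))%C with (- (- (1 - z) * Clog (1 - z)))%C by ring.
  rewrite E. field. auto.
- assert (nc : RtoC (c - 1) <> RtoC 0) by (apply RtoC_neq; lra).
  assert (E : ((1 - z) * (1 - Cpowr (1 - z) (c - 1)) / RtoC (c - 1))%C = (z * recip_psi c z)%C).
  { apply (recip_psi_characterization c (fun z => (1 - z) * (1 - Cpowr (1 - z) (c - 1)) / RtoC (c - 1))%C hc); auto.
    - replace (1 - 0)%C with (RtoC 1) by ring. rewrite Cpowr_1_l. unfold Cdiv. ring.
    - intros w hw. pose proof (one_minus_neq_0 w hw). eapply has_deriv_eq.
      + unfold Cdiv. apply has_deriv_mult; [|apply has_deriv_const].
        apply has_deriv_mult; (apply has_deriv_minus; [apply has_deriv_const|]);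
          [apply has_deriv_id|now apply has_deriv_Cpowr_one_minus].
      + cbv beta. rewrite RtoC_minus in *. field. auto. }
  assert (n3 : (1 - Cpowr (1 - z) (c - 1))%C <> RtoC 0).
  { intros e. apply nzF. rewrite <- E, e. unfold Cdiv. ring. }
  replace (/ recip_psi c z)%C with (z / (z * recip_psi c z))%C by (field; auto).
  rewrite <- E. field. auto.
Qed.

Lemma expansion_psum g a0 a : expansion_at_0 g a0 a -> exists r, 0 < r /\
  forall z, Cmod z < r -> psum (fun n => match n with O => a0 | S _ => a n end) z (g z).
Proof.
intros [r [hr h]]. exists r. split; auto. intros z hz. now apply is_pseries_psum, h.
Qed.

Section Coefficients.

Variables (c : R) (D : nat -> C).
Hypothesis hc : 0 < c <= 2.
Hypothesis hD : expansion_at_0 (psi c) (RtoC 1) D.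

(* z L' + 1 = z f' / f, by differentiating f z = z exp (L z) *)
Let z_L' f gamma L : class_F c f -> 
  (exists r, 0 < r /\ forall z, z <> RtoC 0 -> Cmod z < r -> Cexp (L z) = (f z / z)%C) ->
  expansion_at_0 L (RtoC 0) (fun n => RtoC 2 * gamma n)%C ->
  near 0 (fun z => psum (deriv_coeffs (fun n => RtoC 2 * gamma n)%C) z (C_derive L z) /\
    (z * C_derive L z + 1 = / recip_log_deriv f z)%C).
Proof.
intros hf [r1 [hr1 hexp]] hL. destruct (expansion_psum _ _ _ hL) as [r2 [hr2 h]].
set (r := Rmin (Rmin r1 r2) 1). assert (hr : 0 < r) by (unfold r; repeat apply Rmin_pos; lra).
assert (q1 : r <= r1) by (unfold r; Rmin_le).
assert (q2 : r <= r2) by (unfold r; Rmin_le).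
assert (q3 : r <= 1) by apply Rmin_r.
exists r. split; auto. intros z hz. replace (z - 0)%C with z in hz by ring.
destruct (psum_C_derive _ L r2 h z ltac:(lra)) as [k1 k2]. split.
{ exact k1. }
unfold recip_log_deriv. destruct (Ceq_dec z 0) as [->|n]; [field|].
assert (hzd : unit_disc z) by (unfold unit_disc; lra).
pose proof (proj1 (proj2 hf z hzd)) as nf.
pose proof (analytic_has_deriv f z (proj1 (proj1 hf) z hzd)) as kf.
assert (E : C_derive f z = (Cexp (L z) * (z * C_derive L z + 1))%C).
{ apply (has_deriv_unique f z); auto.
  apply has_deriv_ext with (fun w => w * Cexp (L w))%C.
  - generalize (near_and (near_neq z 0 n) (near_disc z r hz)). apply near_imp. intros w [h1 h2].
    rewrite hexp by (auto; lra). field. auto.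
  - eapply has_deriv_eq.
    + apply has_deriv_mult; [apply has_deriv_id|]. apply (has_deriv_comp Cexp L); [apply has_deriv_Cexp|exact k2].
    + cbv beta; ring. }
pose proof (Cexp_neq_0 (L z)) as ne.
assert (Ef : f z = (z * Cexp (L z))%C).
{ rewrite hexp by (auto; lra). field. auto. }
rewrite E in *. rewrite Ef. field. repeat split; auto.
intros e. apply nf. rewrite e. ring.
Qed.

(** Near the origin [psi (omega z) - 1 = z L' z], whose coefficients are
    [2 n gamma n]. *)
Theorem log_coefficient_square_sums f gamma : class_F c f -> log_coefficients f gamma ->
  forall N, rsum (fun k => INR (S k) ^ 2 * Cmod (gamma (S k)) ^ 2) N
    <= rsum (fun k => 1 / 4 * Cmod (D (S k)) ^ 2) N.
Proof.
intros hf [L [hL0 [hexp hL]]] N.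
set (a := deriv_coeffs (fun n => RtoC 2 * gamma n)%C).
destruct (z_L' f gamma L hf hexp hL) as [r1 [hr1 h1]].
destruct (expansion_psum _ _ _ hD) as [r2 [hr2 h2]].
set (om := subordinating_function c f).
assert (spec : forall z, unit_disc z -> recip_psi c (om z) = recip_log_deriv f z /\ Cmod (om z) <= Cmod z).
{ intros z hz. now apply (subordinating_function_spec c f hc hf). }
assert (H : rsum (fun k => Cmod (a k) ^ 2) N <= rsum (fun k => Cmod (D (S k)) ^ 2) N).
{ apply (rogosinski_inequality om a (fun k => D (S k)) N).
  - apply Cmod_eq_0. apply Rle_antisym; [|apply Cmod_ge_0].
    destruct (spec 0 zero_in_unit_disc) as [_ k]. now rewrite Cmod_0 in k.
  - now apply (subordinating_function_C1 c f hc hf).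
  - intros z hz. destruct (spec z hz) as [_ k]. unfold unit_disc in hz. lra.
  - (* psi (om z) - 1 = z L'(z); both sides are cut at order N *)
    destruct (psum_remainder a (C_derive L) r1 hr1) with (N := N) as [K1 [e1 [he1 [hK1 b1]]]].
    { intros z hz. apply h1. now replace (z - 0)%C with z by ring. }
    destruct (psum_remainder _ (psi c) r2 hr2 h2 (S N)) as [K2 [e2 [he2 [hK2 b2]]]].
    set (e := Rmin (Rmin r1 1) (Rmin e1 e2)).
    assert (he : 0 < e) by (unfold e; repeat apply Rmin_pos; lra).
    assert (q1 : e <= r1) by (unfold e; Rmin_le).
    assert (q2 : e <= 1) by (unfold e; Rmin_le).
    assert (q3 : e <= e1) by (unfold e; Rmin_le).
    assert (q4 : e <= e2) by (unfold e; Rmin_le).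
    exists (K1 + K2), e. split; auto. intros z hz.
    assert (hzd : unit_disc z) by (unfold unit_disc; lra).
    destruct (spec z hzd) as [s1 s2]. pose proof (Cmod_ge_0 z) as hz0. pose proof (Cmod_ge_0 (om z)) as hom0.
    assert (homd : unit_disc (om z)) by (unfold unit_disc in *; lra).
    destruct (h1 z) as [_ k1]. { replace (z - 0)%C with z by ring. lra. }
    specialize (b1 z ltac:(lra)). specialize (b2 (om z) ltac:(lra)).
    rewrite csum_S_l, psi_recip, s1, <- k1 in b2 by auto.
    set (P := csum (fun k => a k * z ^ k)%C N) in *.
    set (Q := csum (fun k => D (S k) * om z ^ k)%C N).
    replace (csum (fun k => D (S k) * om z ^ S k)%C N) with (om z * Q)%C in b2.
    2:{ unfold Q. rewrite <- csum_scal. apply csum_ext. intros; cbn [Cpow]; ring. }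
    replace (csum (fun k => a k * z ^ S k)%C N) with (z * P)%C.
    2:{ unfold P. rewrite <- csum_scal. apply csum_ext. intros; cbn [Cpow]; ring. }
    set (l := C_derive L z) in *.
    replace (om z * Q - z * P)%C with (z * (l - P) - (z * l + 1 - (1 * om z ^ 0 + om z * Q)))%C by (cbn [Cpow]; ring).
    eapply Rle_trans; [apply Cmod_triangle|]. rewrite Cmod_opp, Cmod_mult, Rmult_plus_distr_r.
    apply Rplus_le_compat.
    + replace (K1 * Cmod z ^ S N) with (Cmod z * (K1 * Cmod z ^ N)) by (cbn; ring).
      now apply Rmult_le_compat_l.
    + eapply Rle_trans; [exact b2|]. apply Rmult_le_compat_l; auto. apply pow_incr. auto. }
rewrite rsum_scal.
apply Rmult_le_reg_l with 4; [lra|]. rewrite <- rsum_scal.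
replace (4 * (1 / 4 * rsum (fun k => Cmod (D (S k)) ^ 2) N)) with (rsum (fun k => Cmod (D (S k)) ^ 2) N) by field.
eapply Rle_trans; [|exact H]. right. apply rsum_ext. intros k _.
unfold a, deriv_coeffs. rewrite !Cmod_mult, !Cmod_R, !Rabs_pos_eq; [ring|lra|apply pos_INR].
Qed.

End Coefficients.

(** * The extremal function *)

(** The integrated series converges, and its sum has the same derivative as [k]. *)
Lemma psum_antiderivative a g k z0 r : 0 < r ->
  (forall w, Cmod w < r -> psum a w (g w)) ->
  (forall w, Cmod w < r -> has_deriv k (z0 + w)%C (g w)) ->
  forall w, Cmod w < r ->
    psum (fun n => match n with O => k z0 | S m => a m / RtoC (INR (S m)) end)%C w (k (z0 + w)%C).
Proof.
intros hr ha hk.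
set (b := fun n => match n with O => k z0 | S m => (a m / RtoC (INR (S m)))%C end).
set (H := fun w => epsilon (inhabits (RtoC 0)) (psum b w)).
assert (hH : forall w, Cmod w < r -> psum b w (H w)).
{ intros w hw. apply (epsilon_spec (inhabits (RtoC 0)) (psum b w)).
  set (rho := (Cmod w + r) / 2). pose proof (Cmod_ge_0 w).
  destruct (psum_coeff_bound a (RtoC rho) (g (RtoC rho)) rho) as [M [hM hb]].
  { rewrite Cmod_R, Rabs_pos_eq; unfold rho; lra. }
  { apply ha. rewrite Cmod_R, Rabs_pos_eq; unfold rho; lra. }
  pose proof (Cmod_ge_0 (k z0)).
  assert (hrho : 0 < rho) by (unfold rho; lra).
  destruct (psum_converges b rho (M * rho + Cmod (k z0) + 1)) with (z := w) as [l [hl _]].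
  - unfold rho; lra.
  - assert (0 < M * rho) by (apply Rmult_lt_0_compat; lra). lra.
  - intros n. assert (0 < M * rho) by (apply Rmult_lt_0_compat; lra). destruct n; cbn [b].
    + cbn. lra.
    + rewrite Cmod_div by (apply RtoC_INR_neq_0; lia). rewrite Cmod_R, Rabs_pos_eq by apply pos_INR.
      specialize (hb n). assert (1 <= INR (S n)) by (apply (le_INR 1); lia).
      assert (/ INR (S n) <= 1) by (rewrite <- Rinv_1; apply Rinv_le_contravar; lra).
      assert (0 < / INR (S n)) by (apply Rinv_0_lt_compat; lra).
      pose proof (Cmod_ge_0 (a n)). assert (0 <= rho ^ n) by (apply pow_le; lra).
      assert (0 <= Cmod (a n) * rho ^ n) by (apply Rmult_le_pos; auto).
      cbn [pow]. replace (Cmod (a n) / INR (S n) * (rho * rho ^ n)) with ((Cmod (a n) * rho ^ n) * rho * / INR (S n)) by (unfold Rdiv; ring).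
      apply Rle_trans with (M * rho * 1); [|lra].
      apply Rmult_le_compat; try lra. { apply Rmult_le_pos; lra. } apply Rmult_le_compat_r; lra.
  - unfold rho; lra.
  - now exists l. }
assert (E : forall w, Cmod w < r -> k (z0 + w)%C = H w).
{ intros w hw.
  assert (K : (k (z0 + w) - H w = k (z0 + 0) - H 0)%C).
  { apply (zero_deriv_constant (fun w => k (z0 + w) - H w)%C 0 r).
    - intros v hv. replace (v - 0)%C with v in hv by ring.
      destruct (psum_has_deriv b H r hH v hv) as [l [h1 h2]].
      assert (l = g v).
      { eapply cseries_unique; [exact h1|]. eapply cseries_ext; [|exact (ha v hv)].
        intros n. unfold deriv_coeffs, b. cbv beta. field. apply RtoC_INR_neq_0. lia. }
      subst l. eapply has_deriv_eq.
      + apply has_deriv_minus; [|exact h2].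
        apply (has_deriv_comp k (fun v => z0 + v)%C); [now apply hk|].
        apply has_deriv_plus; [apply has_deriv_const|apply has_deriv_id].
      + ring.
    - now replace (w - 0)%C with w by ring. }
  rewrite (psum_at_0 b (H (RtoC 0))) in K by (apply hH; rewrite Cmod_0; auto).
  cbn [b] in K. replace (z0 + 0)%C with z0 in K by ring.
  replace (k (z0 + w)%C) with (k (z0 + w) - H w + H w)%C by ring. rewrite K. ring. }
intros w hw. rewrite E by auto. now apply hH.
Qed.

Fixpoint binomial_coef (c : R) (n : nat) : R :=
  match n with O => 1 | S m => (INR m + c) / (INR m + 1) * binomial_coef c m end.

Section Extremal.

Variable c : R.
Hypothesis hc : 0 < c <= 2.

Let B (z : C) : C := Cpowr (1 - z) (- c).

Let binomial_coef_bound n : 0 < binomial_coef c n <= INR n + 1.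
Proof.
induction n; [cbn; lra|].
change (binomial_coef c (S n)) with ((INR n + c) / (INR n + 1) * binomial_coef c n).
rewrite S_INR. pose proof (pos_INR n).
assert (0 < (INR n + c) / (INR n + 1)) by (apply Rdiv_lt_0_compat; lra).
split; [apply Rmult_lt_0_compat; lra|].
apply Rle_trans with ((INR n + c) / (INR n + 1) * (INR n + 1)); [apply Rmult_le_compat_l; lra|].
replace ((INR n + c) / (INR n + 1) * (INR n + 1)) with (INR n + c) by (field; lra). lra.
Qed.

Let binomial_series (z : C) : C :=
  epsilon (inhabits (RtoC 0)) (psum (fun n => RtoC (binomial_coef c n)) z).

Let binomial_series_psum z : Cmod z < 1 -> psum (fun n => RtoC (binomial_coef c n)) z (binomial_series z).
Proof.
intros hz. apply (epsilon_spec (inhabits (RtoC 0)) (psum (fun n => RtoC (binomial_coef c n)) z)).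
pose proof (Cmod_ge_0 z). set (rho := (Cmod z + 1) / 2).
destruct (INR_mult_pow_le rho 1) as [K [hK h]]. { unfold rho; lra. }
destruct (psum_converges (fun n => RtoC (binomial_coef c n)) rho (K + 1)) with (z := z) as [l [hl _]];
  try (unfold rho; lra).
- intros n. specialize (h n). rewrite pow1, Rmult_1_r in h.
  destruct (binomial_coef_bound n). rewrite Cmod_R, Rabs_pos_eq by lra.
  assert (0 <= rho ^ n) by (apply pow_le; unfold rho; lra).
  assert (rho ^ n <= 1) by (rewrite <- (pow1 n); apply pow_incr; unfold rho; lra).
  apply Rle_trans with ((INR n + 1) * rho ^ n); [apply Rmult_le_compat_r; auto|]. lra.
- now exists l.
Qed.

Let binomial_series_ode z : Cmod z < 1 -> exists l, has_deriv binomial_series z l /\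
  ((1 - z) * l = RtoC c * binomial_series z)%C.
Proof.
intros hz. destruct (psum_has_deriv _ _ 1 binomial_series_psum z hz) as [l [h1 h2]].
exists l. split; auto.
set (b := fun n => RtoC (binomial_coef c n)) in *.
assert (hzl : cseries (fun n => RtoC (INR n) * b n * z ^ n)%C (z * l)%C).
{ replace (z * l)%C with (RtoC (INR 0) * b O * z ^ 0 + z * l)%C by (cbn; ring).
  apply (cseries_shift (fun n => RtoC (INR n) * b n * z ^ n)%C).
  eapply cseries_ext; [|apply cseries_scal, h1].
  intros n. cbv beta. unfold deriv_coeffs. cbn [Cpow]. ring. }
assert (E : l = (z * l + RtoC c * binomial_series z)%C).
{ eapply cseries_unique; [exact h1|].
  eapply cseries_ext; [|apply cseries_plus; [exact hzl|apply cseries_scal, (binomial_series_psum z hz)]].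
  intros n. cbv beta. unfold deriv_coeffs, b.
  assert (R1 : INR (S n) * binomial_coef c (S n) = (INR n + c) * binomial_coef c n).
  { change (binomial_coef c (S n)) with ((INR n + c) / (INR n + 1) * binomial_coef c n).
    rewrite S_INR. pose proof (pos_INR n). field. lra. }
  apply (f_equal RtoC) in R1. rewrite !RtoC_mult, RtoC_plus in R1. rewrite R1. ring. }
replace ((1 - z) * l)%C with (l - z * l)%C by ring. rewrite E at 1. ring.
Qed.

Let B_neq_0 z : B z <> RtoC 0.
Proof. apply Cpowr_neq_0. Qed.

Let B_deriv z : unit_disc z -> has_deriv B z (RtoC c * B z / (1 - z))%C.
Proof.
intros hz. eapply has_deriv_eq; [now apply has_deriv_Cpowr_one_minus|].
fold (B z). rewrite RtoC_opp. field. now apply one_minus_neq_0.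
Qed.

(** Around [z0] the power [(1 - z)^(-c)] is its value at [z0] times the binomial
    series in [w / (1 - z0)]: the quotient of the two has derivative zero. *)
Let B_expansion z0 w : unit_disc z0 -> Cmod w < 1 - Cmod z0 ->
  psum (fun n => B z0 * RtoC (binomial_coef c n) * / (1 - z0) ^ n)%C w (B (z0 + w)%C).
Proof.
intros hz hw. pose proof (one_minus_neq_0 z0 hz) as ns. set (s := (1 - z0)%C) in *.
assert (hs : 1 - Cmod z0 <= Cmod s).
{ unfold s. pose proof (Cmod_triangle_rev 1 z0). rewrite Cmod_1 in H. lra. }
assert (hx : forall v, Cmod v < 1 - Cmod z0 -> Cmod (v / s) < 1).
{ intros v hv. rewrite Cmod_div by auto. unfold unit_disc in hz.
  apply Rlt_div_l; lra. }
assert (hin : forall v, Cmod v < 1 - Cmod z0 -> unit_disc (z0 + v)).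
{ intros v hv. unfold unit_disc. pose proof (Cmod_triangle z0 v). lra. }
set (G := fun v => (binomial_series (v / s) / B (z0 + v))%C).
assert (hG : G w = G (RtoC 0)).
{ apply (zero_deriv_constant G 0 (1 - Cmod z0)).
  - intros v hv. replace (v - 0)%C with v in hv by ring.
    destruct (binomial_series_ode _ (hx v hv)) as [l [k1 k2]].
    pose proof (one_minus_neq_0 _ (hin v hv)) as n1.
    pose proof (B_neq_0 (z0 + v)) as n2.
    assert (k3 : (l = RtoC c * binomial_series (v / s) * s / (1 - (z0 + v)))%C).
    { rewrite <- k2. replace (1 - v / s)%C with ((1 - (z0 + v)) / s)%C by (unfold s; field; auto).
      field. auto. }
    eapply has_deriv_eq.
    + apply has_deriv_div; [| |exact n2].
      * apply (has_deriv_comp binomial_series (fun v => v / s)%C); [exact k1|].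
        unfold Cdiv. apply has_deriv_mult; [apply has_deriv_id|apply has_deriv_const].
      * apply (has_deriv_comp B (fun v => z0 + v)%C); [now apply B_deriv, hin|].
        apply has_deriv_plus; [apply has_deriv_const|apply has_deriv_id].
    + cbv beta. rewrite k3. field. auto.
  - now replace (w - 0)%C with w by ring. }
assert (S0 : binomial_series 0 = RtoC 1).
{ rewrite (psum_at_0 _ _ (binomial_series_psum 0 zero_in_unit_disc)). reflexivity. }
unfold G in hG. replace (z0 + 0)%C with z0 in hG by ring.
replace (0 / s)%C with (RtoC 0) in hG by (field; auto). rewrite S0 in hG.
pose proof (B_neq_0 z0). pose proof (B_neq_0 (z0 + w)).
assert (E : B (z0 + w)%C = (B z0 * binomial_series (w / s))%C).
{ replace (binomial_series (w / s)) with (binomial_series (w / s) / B (z0 + w) * B (z0 + w))%C by (field; auto).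
  rewrite hG. field. auto. }
rewrite E. unfold psum.
eapply cseries_ext; [|apply cseries_scal, (binomial_series_psum _ (hx w hw))].
intros n. cbv beta. unfold Cdiv. rewrite Cpow_mult_l, Cpow_inv by auto. ring.
Qed.

(** The solution of [f' = (1 - z)^(-c)], for which [z f' / f = psi c]; written in
    this way it needs no separate formula for [c = 1]. *)
Definition extremal_function (z : C) : C := (z * recip_psi c z * Cpowr (1 - z) (- c))%C.

Let extremal_deriv z : unit_disc z -> has_deriv extremal_function z (B z).
Proof.
intros hz. pose proof (one_minus_neq_0 z hz) as n. eapply has_deriv_eq.
- apply has_deriv_mult; [|exact (B_deriv z hz)].
  apply has_deriv_mult; [apply has_deriv_id|now apply recip_psi_deriv].
- cbv beta. fold (B z).
  pose proof (recip_psi_ode c hc z hz) as O.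
  replace ((1 * recip_psi c z + z * recip_psi' c z) * B z + z * recip_psi c z * (RtoC c * B z / (1 - z)))%C with
   (B z * ((1 - z) * z * recip_psi' c z + (1 - z + RtoC c * z) * recip_psi c z) / (1 - z))%C by (field; auto).
  rewrite O. field. auto.
Qed.

Lemma extremal_class_F : class_F c extremal_function.
Proof.
assert (hd : forall z, unit_disc z -> C_derive extremal_function z = B z).
{ intros z hz. now apply has_deriv_C_derive, extremal_deriv. }
split; [split; [|split]|].
- intros z0 hz. apply analytic_at_psum. unfold unit_disc in hz.
  eexists. exists (1 - Cmod z0). split; [lra|].
  apply (psum_antiderivative (fun n => B z0 * RtoC (binomial_coef c n) * / (1 - z0) ^ n)%C
    (fun w => B (z0 + w)%C)); [lra| |].
  + intros w hw. now apply B_expansion.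
  + intros w hw. apply extremal_deriv. unfold unit_disc. pose proof (Cmod_triangle z0 w). lra.
- unfold extremal_function. ring.
- rewrite hd by apply zero_in_unit_disc. unfold B. replace (1 - 0)%C with (RtoC 1) by ring.
  apply Cpowr_1_l.
- intros z hz. pose proof (one_minus_neq_0 z hz) as n. rewrite hd by auto. split; [apply B_neq_0|].
  assert (h2 : C_derive (C_derive extremal_function) z = (RtoC c * B z / (1 - z))%C).
  { apply has_deriv_C_derive. apply has_deriv_ext with B; [|now apply B_deriv].
    generalize (near_disc z 1 hz). apply near_imp. intros w hw. symmetry. now apply hd. }
  rewrite h2.
  replace (1 + z * (RtoC c * B z / (1 - z)) / B z)%C with (RtoC (1 - c) + RtoC c * / (1 - z))%C
    by (rewrite RtoC_minus; field; auto).
  change (1 - c + Re (RtoC c * / (1 - z))%C > 1 - c / 2). rewrite Re_RtoC_mult.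
  pose proof (half_lt_Re_inv_one_minus z hz).
  assert (c * / 2 < c * Re (/ (1 - z))%C) by (apply Rmult_lt_compat_l; lra). lra.
Qed.

(* log (f z / z) = log (F z) - c log (1 - z) has derivative (psi z - 1) / z *)
Lemma extremal_log_coefficients D : expansion_at_0 (psi c) (RtoC 1) D ->
  log_coefficients extremal_function (fun n => D n / (RtoC 2 * RtoC (INR n)))%C.
Proof.
intros hD. destruct (expansion_psum _ _ _ hD) as [r0 [hr0 h0]].
set (r := Rmin r0 1). assert (hr : 0 < r) by (apply Rmin_pos; lra).
assert (q1 : r <= r0) by apply Rmin_l. assert (q2 : r <= 1) by apply Rmin_r.
set (L := fun z => (Clog (recip_psi c z) - RtoC c * Clog (1 - z))%C).
set (L' := fun z => (recip_psi' c z / recip_psi c z + RtoC c / (1 - z))%C).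
assert (hL : forall z, unit_disc z -> has_deriv L z (L' z)).
{ intros z hz. pose proof (one_minus_neq_0 z hz). pose proof (recip_psi_neq_0 c hc z hz). eapply has_deriv_eq.
  - apply has_deriv_minus; [|apply has_deriv_scal; now apply has_deriv_Clog_one_minus].
    apply (has_deriv_comp Clog (recip_psi c)); [now apply has_deriv_Clog, recip_psi_Re_pos|now apply recip_psi_deriv].
  - unfold L'. field. auto. }
assert (L0 : L (RtoC 0) = RtoC 0).
{ unfold L. rewrite recip_psi_0 by auto. replace (1 - 0)%C with (RtoC 1) by ring. rewrite Clog_1. ring. }
assert (D1 : D 1%nat = RtoC (c / 2)).
{ destruct (psum_has_deriv _ (psi c) r0 h0 0) as [l [k1 k2]]; [now rewrite Cmod_0|].
  apply psum_at_0 in k1. unfold deriv_coeffs in k1. cbn [INR] in k1.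
  transitivity l; [rewrite k1; ring|]. apply (has_deriv_unique (psi c) 0); auto.
  eapply has_deriv_eq.
  - apply has_deriv_ext with (fun z => / recip_psi c z)%C.
    + generalize (near_disc 0 1 zero_in_unit_disc). apply near_imp. intros w hw. symmetry. now apply psi_recip.
    + apply has_deriv_inv; [apply recip_psi_deriv; auto; apply zero_in_unit_disc|].
      apply recip_psi_neq_0; auto. apply zero_in_unit_disc.
  - rewrite recip_psi_0, recip_psi'_0 by auto. replace (- c / 2) with (- (c / 2)) by field. rewrite RtoC_opp. field. }
assert (hL' : forall z, Cmod z < r -> psum (fun n => D (S n)) z (L' z)).
{ intros z hz. assert (hzd : unit_disc z) by (unfold unit_disc; lra).
  pose proof (one_minus_neq_0 z hzd) as n1. pose proof (recip_psi_neq_0 c hc z hzd) as n2.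
  destruct (Ceq_dec z 0) as [->|n].
  - replace (L' (RtoC 0)) with (D 1%nat).
    + apply (psum_0 (fun n => D (S n))).
    + rewrite D1. unfold L'. rewrite recip_psi_0, recip_psi'_0 by auto.
      replace (- c / 2) with (- (c / 2)) by field. rewrite RtoC_opp.
      replace (RtoC c) with (RtoC (c / 2) + RtoC (c / 2))%C by (rewrite <- RtoC_plus; f_equal; field).
      replace (1 - 0)%C with (RtoC 1) by ring. field.
  - assert (E : L' z = (/ z * (psi c z - 1))%C).
    { rewrite psi_recip by auto. unfold L'.
      pose proof (recip_psi_ode c hc z hzd) as O.
      replace (recip_psi' c z / recip_psi c z + RtoC c / (1 - z))%C with
       ((((1 - z) * z * recip_psi' c z + (1 - z + RtoC c * z) * recip_psi c z) - (1 - z) * recip_psi c z) / (z * (1 - z) * recip_psi c z))%C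
       by (field; auto).
      rewrite O. field. auto. }
    rewrite E.
    assert (k : cseries (fun n => D (S n) * z ^ S n)%C (psi c z - 1)%C).
    { apply (cseries_shift (fun n => match n with O => RtoC 1 | S _ => D n end * z ^ n)%C).
      replace (1 * z ^ 0 + (psi c z - 1))%C with (psi c z) by (cbn [Cpow]; ring).
      apply h0. lra. }
    unfold psum. eapply cseries_ext; [|apply cseries_scal, k].
    intros m. cbn [Cpow]. field. auto. }
exists L. split; [exact L0|]. split.
- exists 1. split; [lra|]. intros z n hz. unfold L, extremal_function.
  replace (Clog (recip_psi c z) - RtoC c * Clog (1 - z))%C with (Clog (recip_psi c z) + RtoC (- c) * Clog (1 - z))%C
    by (rewrite RtoC_opp; ring).
  rewrite Cexp_plus, Cexp_Clog by (now apply recip_psi_neq_0). unfold Cpowr. field. auto.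
- exists r. split; auto. intros z hz. apply is_pseries_psum.
  pose proof (psum_antiderivative (fun n => D (S n)) L' L 0 r hr hL') as A.
  unfold psum. eapply cseries_ext; [|replace (L z) with (L (0 + z)%C) by (f_equal; ring); apply A; auto].
  + intros n. cbv beta. destruct n; [now rewrite L0|].
    f_equal. field. apply RtoC_INR_neq_0. lia.
  + intros w hw. replace (0 + w)%C with w by ring. apply hL. unfold unit_disc. lra.
Qed.

End Extremal.

(** * Summation by parts *)

Lemma sum_n_m_rsum (u : nat -> R) N : sum_n_m u 1 N = rsum (fun k => u (S k)) N.
Proof.
induction N.
- now rewrite sum_n_m_zero by lia.
- rewrite sum_n_Sm by lia. rewrite IHN. reflexivity.
Qed.

(* the induction needs the difference to be at least w_N times that of the last partial sums *)
Lemma abel_summation_le (w a b : nat -> R) :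
  (forall k, 0 <= w (S k) <= w k) -> 0 <= w O -> (forall N, rsum a N <= rsum b N) ->
  forall N, rsum (fun k => w k * a k) N <= rsum (fun k => w k * b k) N.
Proof.
intros hw hw0 hab.
assert (key : forall N, w N * (rsum b (S N) - rsum a (S N)) <=
   rsum (fun k => w k * b k) (S N) - rsum (fun k => w k * a k) (S N)).
{ induction N; [cbn; lra|].
  cbn [rsum] in *. specialize (hw N). pose proof (hab (S N)) as h. cbn [rsum] in h. nra. }
intros [|N]; [cbn; lra|].
assert (0 <= w N) by (destruct N; [auto|apply hw]).
pose proof (hab (S N)). specialize (key N). nra.
Qed.

(* Rpower q t <= q^2 for the ratio q = (k + 3) / (k + 2) >= 1 *)
Lemma weight_decreasing t k : t <= 2 ->
  Rpower (INR (S (S k) + 1)) t / INR (S (S k)) ^ 2 <= Rpower (INR (S k + 1)) t / INR (S k) ^ 2.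
Proof.
intros ht. rewrite !plus_INR. change (INR 1) with 1. rewrite !S_INR. pose proof (pos_INR k). set (n := INR k) in *.
assert (E : Rpower (n + 1 + 1 + 1) t = Rpower (n + 1 + 1) t * Rpower ((n + 1 + 1 + 1) / (n + 1 + 1)) t).
{ rewrite Rpower_mult_distr; [f_equal; field; lra|lra|apply Rdiv_lt_0_compat; lra]. }
rewrite E.
set (q := (n + 1 + 1 + 1) / (n + 1 + 1)).
assert (hq : 1 <= q).
{ apply Rle_div_r; lra. }
assert (hq2 : Rpower q t <= q ^ 2).
{ rewrite <- (Rpower_pow 2) by lra. apply Rle_Rpower; [auto|cbn; lra]. }
assert (hq3 : q <= (n + 1 + 1) / (n + 1)).
{ unfold q. apply Rmult_le_reg_r with ((n + 1 + 1) * (n + 1)); [nra|].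
  replace ((n + 1 + 1 + 1) / (n + 1 + 1) * ((n + 1 + 1) * (n + 1))) with ((n + 1 + 1 + 1) * (n + 1)) by (field; lra).
  replace ((n + 1 + 1) / (n + 1) * ((n + 1 + 1) * (n + 1))) with ((n + 1 + 1) * (n + 1 + 1)) by (field; lra). nra. }
assert (hq4 : q ^ 2 <= ((n + 1 + 1) / (n + 1)) ^ 2) by (apply pow_incr; lra).
assert (hp : 0 < Rpower (n + 1 + 1) t) by apply exp_pos.
unfold Rdiv at 1. rewrite Rmult_assoc.
apply Rmult_le_compat_l; [lra|].
apply Rmult_le_reg_r with ((n + 1 + 1) ^ 2); [apply pow_lt; lra|].
rewrite Rmult_assoc, Rinv_l, Rmult_1_r by (apply pow_nonzero; lra).
eapply Rle_trans; [exact hq2|]. eapply Rle_trans; [exact hq4|]. right. field. lra.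
Qed.

Theorem theorem2p1 (c : R) (hc : 0 < c <= 2) (D : nat -> C)
    (hD : expansion_at_0 (psi c) (RtoC 1) D) :
  (forall (f : C -> C) (gamma : nat -> C),
     class_F c f -> log_coefficients f gamma ->
     Rbar_le
       (nnSeries1 (fun n => INR n ^ 2 * Cmod (gamma n) ^ 2))
       (Rbar_mult (Finite (1 / 4)) (nnSeries1 (fun n => Cmod (D n) ^ 2)))
     /\
     forall t : R, t <= 2 ->
       Rbar_le
         (nnSeries1 (fun n => Rpower (INR (n + 1)) t * Cmod (gamma n) ^ 2))
         (Rbar_mult (Finite (1 / 4))
            (nnSeries1 (fun n =>
               Rpower (INR (n + 1)) t / INR n ^ 2 * Cmod (D n) ^ 2))))
  /\
  (exists (f : C -> C) (gamma : nat -> C),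
     class_F c f /\ log_coefficients f gamma /\
     nnSeries1 (fun n => INR n ^ 2 * Cmod (gamma n) ^ 2) =
     Rbar_mult (Finite (1 / 4)) (nnSeries1 (fun n => Cmod (D n) ^ 2))).
Proof.
split.
- intros f gamma hf hg.
  pose proof (log_coefficient_square_sums c D hc hD f gamma hf hg) as key.
  split; [|intros t ht]; unfold nnSeries1; rewrite <- Lim_seq_scal_l; apply Lim_seq_le_loc;
    exists O; intros N _; rewrite !sum_n_m_rsum, <- rsum_scal.
  + apply key.
  + pose proof (abel_summation_le (fun k => Rpower (INR (S k + 1)) t / INR (S k) ^ 2) _ _
      (fun k => conj (Rlt_le _ _ (Rdiv_lt_0_compat _ _ (exp_pos _) (pow_lt _ 2 (lt_0_INR _ (Nat.lt_0_succ _)))))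
          (weight_decreasing t k ht))
      (Rlt_le _ _ (Rdiv_lt_0_compat _ _ (exp_pos _) (pow_lt _ 2 (lt_0_INR _ (Nat.lt_0_succ _)))))
      key N) as A.
    eapply Rle_trans; [eapply Rle_trans; [|exact A]|]; right; apply rsum_ext; intros k _.
    * field. apply not_0_INR. lia.
    * field. apply not_0_INR. lia.
- exists (extremal_function c), (fun n => D n / (RtoC 2 * RtoC (INR n)))%C.
  split; [now apply extremal_class_F|]. split; [now apply extremal_log_coefficients|].
  unfold nnSeries1. rewrite <- Lim_seq_scal_l. apply Lim_seq_ext. intros N.
  rewrite !sum_n_m_rsum, <- rsum_scal. apply rsum_ext. intros k _.
  assert (h : 0 < INR (S k)) by (apply lt_0_INR; lia).
  rewrite Cmod_div.
  + rewrite Cmod_mult, !Cmod_R, !Rabs_pos_eq by lra. field. lra.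
  + apply Cmult_neq_0; [apply RtoC_neq; lra|apply RtoC_INR_neq_0; lia].
Qed.
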